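(* Let $\alpha\in\mathbb{R}$ be Diophantine of type $\kappa$, let $\varphi_N(z)=\frac{(z-\alpha)^2}{2N}$, and fix $$\eta\in\left(\max\left(\tfrac{17}{18},\,1-\tfrac{2}{9\kappa}\right),\,1\right].$$ There exists $s=s(\kappa,\eta)>0$ such that for any bounded interval $A\subset\mathbb{R}$, $$\frac{1}{M^{\eta}}\sum_{M\le N\le M+M^{\eta}}R_{2,N}(A;\varphi_N)=|A|+O\left(M^{-s}\right)$$ as $M\to\infty$, where the sum runs over integers $N$ and the implied constant in the remainder depends on $\alpha,\eta,A$.
   Context: An irrational $\alpha\in\mathbb{R}$ is Diophantine of type $\kappa>0$ if there exists $C>0$ such that $\left|\alpha-\frac{p}{q}\right|>\frac{C}{q^{\kappa}}$ for all $p\in\mathbb{Z}$, $q\in\mathbb{N}$ (by Dirichlet's theorem, necessarily $\kappa\ge 2$). For a bounded interval $A\subset\mathbb{R}$ of length $|A|$ and a function $\varphi$, the pair correlation measure is $$R_{2,N}(A;\varphi)=\frac{\#\{(i,j)\in\{1,\dots,N\}^2 : i\neq j,\ \varphi(i)-\varphi(j)\in N^{-1}A+\mathbb{Z}\}}{N}.$$ *)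

(* Defs.v *)
From HB Require Import structures.
From mathcomp Require Import all_boot all_order all_algebra.
From mathcomp Require Import all_classical all_reals all_analysis.

Set Implicit Arguments.
Unset Strict Implicit.
Unset Printing Implicit Defensive.

Import Order.TTheory GRing.Theory Num.Theory.
Import numFieldNormedType.Exports.

Local Open Scope classical_set_scope.
Local Open Scope ring_scope.

(* Lets the Landau notations be used at +oo in R. *)
Canonical pinfty_nbhs_filter_on (R : numFieldType) :=
  FilterType (pinfty_nbhs R) _.

Definition diophantine (R : realType) (kappa alpha : R) : Prop :=
  [/\ irrational alpha, 0 < kappa &
      exists2 C : R, 0 < C &
        forall (p : int) (q : nat), (0 < q)%N ->
          C / q%:R `^ kappa < `|alpha - p%:~R / q%:R| ].

(* (i, j) : 'I_N * 'I_N encodes the pair (i + 1, j + 1) of {1, ..., N}^2. *)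
Definition pair_correlation (R : realType) (N : nat) (A : set R)
    (phi : R -> R) : R :=
  #|[set ij : 'I_N * 'I_N | (ij.1 != ij.2) &&
      ((phi ij.1.+1%:R - phi ij.2.+1%:R) \in
        [set N%:R^-1 * a + m%:~R | a in A & m in [set: int]])]%SET|%:R / N%:R.

Definition boxed_phase (R : realType) (alpha : R) (N : nat) (z : R) : R :=
  (z - alpha) ^+ 2 / (2 * N%:R).

(* Main.v *)
(** Let [phi] be the boxed phase with parameter [N]. For [i = j + u > j] the difference
    [phi i - phi j] lies in [N^-1 [a, b) + Z] iff [u j = l] mod [N] for one of the boundedly many
    integers [l] with [a <= l + u^2/2 - alpha u < b]. Writing [u j = l + m N], one has to count,
    for [N] in a short block and [u] in a block, the points [(m, N)] of a box with [u | m N + l].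
    Smoothing the box by convolutions and detecting the divisibility by additive characters turns
    this into a sum over [r | u] of Ramanujan sums [c_r(m N + l)]. The term [r = 1] is the main
    term. For small [r] the pairs [(u, l)] are equidistributed modulo [r] because [alpha] is
    Diophantine, so the Ramanujan sums cancel. For large [r] completing the sum produces
    Kloosterman sums, for which Kloosterman's elementary fourth moment bound is enough as soon
    as the blocks of [N] have length [H] with [H^4 >= N^(3 + epsilon)]. The loss in that bound is
    [gcd(l, u)], which exceeds a small power of [N] for few pairs only, and is at most about
    [N^(1 - 1/kappa)] by the Diophantine condition. Summing the triangular weights [1 - u/N] over
    [u] gives [(b - a) N / 2]; the pairs with [i < j] contribute the same for [-A], and a general
    interval is squeezed between half-open ones whose lengths differ by a power of [M]. *)
Require Import Defs.
From mathcomp Require Import all_boot all_order all_algebra all_field.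
From mathcomp Require Import all_classical all_reals all_analysis.
From mathcomp Require Import zify ring lra.

Set Implicit Arguments.
Unset Strict Implicit.
Unset Printing Implicit Defensive.

Import Order.TTheory GRing.Theory Num.Theory.
Import numFieldNormedType.Exports.

Local Open Scope classical_set_scope.
Local Open Scope ring_scope.

(** * Character sums over finite rings *)

(** All errors are measured by one scale [K = K1 ^ 2], where [K1] is the integer part of a small
    fixed power of [M] and bounds the divisor function. Block and smoothing lengths are [N] or [H]
    divided by powers of [K], moduli up to [K ^ 100] count as small, common divisors up to [K ^ 11]
    as harmless. The exponents only have to dominate one another: [K ^ 100] leaves room for [K ^ 11]
    (common divisors) times [K ^ 31] (divisor bounds and smoothing) times [K ^ 48] (a saving of
    [K ^ 12] in a fourth power), and the saving [K ^ 400] in the equidistribution covers the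
    [K ^ 300] lost at the small moduli. A small enough power of [M] pays for all of them. Smoothing
    means convolving two intervals, so that Cauchy-Schwarz and Parseval suffice and no geometric sum
    is estimated. The obstacle to equidistribution is the quadratic term [u ^ 2 / 2]. Along the
    multiples of [r], after division by [r], it is constant modulo one on each parity class, so that
    a linear problem with slope [2 * alpha] remains. *)

Section finite_ring_characters.
Variables (C : numClosedFieldType) (A : finComUnitRingType) (chi : A -> C).
Hypothesis chiD : forall x y, chi (x + y) = chi x * chi y.
Hypothesis chi_norm : forall x, `|chi x| = 1.
Hypothesis chi_sum : forall a, \sum_x chi (a * x) = #|A|%:R * (a == 0)%:R.

Lemma chi0 : chi 0 = 1.
Proof.
have n0 : chi 0 != 0 by rewrite -normr_gt0 chi_norm ltr01.
by apply: (mulfI n0); rewrite -chiD addr0 mulr1.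
Qed.

Lemma chi_conj x : (chi x)^* = chi (- x).
Proof.
have n0 : chi x != 0 by rewrite -normr_gt0 chi_norm ltr01.
by apply: (mulfI n0); rewrite -normCK chi_norm -chiD subrr chi0 expr1n.
Qed.

Lemma chi_parseval (T : finType) (f : T -> A) :
  \sum_a `|\sum_t chi (a * f t)| ^+ 2
  = #|A|%:R * (\sum_t \sum_t' (f t == f t'))%:R.
Proof.
under [LHS]eq_bigr => a _ do rewrite normCK rmorph_sum big_distrl /=.
rewrite [LHS]exchange_big /= natr_sum big_distrr /=; apply: eq_bigr => t _.
under eq_bigr => a _ do rewrite big_distrr /=.
rewrite [LHS]exchange_big /= natr_sum big_distrr /=; apply: eq_bigr => t' _.
under eq_bigr => a _ do rewrite chi_conj -chiD -mulrN -mulrDr mulrC.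
by rewrite chi_sum subr_eq0.
Qed.

Lemma chi_parseval2 (T : finType) (f g : T -> A) :
  \sum_a \sum_b `|\sum_t chi (a * f t + b * g t)| ^+ 2
  = #|A|%:R ^+ 2 * (\sum_t \sum_t' ((f t == f t') && (g t == g t')))%:R.
Proof.
under [LHS]eq_bigr => a _ do under eq_bigr => b _ do
  rewrite normCK rmorph_sum big_distrl /=.
under eq_bigr => a _ do rewrite exchange_big /=.
rewrite [LHS]exchange_big /= natr_sum big_distrr /=; apply: eq_bigr => t _.
under eq_bigr => a _ do under eq_bigr => b _ do rewrite big_distrr /=.
under eq_bigr => a _ do rewrite exchange_big /=.
rewrite [LHS]exchange_big /= natr_sum big_distrr /=; apply: eq_bigr => t' _.
transitivity (\sum_a chi ((f t - f t') * a) * \sum_b chi ((g t - g t') * b)).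
  apply: eq_bigr => a _; rewrite big_distrr /=; apply: eq_bigr => b _.
  by rewrite chi_conj -!chiD; congr chi; ring.
rewrite -big_distrl /= !chi_sum !subr_eq0 -mulnb natrM; ring.
Qed.

Definition kloosterman (a b : A) : C :=
  \sum_(k : A | k \is a GRing.unit) chi (a * k + b * k^-1).

Let U := {k : A | k \is a GRing.unit}.

(** As a sum over a finite type, its square is a sum over pairs of units, to which [chi_parseval2]
    applies. *)
Lemma kloosterman_sig a b :
  kloosterman a b = \sum_(k : U) chi (a * val k + b * (val k)^-1).
Proof.
by rewrite /kloosterman (reindex_omap (val : U -> A) insub) //= => [|k ku];
   [apply: eq_bigl => k; rewrite (valP k) valK eqxx | rewrite insubT].
Qed.

(** Additive energy of the points [(k, k^-1)] of the hyperbola in [A * A]. *)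
Definition kloosterman_energy : nat :=
  \sum_(s : U * U) \sum_(t : U * U)
    [&& val s.1 + val s.2 == val t.1 + val t.2
      & (val s.1)^-1 + (val s.2)^-1 == (val t.1)^-1 + (val t.2)^-1]%R.

Lemma kloosterman_moment4 :
  \sum_a \sum_b `|kloosterman a b| ^+ 4 = #|A|%:R ^+ 2 * kloosterman_energy%:R.
Proof.
rewrite -(chi_parseval2 (fun s : U * U => val s.1 + val s.2)
   (fun s : U * U => (val s.1)^-1 + (val s.2)^-1)).
apply: eq_bigr => a _; apply: eq_bigr => b _.
rewrite (exprM _ 2 2) -normrX; congr (`| _ | ^+ 2).
rewrite expr2 kloosterman_sig big_distrl /= -(pair_big xpredT xpredT
  (fun x y : U => chi (a * (val x + val y) + b * ((val x)^-1 + (val y)^-1)))) /=.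
apply: eq_bigr => k _; rewrite big_distrr /=; apply: eq_bigr => k' _.
by rewrite -chiD; congr chi; ring.
Qed.

Lemma unit_mulrI (k : A) : k \is a GRing.unit -> injective ( *%R k).
Proof. by move=> ku x y /(congr1 ( *%R k^-1)); rewrite !mulrA mulVr // !mul1r. Qed.

(** Substitute [t * k] for [k]. A single large value thus repeats along an orbit, and the fourth
    moment bounds it. *)
Lemma kloosterman_scale (t a b : A) : t \is a GRing.unit ->
  kloosterman (a * t) (b * t^-1) = kloosterman a b.
Proof.
move=> tu; rewrite /kloosterman [RHS](reindex_inj (unit_mulrI tu)) /=.
apply: eq_big => [k|k ku]; first by rewrite unitrMr.
by rewrite invrM // mulrA [k^-1 * _]mulrC mulrA.
Qed.

(* The orbit of (a, b) under (a t, b / t) has at least [#units / #annihilator] points. *)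
Lemma kloosterman_bound4 (a b : A) :
  #|[pred t : A | t \is a GRing.unit]|%:R * `|kloosterman a b| ^+ 4
  <= #|[pred x : A | a * x == 0]|%:R * (#|A|%:R ^+ 2 * kloosterman_energy%:R).
Proof.
rewrite -kloosterman_moment4.
rewrite -sum1_card natr_sum big_distrl /=.
rewrite (eq_bigr (fun t => \sum_x \sum_y
   `|kloosterman x y| ^+ 4 * ((x == a * t) && (y == b * t^-1))%:R)); last first.
  move=> t tu; rewrite (bigD1 (a * t)) //= (bigD1 (b * t^-1)) //= !eqxx /= mulr1.
  rewrite big1 => [|y /negbTE->]; last by rewrite mulr0.
  rewrite big1 => [|x /negbTE->]; last by rewrite big1 // => y _; rewrite mulr0.
  by rewrite kloosterman_scale // !addr0 mul1r.
rewrite exchange_big /= big_distrr /=; apply: ler_sum => x _.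
rewrite exchange_big /= big_distrr /=; apply: ler_sum => y _.
rewrite -big_distrr /= mulrC; apply: ler_wpM2r; first exact: exprn_ge0.
apply: (@le_trans _ _ (\sum_(t : A) (x == a * t)%:R)).
  rewrite big_mkcond /=; apply: ler_sum => t _.
  by case: ifP => _; rewrite ?ler0n // ler_nat; case: (x == _); case: (y == _).
rewrite -natr_sum ler_nat -sum1_card.
have [t0 /eqP xE|no] := pickP (fun t => x == a * t); last first.
  by rewrite big1 // => t _; rewrite no.
(* Translation by one solution [t0] of [x = a * t] carries the solutions into the annihilator of
   [a]. *)
rewrite (reindex_inj (addIr t0)) /= [leqRHS]big_mkcond /=.
apply: leq_sum => t _; rewrite mulrDr xE -subr_eq0 opprD addrCA subrr addr0.
by rewrite oppr_eq0 inE; case: eqP.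
Qed.

Definition ramanujan (z : A) : C :=
  \sum_(k : A | k \is a GRing.unit) chi (k * z).

Lemma ramanujan_unit (t z : A) : t \is a GRing.unit ->
  ramanujan (t * z) = ramanujan z.
Proof.
move=> tu; rewrite /ramanujan [RHS](reindex_inj (unit_mulrI tu)) /=.
by apply: eq_big => [k|k ku]; rewrite ?unitrMr //; congr chi; ring.
Qed.

(** The sum over [b] vanishes unless [a = k * y]. On the right [x] and [y] occur in separate linear
    phases, and the term in [k^-1] becomes a Kloosterman sum after summation over [k]. *)
Lemma chi_expand (k x y : A) : k \is a GRing.unit ->
  #|A|%:R * chi (k * x * y) = \sum_a \sum_b chi (a * x + b * y - a * b * k^-1).
Proof.
move=> ku.
transitivity (\sum_a chi (a * x) * \sum_b chi ((y - a * k^-1) * b)).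
  under eq_bigr => a _ do rewrite chi_sum.
  rewrite (bigD1 (k * y)) //= big1 => [|a ak]; last first.
    suff -> : (y - a / k == 0) = false by rewrite !mulr0.
    apply: contraNF ak; rewrite subr_eq0 => /eqP ->.
    by rewrite mulrC divrK.
  have -> : y - k * y / k = 0 by rewrite mulrAC divrr // mul1r subrr.
  rewrite eqxx mulr1 addr0 mulrC.
  by congr (chi _ * _); ring.
apply: eq_bigr => a _; rewrite big_distrr /=; apply: eq_bigr => b _.
by rewrite -chiD; congr chi; ring.
Qed.

Lemma box_ramanujan (T1 T2 : finType) (f : T1 -> A) (g : T2 -> A) (l : A) :
  #|A|%:R * \sum_i \sum_j ramanujan (f i * g j + l)
  = \sum_a \sum_b (\sum_i chi (a * f i)) * (\sum_j chi (b * g j))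
      * kloosterman l (- (a * b)).
Proof.
rewrite /ramanujan /kloosterman.
transitivity (\sum_i \sum_j \sum_(k : A | k \is a GRing.unit)
   \sum_a \sum_b chi (a * f i + b * g j - a * b * k^-1) * chi (k * l)).
  rewrite big_distrr /=; apply: eq_bigr => i _.
  rewrite big_distrr /=; apply: eq_bigr => j _.
  rewrite big_distrr /=; apply: eq_bigr => k ku.
  rewrite mulrDr chiD mulrA mulrA chi_expand // big_distrl /=.
  by apply: eq_bigr => a _; rewrite big_distrl.
under eq_bigr => i _ do under eq_bigr => j _ do rewrite exchange_big /=.
under eq_bigr => i _ do rewrite exchange_big /=.
rewrite exchange_big /=; apply: eq_bigr => a _.
under eq_bigr => i _ do under eq_bigr => j _ do rewrite exchange_big /=.
under eq_bigr => i _ do rewrite exchange_big /=.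
rewrite exchange_big /=; apply: eq_bigr => b _.
rewrite -mulrA big_distrl /=; apply: eq_bigr => i _.
rewrite big_distrl big_distrr /=; apply: eq_bigr => j _.
rewrite mulrCA !big_distrr /=; apply: eq_bigr => k _.
by rewrite -!chiD; congr chi; ring.
Qed.

End finite_ring_characters.

(** * The divisor function *)

Section divisor_counts.
Local Open Scope nat_scope.

Lemma sum_dvd_period (x : int) (d : nat) : 0 < d ->
  \sum_(i < d) (d%:Z %| (x + i%:Z)%R)%Z = 1.
Proof.
move=> d0; have dN0 : (d%:Z != 0)%R by lia.
pose r := absz ((- x)%R %% d)%Z.
have rE : (r%:Z = ((- x)%R %% d)%Z)%R by rewrite /r gez0_abs // modz_ge0.
have rd : r < d by have := ltz_mod (- x)%R dN0; rewrite -rE; lia.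
have xE : (- x = (- x %/ d)%Z * d%:Z + r%:Z)%R by rewrite rE -divz_eq.
rewrite (bigD1 (Ordinal rd)) //= big1 ?addn0.
  by rewrite (_ : (d%:Z %| _)%Z = true) //; apply/dvdzP; exists (- (- x %/ d)%Z)%R; lia.
move=> i ir; apply/eqP; rewrite eqb0; apply: contra ir => /dvdzP [q qE].
apply/eqP/val_inj => /=; have id := ltn_ord i.
have qE2 : ((q + (- x %/ d)%Z) * d%:Z = i%:Z - r%:Z)%R by lia.
have q0 : ((q + (- x %/ d)%Z) = 0)%R by nia.
by move: qE2; rewrite q0 mul0r; lia.
Qed.

Lemma sum_dvd_periods (x : int) (d q : nat) : 0 < d ->
  \sum_(i < q * d) (d%:Z %| (x + i%:Z)%R)%Z = q.
Proof.
move=> d0; elim: q x => [|q IH] x; first by rewrite mul0n big_ord0.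
rewrite mulSn big_split_ord /= sum_dvd_period //.
under eq_bigr => i _ do rewrite PoszD addrA.
by rewrite IH add1n.
Qed.

Lemma sum_dvd_bounds (x : int) (d n : nat) : 0 < d ->
  n %/ d <= \sum_(i < n) (d%:Z %| (x + i%:Z)%R)%Z <= (n %/ d).+1.
Proof.
move=> d0; pose S y m := \sum_(i < m) (d%:Z %| (y + i%:Z)%R)%Z.
have SD y m m' : S y (m + m') = S y m + S (y + m%:Z)%R m'.
  rewrite /S big_split_ord /=; congr (_ + _); apply: eq_bigr => i _.
  by rewrite PoszD addrA.
have Sle m m' : m <= m' -> S (x + (n %/ d * d)%:Z)%R m <= S (x + (n %/ d * d)%:Z)%R m'.
  by move=> mm; rewrite -(subnKC mm) SD leq_addr.
have SE : S x n = n %/ d + S (x + (n %/ d * d)%:Z)%R (n %% d).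
  by rewrite {1}(divn_eq n d) SD; congr (_ + _); exact: sum_dvd_periods.
rewrite -/(S x n) SE leq_addr -addn1 leq_add2l.
by rewrite (leq_trans (Sle _ d (ltnW (ltn_pmod n d0)))) // /S sum_dvd_period.
Qed.

Lemma sum_dvdn (r d : nat) : 0 < r -> d %| r -> \sum_(i < r) (d %| i) = r %/ d.
Proof.
move=> r0 dr; have d0 := dvdn_gt0 r0 dr.
move: (sum_dvd_periods 0 (r %/ d) d0); rewrite (divnK dr) => <-.
by apply: eq_bigr => i _; rewrite add0r.
Qed.

Definition tau (n : nat) := size (divisors n).

Lemma leq_sum_divisors (n : nat) (F : nat -> nat) (d : nat) : 0 < n -> d %| n ->
  F d <= \sum_(e <- divisors n) F e.
Proof.
move=> n0 dn; rewrite (bigD1_seq d) /= ?divisors_uniq ?leq_addr //.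
by rewrite -dvdn_divisors.
Qed.

(** Take [d1 = gcd(r, p)] and then [d2 = gcd(r / d1, q)]; what remains of [r] must divide [s]. *)
Lemma dvdn_mul3 (r p q s : nat) : 0 < r -> r %| p * q * s ->
  exists d1 d2, [/\ d1 * d2 %| r, d1 %| p, d2 %| q & r %/ (d1 * d2) %| s].
Proof.
move=> r0 dvd; have g0 : 0 < gcdn r p by rewrite gcdn_gt0 r0.
have r10 : 0 < r %/ gcdn r p by rewrite divn_gt0 // dvdn_leq // dvdn_gcdl.
exists (gcdn r p), (gcdn (r %/ gcdn r p) q).
have dvd1 : r %/ gcdn r p %| q * s.
  have : r %/ gcdn r p %| p %/ gcdn r p * (q * s).
    rewrite -(dvdn_pmul2r g0) (divnK (dvdn_gcdl _ _)) mulnAC.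
    by rewrite (divnK (dvdn_gcdr _ _)) mulnA.
  by rewrite Gauss_dvdr // coprime_sym /coprime -(eqn_pmul2r g0) muln_gcdl
     !divnK ?dvdn_gcdl ?dvdn_gcdr // mul1n gcdnC.
split; rewrite ?dvdn_gcdl ?dvdn_gcdr //.
  rewrite mulnC -[X in _ %| X](divnK (dvdn_gcdl r p)).
  by rewrite dvdn_mul // dvdn_gcdl.
rewrite divnMA; set r1 := r %/ gcdn r p in r10 dvd1 *.
have h0 : 0 < gcdn r1 q by rewrite gcdn_gt0 r10.
have : r1 %/ gcdn r1 q %| q %/ gcdn r1 q * s.
  rewrite -(dvdn_pmul2r h0) (divnK (dvdn_gcdl _ _)) mulnAC.
  by rewrite (divnK (dvdn_gcdr _ _)).
by rewrite Gauss_dvdr // /coprime -(eqn_pmul2r h0) muln_gcdl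
     !divnK ?dvdn_gcdl ?dvdn_gcdr // mul1n.
Qed.

(** For fixed [d1] and [d2] the three divisibilities hold for [r / d1], [r / d2] and [d1 * d2]
    residues, so each of the [tau r ^ 2] choices contributes at most [r ^ 2]. *)
Lemma sum_dvd_mul3 (r : nat) : 0 < r ->
  \sum_(p < r) \sum_(q < r) \sum_(s < r) (r %| p * q * s) <= r ^ 2 * tau r ^ 2.
Proof.
move=> r0.
pose F (d1 d2 p q s : nat) : nat :=
  [&& d1 * d2 %| r, d1 %| p, d2 %| q & r %/ (d1 * d2) %| s].
apply: (@leq_trans (\sum_(p < r) \sum_(q < r) \sum_(s < r)
  \sum_(d1 <- divisors r) \sum_(d2 <- divisors r) F d1 d2 p q s)).
  apply: leq_sum => p _; apply: leq_sum => q _; apply: leq_sum => s _.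
  have [dvd|//] := boolP (r %| _).
  have [d1 [d2 [d12 dp dq ds]]] := dvdn_mul3 r0 dvd.
  have d1r : d1 %| r by apply: dvdn_trans d12; exact: dvdn_mulr.
  have d2r : d2 %| r by apply: dvdn_trans d12; exact: dvdn_mull.
  apply: leq_trans (leq_sum_divisors
     (fun d => \sum_(d2 <- divisors r) F d d2 p q s) r0 d1r).
  apply: leq_trans (leq_sum_divisors (fun d => F d1 d p q s) r0 d2r).
  by rewrite /F d12 dp dq ds.
under eq_bigr => p _ do under eq_bigr => q _ do rewrite exchange_big /=.
under eq_bigr => p _ do rewrite exchange_big /=.
rewrite exchange_big /=.
apply: (@leq_trans (\sum_(d1 <- divisors r) \sum_(d2 <- divisors r) r ^ 2)).
  rewrite big_seq [X in _ <= X]big_seq; apply: leq_sum => d1.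
  rewrite -dvdn_divisors // => d1r.
  under eq_bigr => p _ do under eq_bigr => q _ do rewrite exchange_big /=.
  under eq_bigr => p _ do rewrite exchange_big /=.
  rewrite exchange_big /= big_seq [X in _ <= X]big_seq; apply: leq_sum => d2.
  rewrite -dvdn_divisors // => d2r.
  have [d12|nd] := boolP (d1 * d2 %| r); last first.
    rewrite big1 // => p _; rewrite big1 // => q _; rewrite big1 // => s _.
    by rewrite /F (negbTE nd).
  have -> : \sum_(p < r) \sum_(q < r) \sum_(s < r) F d1 d2 p q s =
     (\sum_(p < r) (d1 %| p)) * (\sum_(q < r) (d2 %| q)) *
     (\sum_(s < r) (r %/ (d1 * d2) %| s)).
    rewrite -mulnA [RHS]big_distrl /=; apply: eq_bigr => p _.
    rewrite [in RHS]big_distrl big_distrr /=; apply: eq_bigr => q _.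
    rewrite !big_distrr /=; apply: eq_bigr => s _.
    by rewrite /F d12 /= -!mulnb.
  rewrite !sum_dvdn ?dvdn_div //.
  have d10 := dvdn_gt0 r0 d1r; have d20 := dvdn_gt0 r0 d2r.
  have e : r %/ (r %/ (d1 * d2)) = d1 * d2 by rewrite divnA // mulnC mulnK.
  rewrite e mulnACA (divnK d1r) (divnK d2r) -mulnn leqnn //.
by rewrite !big_const_seq !count_predT !iter_addn_0 /tau -mulnA mulnn.
Qed.

Lemma tau_pfactor (p a m : nat) : prime p -> 0 < m -> ~~ (p %| m) ->
  tau (p ^ a * m) = a.+1 * tau m.
Proof.
move=> pp m0 pm; have p0 := prime_gt0 pp.
have pa0 : 0 < p ^ a by rewrite expn_gt0 p0.
have n0 : 0 < p ^ a * m by rewrite muln_gt0 pa0.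
pose s := [seq p ^ i * d | i <- iota 0 a.+1, d <- divisors m].
have <- : size s = a.+1 * tau m by rewrite size_allpairs size_iota.
have coprimep d : d %| m -> ~~ (p %| d) by move=> dm; apply: contra pm => /dvdn_trans; apply.
apply: perm_size; apply: uniq_perm; first exact: divisors_uniq.
  apply: allpairs_uniq; rewrite ?iota_uniq ?divisors_uniq //.
  move=> [i3 d3] [i4 d4] /allpairsP [[i1 d1] [_ d1m] [-> ->]].
  move=> /allpairsP [[i2 d2] [_ d2m] [-> ->]] /=; move: d1m d2m => /= d1m d2m.
  rewrite -!dvdn_divisors // in d1m d2m.
  have lg i d' : d' %| m -> logn p (p ^ i * d') = i.
    move=> dm; rewrite lognM ?expn_gt0 ?p0 ?(dvdn_gt0 m0 dm) // pfactorK //.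
    by rewrite lognE (negbTE (coprimep _ dm)) !andbF addn0.
  move=> eqm; have ij : i1 = i2 by rewrite -(lg i1 d1 d1m) eqm lg.
  by move: eqm; rewrite ij => /eqP; rewrite eqn_pmul2l ?expn_gt0 ?p0 // => /eqP ->.
move=> x; rewrite -dvdn_divisors //; apply/idP/allpairsP => [xn|[[i d] [ia dm ->]]]; last first.
  rewrite -dvdn_divisors // in dm; rewrite mem_iota ltnS in ia.
  by rewrite dvdn_mul // dvdn_exp2l.
have [i ia gE] : exists2 i, i <= a & gcdn x (p ^ a) = p ^ i.
  by apply/(dvdn_pfactor _ _ pp); exact: dvdn_gcdr.
have g0 : 0 < gcdn x (p ^ a) by rewrite gE expn_gt0 p0.
exists (i, x %/ p ^ i) => /=; split.
- by rewrite (mem_iota 0 a.+1) ltnS.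
- rewrite -dvdn_divisors // -gE.
  have : x %/ gcdn x (p ^ a) %| p ^ a %/ gcdn x (p ^ a) * m.
    rewrite -(dvdn_pmul2r g0) (divnK (dvdn_gcdl _ _)) mulnAC.
    by rewrite (divnK (dvdn_gcdr _ _)).
  by rewrite Gauss_dvdr // /coprime -(eqn_pmul2r g0) muln_gcdl
     !divnK ?dvdn_gcdl ?dvdn_gcdr // mul1n.
- by rewrite mulnC divnK // -gE dvdn_gcdl.
Qed.

Lemma pdiv_decomp (n : nat) : 1 < n -> exists p a m,
  [/\ prime p, p = pdiv n, 0 < a, 0 < m & ~~ (p %| m) /\ n = p ^ a * m].
Proof.
move=> n1; have pp := pdiv_prime n1; have n0 := ltnW n1.
have [m cop nE] := pfactor_coprime pp n0.
exists (pdiv n), (logn (pdiv n) n), m; split=> //.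
- by rewrite logn_gt0 mem_primes pp n0 pdiv_dvd.
- by case: m nE {cop} => // nE; rewrite nE mul0n in n0.
- by split; [rewrite -prime_coprime | rewrite mulnC].
Qed.

(** At a prime power [p ^ a] with [a > 0] this is [p <= (p - 1) * (a + 1)]. It serves to replace the
    number of units, by which the orbit argument divides, by the modulus. *)
Lemma leq_totient_tau (n : nat) : 0 < n -> n <= totient n * tau n.
Proof.
elim/ltn_ind: n => n IH n0; case: (leqP n 1) => [n1|n1].
  by have -> : n = 1 by lia.
have [p [a [m [pp _ a0 m0 [pm nE]]]]] := pdiv_decomp n1.
have p1 := prime_gt1 pp.
have mn : m < n by rewrite nE ltn_Pmull // -{1}(expn0 p) ltn_exp2l.
have cop : coprime (p ^ a) m by rewrite coprime_pexpl // prime_coprime.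
rewrite nE totient_coprime // tau_pfactor // totient_pfactor //.
rewrite mulnACA leq_mul ?IH //.
rewrite -(prednK a0) expnS -pred_Sn mulnAC leq_mul2r; apply/orP; right.
by case: p p1 {nE cop pp pm} => // -[|p] // _; rewrite prednK //=; nia.
Qed.

(** A prime power [p ^ a] with [p >= 2 ^ k] costs nothing, as [(a + 1) ^ k <= 2 ^ (a * k) <= p ^ a];
    each smaller prime costs a factor [C], and their number is bounded in terms of [k]. *)
Lemma tau_bound (k : nat) : exists2 C : nat, 0 < C & forall n, 0 < n -> tau n ^ k <= C * n.
Proof.
pose C := k.+1 ^ k.+1.
have C0 : 0 < C by rewrite expn_gt0.
have CP a : a.+1 ^ k <= C * 2 ^ a.
  have h1 : a.+1 <= k.+1 * 2 ^ (a %/ k.+1).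
    apply: (@leq_trans (k.+1 * (a %/ k.+1).+1)); first by rewrite mulnC ltn_ceil.
    by rewrite leq_mul2l ltn_expl.
  apply: (@leq_trans (a.+1 ^ k.+1)); first by rewrite leq_pexp2l.
  apply: (@leq_trans ((k.+1 * 2 ^ (a %/ k.+1)) ^ k.+1)); first by rewrite leq_exp2r.
  by rewrite expnMn -expnM leq_mul2l leq_exp2l ?leq_trunc_div ?orbT.
(* [q] is a lower bound for the primes dividing [n]. Removing the least prime raises it, and
   [2 ^ k - q] bounds the number of small primes that may still occur. *)
suff key q n : 0 < n -> (forall p, prime p -> p %| n -> q <= p) ->
    tau n ^ k <= C ^ (2 ^ k - q) * n.
  exists (C ^ (2 ^ k)) => [|n n0]; first by rewrite expn_gt0 C0.
  by have := key 0 n n0; rewrite subn0; apply.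
elim/ltn_ind: n q => n IH q n0 nq; case: (leqP n 1) => [n1|n1].
  have -> : n = 1 by lia.
  by rewrite (_ : tau 1 = 1) // exp1n muln1 expn_gt0 C0.
have [p [a [m [pp pE a0 m0 [pm nE]]]]] := pdiv_decomp n1.
have qp : q <= p by apply: nq; rewrite // nE dvdn_mulr // dvdn_exp.
have mn : m < n.
  by rewrite nE ltn_Pmull // -{1}(expn0 p) ltn_exp2l ?prime_gt1.
have mp r : prime r -> r %| m -> p.+1 <= r.
  move=> rp rm; rewrite ltn_neqAle; apply/andP; split.
    by apply: contra pm => /eqP ->.
  by rewrite pE pdiv_min_dvd ?prime_gt1 // nE dvdn_mull.
have IHm := IH m mn p.+1 m0 mp.
rewrite nE tau_pfactor // expnMn mulnCA.
case: (leqP (2 ^ k) p) => [kp|pk].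
  have : C ^ (2 ^ k - p.+1) = 1 by rewrite (_ : 2 ^ k - p.+1 = 0) //; lia.
  move=> E; rewrite E mul1n in IHm.
  apply: (@leq_trans (p ^ a * m)); last first.
    by rewrite mulnCA -[X in X <= _]mul1n leq_mul2r expn_gt0 C0 orbT.
  rewrite leq_mul //; apply: (@leq_trans ((2 ^ a) ^ k)).
    have le2 : a.+1 <= 2 ^ a by apply: ltn_expl.
    have : 0 < k \/ k = 0 by clear; lia.
    by case=> [k0|->]; [rewrite leq_exp2r | rewrite !expn0].
  by rewrite -expnM mulnC expnM leq_exp2r.
apply: (@leq_trans ((C * 2 ^ a) * (C ^ (2 ^ k - p.+1) * m))); first exact: leq_mul.
rewrite mulnACA -expnS [X in _ <= X]mulnCA; apply: leq_mul.
  by apply: leq_pexp2l => //; lia.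
by apply: leq_mul => //; rewrite leq_exp2r ?prime_gt1.
Qed.
End divisor_counts.

(** * Additive energy of the units and their inverses *)

Lemma leq_sum_sig (A : finType) (P : pred A) (F : A -> nat) :
  (\sum_(k : {k : A | P k}) F (val k) <= \sum_k F k)%N.
Proof.
apply: (@leq_trans (\sum_(k | P k) F k)%N); last first.
  by rewrite [leqRHS](bigID P) /= leq_addr.
rewrite [leqRHS](reindex_omap (val : {k : A | P k} -> A) insub) /=; last first.
  by move=> k ku; rewrite insubT.
by rewrite [leqRHS](eq_bigl xpredT) // => k; rewrite (valP k) valK eqxx.
Qed.

Lemma leq_sum_unique (I : finType) (b : I -> bool) (c : bool) :
  (forall i, b i -> c) -> (forall i j, b i -> b j -> i = j) ->
  (\sum_i b i <= c)%N.
Proof.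
move=> bc bu; have [i bi|no] := pickP b; last by rewrite big1 // => i _; rewrite no.
rewrite (bigD1 i) //= big1 ?addn0 ?bi ?(bc _ bi) // => j ji.
by case bj: (b j) => //; rewrite (bu _ _ bi bj) eqxx in ji.
Qed.

Lemma inverse_sums (A : comUnitRingType) (x y z w : A) :
  x \is a GRing.unit -> y \is a GRing.unit ->
  z \is a GRing.unit -> w \is a GRing.unit ->
  x + y = z + w -> x^-1 + y^-1 = z^-1 + w^-1 -> (x + y) * (z - x) * (y - z) = 0.
Proof.
move=> xu yu zu wu e1 e2; have wE : w = x + y - z by rewrite e1 addrC addKr.
have e3 : x * y * z * w * (x^-1 + y^-1) = x * y * z * w * (z^-1 + w^-1) by rewrite e2.
have e4 : x * y * z * w * (x^-1 + y^-1) = (x + y) * (z * w).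
  transitivity ((x / x) * (y * z * w) + (y / y) * (x * z * w)); first by ring.
  by rewrite !divrr //; ring.
have e5 : x * y * z * w * (z^-1 + w^-1) = (z + w) * (x * y).
  transitivity ((z / z) * (x * y * w) + (w / w) * (x * y * z)); first by ring.
  by rewrite !divrr //; ring.
transitivity ((x + y) * (z * w) - (z + w) * (x * y)); last first.
  by rewrite -e4 -e5 e3 subrr.
by rewrite -e1 wE; ring.
Qed.

(* With [s = k1 + k2], equality of the sums of inverses reads [s (k3 k4 - k1 k2) = 0],
   and [k3 k4 - k1 k2 = (k3 - k1) (k2 - k3)]. *)
Lemma kloosterman_energy_le (A : finComUnitRingType) :
  (kloosterman_energy A <= #|[pred d : A | d + d == 0]%R| *
     \sum_(p : A) \sum_(q : A) \sum_(s : A) (p * q * s == 0)%R)%N.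
Proof.
(* The fourth unit is determined by the other three, so triples are counted. The map [h] forgets
   only a common translation [d] with [d + d = 0], which gives the first factor. *)
pose h (v : A * A * A) := (v.1.1 + v.1.2, v.2 - v.1.1, v.1.2 - v.2).
pose Q (w : A * A * A) : bool := w.1.1 * w.1.2 * w.2 == 0.
apply: (@leq_trans (\sum_(v : A * A * A) Q (h v))%N); last first.
  have -> : (\sum_(p : A) \sum_(q : A) \sum_(s : A) (p * q * s == 0)%R =
     \sum_(w : A * A * A) Q w)%N by rewrite !pair_bigA.
  rewrite (partition_big h xpredT) //= big_distrr /=; apply: leq_sum => w _.
  under eq_bigr => v /eqP -> do [].
  rewrite big_const_seq iter_addn_0 mulnC leq_mul2r; apply/orP; right.
  rewrite -sum1_count sum1_card.
  have [v0 /eqP hv0|no] := pickP [pred v | h v == w]; last by rewrite eq_card0.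
  pose g (d : A) := (v0.1.1 + d, v0.1.2 + d, v0.2 + d).
  apply: (@leq_trans #|[seq g d | d in [pred d : A | d + d == 0]]|); last exact: leq_image_card.
  apply: subset_leq_card; apply/fintype.subsetP => -[[k1 k2] k3] hv.
  have {hv} : h (k1, k2, k3) == w := hv.
  rewrite -hv0 /h /= !xpair_eqE => /andP[/andP[/eqP e1 /eqP e2] /eqP e3].
  have k2E : k2 = v0.1.2 + (k1 - v0.1.1).
    by transitivity ((k2 - k3) + (k3 - k1) + k1); [ring | rewrite e2 e3; ring].
  have k3E : k3 = v0.2 + (k1 - v0.1.1).
    by transitivity ((k3 - k1) + k1); [ring | rewrite e2; ring].
  apply/mapP; exists (k1 - v0.1.1); last by rewrite /g -k2E -k3E addrC subrK.
  rewrite mem_enum inE; apply/eqP.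
  transitivity ((k1 + k2) - (v0.1.1 + v0.1.2)); last by rewrite e1 subrr.
  by rewrite k2E; ring.
rewrite -(pair_bigA _ (fun v z => Q (h (v, z)) : nat)) /=.
rewrite -(pair_bigA _ (fun x y => \sum_z (Q (h (x, y, z)) : nat))) /=.
rewrite /kloosterman_energy.
under [leqLHS]eq_bigr => s _ do rewrite -(pair_bigA _ (fun z w : {k : A | k \is a GRing.unit} =>
  [&& val s.1 + val s.2 == val z + val w
    & (val s.1)^-1 + (val s.2)^-1 == (val z)^-1 + (val w)^-1]%R : nat)) /=.
rewrite -(pair_bigA _ (fun x y : {k : A | k \is a GRing.unit} => \sum_z \sum_w
  ([&& val x + val y == val z + val w
    & (val x)^-1 + (val y)^-1 == (val z)^-1 + (val w)^-1]%R : nat))) /=.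
apply: leq_trans (leq_sum_sig (fun x : A => x \is a GRing.unit)
  (fun x => \sum_y \sum_z (Q (h (x, y, z)) : nat))); apply: leq_sum => x _.
apply: leq_trans (leq_sum_sig (fun x : A => x \is a GRing.unit)
  (fun y => \sum_z (Q (h (val x, y, z)) : nat))); apply: leq_sum => y _.
apply: leq_trans (leq_sum_sig (fun x : A => x \is a GRing.unit)
  (fun z => Q (h (val x, val y, z)) : nat)); apply: leq_sum => z _.
apply: leq_sum_unique => [w /andP[/eqP e1 /eqP e2]|w w' /andP[/eqP e1 _] /andP[/eqP e2 _]].
  by rewrite /Q /h /=; apply/eqP; apply: inverse_sums e2 => //; exact: valP.
apply/val_inj; have : val z + val w = val z + val w' by rewrite -e1 -e2.
exact: addrI.
Qed.

(** * Ramanujan and Kloosterman sums modulo r *)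

Lemma le_of_eq (d : Order.disp_t) (T : porderType d) (x y : T) : x = y -> (x <= y)%O.
Proof. by move=> ->. Qed.

(** Lagrange's identity writes twice the difference as a sum of squares. *)
Lemma sum_cauchy_schwarz (F : numDomainType) (I : finType) (x y : I -> F) :
  (forall i, 0 <= x i) -> (forall i, 0 <= y i) ->
  (\sum_i x i * y i) ^+ 2 <= (\sum_i x i ^+ 2) * (\sum_i y i ^+ 2).
Proof.
move=> x0 y0; rewrite -subr_ge0 -(pmulrn_lge0 _ (isT : (0 < 2)%N)).
have -> : ((\sum_i x i ^+ 2) * (\sum_i y i ^+ 2) - (\sum_i x i * y i) ^+ 2) *+ 2
    = \sum_i \sum_j (x i * y j - x j * y i) ^+ 2.
  have e1 : (\sum_i x i ^+ 2) * (\sum_i y i ^+ 2) = \sum_i \sum_j x i ^+ 2 * y j ^+ 2.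
    by rewrite big_distrl; apply: eq_bigr => i _; rewrite big_distrr.
  have e2 : (\sum_i x i * y i) ^+ 2 = \sum_i \sum_j x i * y i * (x j * y j).
    by rewrite expr2 big_distrl; apply: eq_bigr => i _; rewrite big_distrr.
  have e3 : (\sum_i x i ^+ 2) * (\sum_i y i ^+ 2) = \sum_i \sum_j x j ^+ 2 * y i ^+ 2.
    by rewrite e1 exchange_big.
  rewrite mulr2n {1}e1 e3 e2 -!sumrB -big_split /=; apply: eq_bigr => i _.
  rewrite -!sumrB -big_split /=; apply: eq_bigr => j _; ring.
apply: sumr_ge0 => i _; apply: sumr_ge0 => j _; rewrite -realEsqr.
by rewrite rpredB // rpredM // ger0_real.
Qed.

Lemma Zp_intr_eq0 (r : nat) (z : int) : (1 < r)%N ->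
  (z%:~R == 0 :> 'Z_r) = (r%:Z %| z)%Z.
Proof.
move=> r1; have rE n : (n%:R == 0 :> 'Z_r) = (r %| n)%N.
  by rewrite Zp_nat -val_eqE /= Zp_cast // /dvdn.
by case: z => n; rewrite /dvdz /= ?NegzE ?mulrNz ?oppr_eq0 -?pmulrn rE //= abszN.
Qed.

Lemma sum_Zr (r : nat) (F : nat -> nat) : (1 < r)%N ->
  (\sum_(x : 'Z_r) F x = \sum_(x < r) F x)%N.
Proof. by move=> r1; rewrite -!(big_mkord xpredT F) Zp_cast. Qed.

Section residue_characters.
Variables (C : numClosedFieldType) (r : nat) (w : C).
Hypotheses (r1 : (1 < r)%N) (wr : r.-primitive_root w).

Definition zchar (x : 'Z_r) : C := w ^+ x.

Lemma card_Zr : #|'Z_r| = r.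
Proof. by rewrite card_ord Zp_cast. Qed.

Lemma zchar_nat (n : nat) : zchar n%:R = w ^+ n.
Proof. by rewrite /zchar Zp_nat /= Zp_cast // (prim_expr_mod wr). Qed.

Lemma zcharD x y : zchar (x + y) = zchar x * zchar y.
Proof. by rewrite -(natr_Zp x) -(natr_Zp y) -natrD !zchar_nat exprD. Qed.

Lemma zchar_norm x : `|zchar x| = 1.
Proof.
apply/eqP; rewrite -(@pexpr_eq1 _ _ r) ?normr_ge0 ?(ltnW r1) //.
by rewrite -normrX /zchar -exprM mulnC exprM (prim_expr_order wr) expr1n normr1.
Qed.

Lemma zchar_eq1 x : (zchar x == 1) = (x == 0).
Proof.
rewrite /zchar -(prim_order_dvd wr) -val_eqE /=.
have := ltn_ord x; rewrite [X in (_ < X)%N]Zp_cast // => xr.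
by apply/idP/eqP => [/dvdn_leq h|->]; [case: (nat_of_ord x) h xr => // n /(_ isT); lia | ].
Qed.

Lemma zchar_sum a : \sum_x zchar (a * x) = #|'Z_r|%:R * (a == 0)%:R.
Proof.
have [->|a0] := eqVneq a 0.
  under eq_bigr => x _ do rewrite mul0r.
  by rewrite sumr_const (_ : zchar 0 = 1) ?mulr1 // /zchar expr0.
apply/eqP; rewrite mulr0; have /negP := a0; rewrite -zchar_eq1.
apply: contra_notT => s0; rewrite -(inj_eq (mulfI s0)) mulr1 [eqbRHS](reindex_inj (addIr 1)) /=.
by apply/eqP; rewrite mulrC big_distrr /=; apply: eq_bigr => x _; rewrite mulrDr mulr1 zcharD mulrC.
Qed.

(** If [r] divides [l * x], then [r / gcd(l, r)] divides [x]. *)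
Lemma card_annihilator (l : int) :
  (#|[pred x : 'Z_r | (l%:~R * x == 0)%R]| <= gcdn `|l| r)%N.
Proof.
have r0 := ltnW r1.
have g0 : (0 < gcdn `|l| r)%N by rewrite gcdn_gt0 r0 orbT.
rewrite -sum1_card big_mkcond /=.
apply: (@leq_trans (\sum_(x < r) (r %/ gcdn `|l| r %| x))%N); last first.
  by rewrite sum_dvdn ?dvdn_div ?dvdn_gcdr // divnA ?dvdn_gcdr // mulKn.
rewrite -(sum_Zr (fun x => (r %/ gcdn `|l| r %| x) : nat) r1).
apply: leq_sum => x _; have -> : (x \in [pred x : 'Z_r | (l%:~R * x == 0)%R]) = (r%:Z %| (l * x%:Z)%R)%Z.
  by rewrite inE -{1}[x]natr_Zp pmulrn -intrM Zp_intr_eq0.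
case: (boolP (_ %| _)%Z) => // dv; rewrite lt0n eqb0 negbK.
move: dv; rewrite dvdzE abszM !absz_nat => dv.
have : (r %/ gcdn `|l| r %| `|l| %/ gcdn `|l| r * x)%N.
  rewrite -(dvdn_pmul2r g0) (divnK (dvdn_gcdr _ _)) mulnAC.
  by rewrite (divnK (dvdn_gcdl _ _)).
by rewrite Gauss_dvdr // coprime_sym /coprime -(eqn_pmul2r g0) muln_gcdl
     !divnK ?dvdn_gcdl ?dvdn_gcdr // mul1n.
Qed.

(** The factor 2 bounds the number of [d] with [2 * d = 0] modulo [r]. *)
Lemma energy_Zr : (kloosterman_energy 'Z_r <= 2 * (r ^ 2 * tau r ^ 2))%N.
Proof.
apply: leq_trans (kloosterman_energy_le _) _; apply: leq_mul.
  rewrite (@leq_trans (gcdn `|2%:Z| r)) //; last by rewrite dvdn_leq // dvdn_gcdl.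
  apply: leq_trans (card_annihilator 2); apply: subset_leq_card.
  by apply/fintype.subsetP => x; rewrite !inE -mulr2n -[x *+ 2]mulr_natl.
apply: leq_trans (sum_dvd_mul3 (ltnW r1)).
rewrite -(sum_Zr (fun p => \sum_(q < r) \sum_(s < r) ((r %| p * q * s) : nat))) //.
apply: leq_sum => p _; rewrite -(sum_Zr (fun q => \sum_(s < r) ((r %| p * q * s) : nat))) //.
apply: leq_sum => q _; rewrite -(sum_Zr (fun s => (r %| p * q * s) : nat)) //.
apply: leq_sum => s _.
rewrite -{1}(natr_Zp p) -{1}(natr_Zp q) -{1}(natr_Zp s) -!natrM pmulrn Zp_intr_eq0 //.
Qed.

Lemma card_unit_Zr : #|[pred t : 'Z_r | t \is a GRing.unit]| = totient r.
Proof. by rewrite -card_units_Zp ?(ltnW r1) // cardsT card_sub. Qed.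

(** Kloosterman's bound: the sum is at most of order [gcd(l, r)^(1/4) r^(3/4 + epsilon)], uniformly
    in [c]. *)
Lemma kloosterman_Zr (l : int) (c : 'Z_r) :
  (totient r)%:R * `|kloosterman zchar l%:~R c| ^+ 4
    <= (2 * gcdn `|l| r * r ^ 4 * tau r ^ 2)%:R.
Proof.
rewrite -card_unit_Zr.
apply: le_trans (kloosterman_bound4 zcharD zchar_norm zchar_sum _ _) _.
rewrite card_Zr -natrX -!natrM ler_nat.
apply: (@leq_trans (gcdn `|l| r * (r ^ 2 * (2 * (r ^ 2 * tau r ^ 2))))).
  by rewrite !leq_mul ?card_annihilator ?energy_Zr.
by rewrite leq_eqVlt; apply/orP; left; apply/eqP; ring.
Qed.

Lemma interval_parseval (n : nat) :
  \sum_a `|\sum_(i < n) zchar (a * (i%:Z)%:~R)| ^+ 2 <= (n * (n + r))%:R.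
Proof.
rewrite (chi_parseval zcharD zchar_norm zchar_sum) card_Zr -natrM ler_nat.
apply: (@leq_trans (r * (n * (n %/ r).+1))).
  rewrite leq_mul2l; apply/orP; right.
  rewrite -[X in (X * _)%N]card_ord -sum_nat_const; apply: leq_sum => i _.
  have /andP[_ /(leq_trans _)] := sum_dvd_bounds (- i%:Z)%R n (ltnW r1); apply.
  apply: leq_sum => j _; rewrite eq_sym -subr_eq0 -intrB Zp_intr_eq0 //.
  by rewrite addrC.
rewrite mulnCA leq_mul2l mulnS; apply/orP; right.
by rewrite addnC leq_add2r mulnC leq_trunc_div.
Qed.

(** Up to a unimodular factor, the transform of a convolution of two intervals is the product of
    their transforms. Cauchy-Schwarz reduces its [l1] norm to two instances of
    [interval_parseval]. *)
Lemma smoothed_interval_l1 (x : int) (n p : nat) :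
  (\sum_a `|\sum_(t : 'I_n * 'I_p) zchar (a * (x + t.1%:Z + t.2%:Z)%:~R)|) ^+ 2
  <= (n * (n + r) * (p * (p + r)))%:R.
Proof.
rewrite natrM; set N := (_ <= _).
apply: (@le_trans _ _ ((\sum_a `|\sum_(i < n) zchar (a * (i%:Z)%:~R)| ^+ 2) *
   (\sum_a `|\sum_(i < p) zchar (a * (i%:Z)%:~R)| ^+ 2))); last first.
  by apply: ler_pM (interval_parseval n) (interval_parseval p);
    apply: sumr_ge0 => a _; rewrite exprn_ge0.
apply: le_trans (sum_cauchy_schwarz _ _) => //.
apply: le_of_eq; congr (_ ^+ 2); apply: eq_bigr => a _.
rewrite -normrM -[RHS]mul1r -(zchar_norm (a * x%:~R)) -normrM; congr (`| _ |).
rewrite -(pair_bigA _ (fun (i : 'I_n) (j : 'I_p) => zchar (a * (x + i%:Z + j%:Z)%:~R))) /=.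
rewrite big_distrl big_distrr /=; apply: eq_bigr => i _.
rewrite !big_distrr /=; apply: eq_bigr => j _.
by rewrite -!zcharD !intrD; congr zchar; ring.
Qed.

Definition box_ramanujan_sum (x : int) (n p : nat) (y : int) (n' p' : nat) (l : int) : C :=
  \sum_(t : 'I_n * 'I_p) \sum_(t' : 'I_n' * 'I_p')
    ramanujan zchar ((x + t.1%:Z + t.2%:Z)%:~R * (y + t'.1%:Z + t'.2%:Z)%:~R + l%:~R).

(** Product of the bounds of [smoothed_interval_l1] for the two variables, hence the square of an
    [l1] norm. *)
Definition smooth_box_mass (n p n' p' : nat) : nat :=
  (n * (n + r) * (p * (p + r)) * (n' * (n' + r) * (p' * (p' + r))))%N.

Lemma box_ramanujan_le (x : int) (n p : nat) (y : int) (n' p' : nat) (l : int) (K : C) :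
  (forall c, `|kloosterman zchar l%:~R c| <= K) ->
  (r%:R * `|box_ramanujan_sum x n p y n' p' l|) ^+ 2
    <= (smooth_box_mass n p n' p')%:R * K ^+ 2.
Proof.
move=> KP; have K0 : 0 <= K by exact: le_trans (KP 0).
rewrite -[r%:R]normr_nat -normrM -{1}card_Zr.
rewrite /box_ramanujan_sum (box_ramanujan zcharD zchar_sum).
rewrite /smooth_box_mass natrM.
pose F a := \sum_(t : 'I_n * 'I_p) zchar (a * (x + t.1%:Z + t.2%:Z)%:~R).
pose G a := \sum_(t : 'I_n' * 'I_p') zchar (a * (y + t.1%:Z + t.2%:Z)%:~R).
apply: (@le_trans _ _ (((\sum_a `|F a|) * (\sum_a `|G a|) * K) ^+ 2)).
  rewrite lerXn2r ?nnegrE ?normr_ge0 ?mulr_ge0 ?sumr_ge0 //.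
  apply: le_trans (ler_norm_sum _ _ _) _; rewrite -mulrA big_distrl /=.
  apply: ler_sum => a _; apply: le_trans (ler_norm_sum _ _ _) _.
  rewrite big_distrl big_distrr /=; apply: ler_sum => b _.
  by rewrite !normrM -mulrA ler_wpM2l // ler_wpM2l.
rewrite !exprMn ler_wpM2r ?exprn_ge0 //.
by rewrite ler_pM ?exprn_ge0 ?sumr_ge0 ?smoothed_interval_l1.
Qed.

Lemma box_ramanujan_trivial (x : int) (n p : nat) (y : int) (n' p' : nat) (l : int) :
  `|box_ramanujan_sum x n p y n' p' l| ^+ 2 <= (smooth_box_mass n p n' p')%:R.
Proof.
have r0 : 0 < r%:R :> C by rewrite ltr0n ltnW.
rewrite -(ler_pM2l (exprn_gt0 2 r0)) -exprMn.
rewrite [leRHS]mulrC; apply: box_ramanujan_le => c.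
apply: le_trans (ler_norm_sum _ _ _) _.
under eq_bigr => k _ do rewrite zchar_norm.
by rewrite sumr_const ler_nat (leq_trans (max_card _)) // card_Zr.
Qed.

(** The energy contributes [tau r ^ 2]; the third factor [tau r] pays for replacing [totient r] by
    [r]. *)
Lemma box_ramanujan_kloosterman (x : int) (n p : nat) (y : int) (n' p' : nat) (l : int) :
  r%:R * `|box_ramanujan_sum x n p y n' p' l| ^+ 4
    <= (2 * gcdn `|l| r * tau r ^ 3 * smooth_box_mass n p n' p' ^ 2)%:R.
Proof.
have r0 : 0 < r%:R :> C by rewrite ltr0n ltnW.
have t0 : 0 < (totient r)%:R :> C by rewrite ltr0n totient_gt0 ltnW.
set Q := smooth_box_mass n p n' p'; set S := box_ramanujan_sum _ _ _ _ _ _ _.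
set D : C := (2 * gcdn `|l| r * r ^ 4 * tau r ^ 2)%:R.
have D0 : 0 <= D / (totient r)%:R by rewrite divr_ge0 ?ler0n.
have KE : (4.-root (D / (totient r)%:R)) ^+ 4 = D / (totient r)%:R by rewrite rootCK.
have K0 : 0 <= 4.-root (D / (totient r)%:R) by rewrite rootC_ge0.
have KP c : `|kloosterman zchar l%:~R c| <= 4.-root (D / (totient r)%:R).
  rewrite -(@ler_pXn2r _ 4) ?nnegrE // KE ler_pdivlMr // mulrC.
  exact: kloosterman_Zr.
have := box_ramanujan_le x n p y n' p' KP; rewrite -/Q -/S => h.
have {h} : (r%:R * `|S|) ^+ 4 <= Q%:R ^+ 2 * (D / (totient r)%:R).
  rewrite -KE (exprM _ 2 2) [in leRHS](exprM _ 2 2) -exprMn.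
  by rewrite lerXn2r ?nnegrE ?mulr_ge0 ?exprn_ge0 ?ler0n.
rewrite mulrA ler_pdivlMr // exprMn => h.
rewrite -(ler_pM2l (exprn_gt0 4 r0)).
apply: (@le_trans _ _ (r%:R ^+ 4 * ((totient r * tau r)%:R * `|S| ^+ 4))).
  rewrite ler_wpM2l ?exprn_ge0 ?ler0n // ler_wpM2r ?exprn_ge0 //.
  by rewrite ler_nat leq_totient_tau ?(ltnW r1).
rewrite (_ : _ * _ = r%:R ^+ 4 * `|S| ^+ 4 * (totient r)%:R * (tau r)%:R); last first.
  by rewrite natrM; ring.
apply: (@le_trans _ _ (Q%:R ^+ 2 * D * (tau r)%:R)); first by rewrite ler_wpM2r ?ler0n.
by apply: le_of_eq; rewrite /D !natrM; ring.
Qed.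

End residue_characters.

(** * Counting solutions in smoothed boxes *)

(** In lowest terms [c / u] has denominator [r = u / gcd(c, u)]. *)
Lemma sum_by_reduced_fraction (V : nmodType) (u : nat) (F : nat -> V) : (0 < u)%N ->
  \sum_(c < u) F c
  = \sum_(r <- divisors u) \sum_(k < r | coprime k r) F (k * (u %/ r))%N.
Proof.
move=> u0; rewrite -(big_mkord xpredT F).
have gcd_div c : (u %/ gcdn c u %| u)%N by rewrite dvdn_div ?dvdn_gcdr.
transitivity (\sum_(r <- divisors u) \sum_(0 <= c < u | (u %/ gcdn c u == r)%N) F c).
  rewrite (exchange_big_dep xpredT) //=; apply: eq_bigr => c _.
  rewrite (big_rem (u %/ gcdn c u)%N) /=; last by rewrite -dvdn_divisors.
  rewrite eqxx big_seq_cond big_pred0 ?addr0 // => r.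
  rewrite mem_rem_uniq ?divisors_uniq // inE.
  by rewrite [X in _ && X]eq_sym; case: (r == _); rewrite ?andbF.
rewrite big_seq [RHS]big_seq; apply: eq_bigr => r; rewrite -dvdn_divisors // => ru.
have r0 := dvdn_gt0 u0 ru.
have ur0 : (0 < u %/ r)%N by rewrite divn_gt0 // dvdn_leq.
have uE : u = (u %/ r * r)%N by rewrite divnK.
rewrite -(big_mkord (fun k => coprime k r) (fun k => F (k * (u %/ r))%N)).
rewrite -[LHS]big_filter -[RHS]big_filter -(big_map (fun k => k * (u %/ r))%N xpredT F).
apply: perm_big; apply: uniq_perm.
- by rewrite filter_uniq // iota_uniq.
- rewrite map_inj_uniq ?filter_uniq ?iota_uniq // => a b /eqP.
  by rewrite eqn_pmul2r // => /eqP.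
move=> c; rewrite mem_filter mem_index_iota; apply/andP/mapP => [[/eqP cE /andP[_ cu]]|[k]].
  have gE : gcdn c u = (u %/ r)%N.
    by rewrite -cE divnA ?dvdn_gcdr // mulKn.
  have dc : (u %/ r %| c)%N by rewrite -gE dvdn_gcdl.
  exists (c %/ (u %/ r))%N; last by rewrite divnK.
  rewrite mem_filter mem_index_iota /=; apply/andP; split.
    by rewrite /coprime -(eqn_pmul2r ur0) muln_gcdl divnK // [(r * _)%N]mulnC -uE gE mul1n.
  by rewrite ltn_divLR // mulnC -uE.
rewrite mem_filter mem_index_iota /= => /andP[kr krr] ->.
rewrite [X in gcdn _ X]uE [(u %/ r * r)%N]mulnC -muln_gcdl (eqP kr) mul1n.
split; last by rewrite [X in (_ < X)%N]uE mulnC ltn_pmul2l.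
by rewrite divnA ?dvdn_div // mulKn.
Qed.

Lemma natr_dist_le (F : numDomainType) (a b e : nat) :
  (a <= b + e)%N -> (b <= a + e)%N -> `|a%:R - b%:R : F| <= e%:R.
Proof.
move=> ab ba; rewrite real_ler_distl ?rpredB ?realn // lerBlDr -!natrD !ler_nat.
by rewrite ab ba.
Qed.

Lemma natr_dist_leE (F : numDomainType) (a b e : nat) :
  `|a%:R - b%:R : F| <= e%:R -> (a <= b + e)%N /\ (b <= a + e)%N.
Proof.
rewrite real_ler_distl ?rpredB ?realn // lerBlDr -!natrD !ler_nat.
by case/andP.
Qed.

Definition unity_root (r : nat) : algC := sval (C_prim_root_exists (ltn0Sn r.-1)).

Lemma unity_rootP (r : nat) : (0 < r)%N -> r.-primitive_root (unity_root r).
Proof. by case: r => // r _; exact: svalP (C_prim_root_exists (ltn0Sn r)). Qed.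

Section ramanujan_Zr.
Variables (r : nat).
Hypothesis (r1 : (1 < r)%N).
Let r0 : (0 < r)%N := ltnW r1.

(** One root is a power of the other with exponent prime to [r], which permutes the units. Roots of
    order [r] obtained from a root of order [u] can thus be compared with the fixed
    [unity_root r]. *)
Lemma ramanujan_Zr_indep (w w' : algC) (z : 'Z_r) :
  r.-primitive_root w -> r.-primitive_root w' ->
  ramanujan (zchar w) z = ramanujan (zchar w') z.
Proof.
move=> wr wr'; have [j wE] := prim_rootP wr' (prim_expr_order wr).
have ju : (j%:R : 'Z_r) \is a GRing.unit.
  by rewrite unitZpE // coprime_sym -(prim_root_exp_coprime _ wr') -wE.
rewrite -(ramanujan_unit (zchar w') z ju); apply: eq_bigr => k _.
have -> : zchar w (k * z) = zchar w' (j%:R * (k * z)).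
  by rewrite -[k * z]natr_Zp -natrM !zchar_nat // wE -exprM.
by congr zchar; ring.
Qed.

Lemma ramanujan_Zr_sum (w : algC) (n : nat) : r.-primitive_root w ->
  ramanujan (zchar w) (n%:R : 'Z_r) = \sum_(k < r | coprime k r) w ^+ (k * n).
Proof.
move=> wr; rewrite /ramanujan.
transitivity (\sum_(k < (Zp_trunc r).+2 | coprime k r) w ^+ (k * n)).
  apply: eq_big => k; first by rewrite -{1}[k]natr_Zp unitZpE // coprime_sym.
  by move=> _; rewrite -{1}[k]natr_Zp -natrM zchar_nat.
rewrite -(big_mkord (fun k => coprime k r) (fun k => w ^+ (k * n))).
by rewrite -[RHS](big_mkord (fun k => coprime k r) (fun k => w ^+ (k * n))) Zp_cast.
Qed.

(** As [r > 1], a unit [k] is nonzero and defines a nontrivial character. *)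
Lemma ramanujan_Zr_mean (w : algC) (z : 'Z_r) : r.-primitive_root w ->
  \sum_x ramanujan (zchar w) (z + x) = 0.
Proof.
move=> wr; rewrite [LHS](reindex_inj (addrI (- z))) /=.
rewrite (eq_bigr (fun x => ramanujan (zchar w) x)) => [|x _]; last by rewrite addrA subrr add0r.
rewrite exchange_big /= big1 // => k ku; rewrite zchar_sum //.
by case: eqP ku => [->|_ _]; [rewrite unitr0 | rewrite mulr0].
Qed.

Lemma ramanujan_Zr_le (w : algC) (z : 'Z_r) : r.-primitive_root w ->
  `|ramanujan (zchar w) z| <= r%:R.
Proof.
move=> wr; apply: le_trans (ler_norm_sum _ _ _) _.
under eq_bigr => k _ do rewrite zchar_norm //.
by rewrite sumr_const ler_nat (leq_trans (max_card _)) // card_Zr.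
Qed.

Definition ram (z : int) : algC := ramanujan (zchar (unity_root r)) (z%:~R : 'Z_r).

(** Group the pairs by the residue of [q.2]. Ramanujan sums have mean zero, so the count of the
    residue 0 may be subtracted from every count; there remain [r] residues, values at most [r] and
    differences at most [E]. *)
Lemma sum_ram_le (s : seq (nat * int)) (E : nat) (z : int) :
  (forall a b : int,
    count (fun q : nat * int => (r %| q.1)%N && (r%:Z %| (q.2 - a)%R)%Z) s <=
    count (fun q : nat * int => (r %| q.1)%N && (r%:Z %| (q.2 - b)%R)%Z) s + E)%N ->
  `|\sum_(q <- s | (r %| q.1)%N) ram (z + q.2)| <= (r * (r * E))%:R.
Proof.
move=> HE; have wr := unity_rootP r0.
pose N (a : int) := count (fun q : nat * int => (r %| q.1)%N && (r%:Z %| (q.2 - a)%R)%Z) s.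
have -> : \sum_(q <- s | (r %| q.1)%N) ram (z + q.2) =
    \sum_(x : 'Z_r) ramanujan (zchar (unity_root r)) (z%:~R + x) *
       ((N (x : nat)%:Z)%:R - (N 0)%:R).
  under [RHS]eq_bigr => x _ do rewrite mulrBr.
  rewrite sumrB -big_distrl /= ramanujan_Zr_mean // mul0r subr0.
  under [RHS]eq_bigr => x _ do rewrite /N -sum1_count natr_sum big_distrr big_mkcond /=.
  rewrite [RHS]exchange_big [LHS]big_mkcond /=; apply: eq_bigr => q _.
  case: (r %| q.1)%N => /=; last by rewrite big1.
  have xE x : (r%:Z %| q.2 - (nat_of_ord x)%:Z)%Z = (x == q.2%:~R :> 'Z_r).
    by rewrite -Zp_intr_eq0 // intrB -[_%:~R in X in _ - X]pmulrn natr_Zp subr_eq0 eq_sym.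
  rewrite (bigD1 (q.2%:~R : 'Z_r)) //= big1 => [|x /negbTE xn]; last by rewrite xE xn.
  by rewrite xE eqxx addr0 mulr1 /ram intrD.
apply: le_trans (ler_norm_sum _ _ _) _.
apply: (@le_trans _ _ (\sum_(x : 'Z_r) (r%:R * E%:R))); last first.
  by rewrite sumr_const card_Zr // -[leLHS]mulr_natl !natrM.
apply: ler_sum => x _; rewrite normrM ler_pM ?normr_ge0 ?ramanujan_Zr_le //.
by apply: natr_dist_le; exact: HE.
Qed.
End ramanujan_Zr.

(** The first interval carries [m], the second the modulus [N]. Letting [t] run over a product
    realises the convolution of two intervals. *)
Definition smooth_count (x : int) (n p : nat) (y : int) (n' p' : nat) (u : nat) (l : int) : nat :=
  \sum_(t : 'I_n * 'I_p) \sum_(t' : 'I_n' * 'I_p')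
    (u%:Z %| ((x + t.1%:Z + t.2%:Z) * (y + t'.1%:Z + t'.2%:Z) + l)%R)%Z.

(** Detect [u | z] by all additive characters modulo [u] and collect those of exact order [r]. *)
Lemma sum_ram (u : nat) (z : int) : (0 < u)%N ->
  (u * (u%:Z %| z)%Z)%:R = 1 + \sum_(r <- divisors u | (1 < r)%N) ram r z.
Proof.
move=> u0; have wu := unity_rootP u0; set w := unity_root u in wu.
have [u1|u1] := leqP u 1.
  have -> : u = 1%N by lia.
  by rewrite big_cons big_nil /= dvd1z addr0.
pose n := absz (z %% u)%Z.
have uZ : u%:Z != 0 by lia.
have nE : n%:Z = (z %% u)%Z by rewrite /n gez0_abs // modz_ge0.
have zn r : (r %| u)%N -> (1 < r)%N -> z%:~R = n%:R :> 'Z_r.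
  move=> ru r1; apply/eqP; rewrite pmulrn -subr_eq0 -intrB Zp_intr_eq0 // nE.
  rewrite {1}(divz_eq z u) addrK dvdz_mull //.
have -> : (u * (u%:Z %| z)%Z)%:R = \sum_(c < u) w ^+ (c * n).
  have -> : (u%:Z %| z)%Z = (n%:R == 0 :> 'Z_u) by rewrite -(zn u) // Zp_intr_eq0.
  have := zchar_sum u1 wu n%:R; rewrite card_Zr // -natrM => <-.
  transitivity (\sum_(c < (Zp_trunc u).+2) w ^+ (c * n)).
    by apply: eq_bigr => c _; rewrite -{1}[c]natr_Zp -natrM zchar_nat // mulnC.
  rewrite -(big_mkord xpredT (fun c => w ^+ (c * n))) Zp_cast //.
  by rewrite big_mkord.
rewrite (sum_by_reduced_fraction (fun c => w ^+ (c * n))) // (bigD1_seq 1%N) ?divisors_uniq -?dvdn_divisors //=.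
congr (_ + _).
  by rewrite big_mkcond big_ord_recl big_ord0 /= mul0n mul0n expr0 addr0.
rewrite big_seq_cond [RHS]big_seq_cond; apply: eq_big => r.
  by rewrite -dvdn_divisors //; case: (r) => [|[|]] //=; rewrite ?andbF // dvd0n; case: (u) u0.
rewrite -dvdn_divisors // => /andP[ru rn1].
have r0 := dvdn_gt0 u0 ru; have r1 : (1 < r)%N by rewrite ltn_neqAle eq_sym rn1.
have wr : r.-primitive_root (w ^+ (u %/ r)) by apply: dvdn_prim_root.
rewrite /ram (ramanujan_Zr_indep r1 _ (unity_rootP r0) wr) zn // ramanujan_Zr_sum //.
by apply: eq_bigr => k _; rewrite -exprM; congr (_ ^+ _); rewrite mulnCA mulnA.
Qed.

Definition ram_box (x : int) (n p : nat) (y : int) (n' p' : nat) (r : nat) (l : int) : algC :=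
  box_ramanujan_sum r (unity_root r) x n p y n' p' l.

Lemma ram_boxE (x : int) (n p : nat) (y : int) (n' p' : nat) (r : nat) (l : int) :
  ram_box x n p y n' p' r l = \sum_(t : 'I_n * 'I_p) \sum_(t' : 'I_n' * 'I_p')
    ram r ((x + t.1%:Z + t.2%:Z) * (y + t'.1%:Z + t'.2%:Z) + l).
Proof.
rewrite /ram_box /box_ramanujan_sum; apply: eq_bigr => t _; apply: eq_bigr => t' _.
by rewrite /ram [in RHS]intrD [in RHS]intrM.
Qed.

Lemma smooth_count_expand (x : int) (n p : nat) (y : int) (n' p' : nat) (u : nat) (l : int) :
  (0 < u)%N ->
  (u * smooth_count x n p y n' p' u l)%:R
  = (n * p * (n' * p'))%:R
    + \sum_(r <- divisors u | (1 < r)%N) ram_box x n p y n' p' r l.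
Proof.
move=> u0; under eq_bigr => r _ do rewrite ram_boxE.
rewrite exchange_big /= /smooth_count natrM natr_sum big_distrr /=.
have -> : (n * p * (n' * p'))%:R = \sum_(t : 'I_n * 'I_p) (n' * p')%:R :> algC.
  by rewrite sumr_const card_prod !card_ord -[RHS]mulr_natl -natrM.
rewrite -big_split /=; apply: eq_bigr => t _.
rewrite exchange_big /= natr_sum big_distrr /=.
have -> : (n' * p')%:R = \sum_(t : 'I_n' * 'I_p') 1 :> algC.
  by rewrite sumr_const card_prod !card_ord.
rewrite -big_split /=; apply: eq_bigr => t' _.
by rewrite -natrM sum_ram.
Qed.

Lemma big_divisors_le (V : nmodType) (u R : nat) (P : pred nat) (F : nat -> V) : (0 < u)%N ->
  \sum_(r <- divisors u | P r && (r <= R)%N) F r = \sum_(r < R.+1 | P r && (r %| u)%N) F r.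
Proof.
move=> u0; rewrite -(big_mkord (fun r => P r && (r %| u)%N) F).
rewrite -[LHS]big_filter -[RHS]big_filter; apply: perm_big; apply: uniq_perm.
- by rewrite filter_uniq ?divisors_uniq.
- by rewrite filter_uniq ?iota_uniq.
move=> r; rewrite !mem_filter mem_index_iota -dvdn_divisors // ltnS /=.
by case: (P r); case: (r <= R)%N; rewrite ?andbT ?andbF.
Qed.

Lemma sum_ram_box_le (s : seq (nat * int)) (x : int) (n p : nat) (y : int) (n' p' r E : nat) :
  (1 < r)%N -> (forall a b : int,
    count (fun q : nat * int => (r %| q.1)%N && (r%:Z %| (q.2 - a)%R)%Z) s <=
    count (fun q : nat * int => (r %| q.1)%N && (r%:Z %| (q.2 - b)%R)%Z) s + E)%N ->
  `|\sum_(q <- s | (r %| q.1)%N) ram_box x n p y n' p' r q.2|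
    <= (n * p * (n' * p') * (r * (r * E)))%:R.
Proof.
move=> r1 HE; under eq_bigr => q _ do rewrite ram_boxE.
rewrite [X in `|X|]exchange_big /=.
under eq_bigr => t _ do rewrite exchange_big /=.
apply: le_trans (ler_norm_sum _ _ _) _.
apply: (@le_trans _ _ (\sum_(t : 'I_n * 'I_p) (n' * p' * (r * (r * E)))%:R)).
  apply: ler_sum => t _; apply: le_trans (ler_norm_sum _ _ _) _.
  apply: (@le_trans _ _ (\sum_(t : 'I_n' * 'I_p') (r * (r * E))%:R)).
    by apply: ler_sum => t' _; exact: sum_ram_le.
  by rewrite sumr_const card_prod !card_ord -[leLHS]mulr_natl -natrM.
by rewrite sumr_const card_prod !card_ord -[leLHS]mulr_natl -natrM mulnA.
Qed.

(* [E] controls the equidistribution of the pairs [(u, l)] modulo the small [r],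
   [e] comes from the Kloosterman bound for the large [r]. *)
Lemma weighted_smooth_count (s : seq (nat * int)) (x : int) (n p : nat) (y : int)
    (n' p' : nat) (R G E e e1 : nat) :
  (forall q, q \in s -> 0 < q.1)%N ->
  (forall r, 1 < r -> r <= R -> forall a b : int,
    count (fun q : nat * int => (r %| q.1)%N && (r%:Z %| (q.2 - a)%R)%Z) s <=
    count (fun q : nat * int => (r %| q.1)%N && (r%:Z %| (q.2 - b)%R)%Z) s + E)%N ->
  (forall q, q \in s -> gcdn `|q.2| q.1 <= G -> forall r, r %| q.1 -> R < r ->
    2 * G * tau r ^ 3 * smooth_box_mass r n p n' p' ^ 2 <= r * e ^ 4)%N ->
  (forall r, r <= R -> smooth_box_mass r n p n' p' <= e1 ^ 2)%N ->
  let A := (\sum_(q <- s) q.1 * smooth_count x n p y n' p' q.1 q.2)%N in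
  let B := (n * p * (n' * p') * size s)%N in
  let Err := (n * p * (n' * p') * (R ^ 3 * E) +
    \sum_(q <- s | gcdn `|q.2| q.1 <= G) tau q.1 * e +
    \sum_(q <- s | ~~ (gcdn `|q.2| q.1 <= G))
      (q.1 * smooth_count x n p y n' p' q.1 q.2 + n * p * (n' * p') + tau q.1 * e1))%N in
  (A <= B + Err)%N /\ (B <= A + Err)%N.
Proof.
move=> s0 HE Hgood Hbad A B Err; apply: (@natr_dist_leE algC).
set N := (n * p * (n' * p'))%N in B Err *.
(* The moduli [r <= R] are summed over all pairs before absolute values are taken; the rest is
   bounded pair by pair. *)
pose small q := \sum_(r <- divisors q.1 | (1 < r <= R)%N) ram_box x n p y n' p' r q.2.
have small_le : `|\sum_(q <- s) small q| <= (N * (R ^ 3 * E))%:R.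
  have -> : \sum_(q <- s) small q = \sum_(r < R.+1 | (1 < r)%N)
      \sum_(q <- s | (r %| q.1)%N) ram_box x n p y n' p' r q.2.
    rewrite (exchange_big_dep xpredT) //= big_seq [RHS]big_seq; apply: eq_bigr => q /s0 q0.
    rewrite /small big_divisors_le //.
  apply: le_trans (ler_norm_sum _ _ _) _.
  apply: (@le_trans _ _ (\sum_(r < R.+1 | (1 < r)%N) (N * (R * (R * E)))%:R)).
    apply: ler_sum => r r1; have rR : (r <= R)%N by rewrite -ltnS.
    apply: le_trans (sum_ram_box_le x n p y n' p' r1 (HE _ r1 rR)) _.
    by rewrite ler_nat -/N !leq_mul.
  rewrite -natr_sum ler_nat big_mkcond big_ord_recl /= add0n.
  apply: (@leq_trans (\sum_(i < R) N * (R * (R * E)))%N).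
    by apply: leq_sum => i _; case: ifP.
  by rewrite sum_nat_const card_ord leq_eqVlt; apply/orP; left; apply/eqP; ring.
have -> : A%:R - B%:R = \sum_(q <- s) small q +
   \sum_(q <- s) ((q.1 * smooth_count x n p y n' p' q.1 q.2)%:R - N%:R - small q) :> algC.
  rewrite !sumrB [RHS]addrC subrK natr_sum; congr (_ - _).
  by rewrite big_const_seq count_predT iter_addr_0 -mulrnA.
apply: le_trans (ler_normD _ _) _; rewrite /Err -addnA natrD; apply: lerD => //.
apply: le_trans (ler_norm_sum _ _ _) _.
rewrite (bigID (fun q : nat * int => (gcdn `|q.2| q.1 <= G)%N)) /= natrD.
apply: lerD; rewrite natr_sum big_seq_cond [leRHS]big_seq_cond; apply: ler_sum => q /andP[qs qG].
  have q0 := s0 q qs.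
  rewrite smooth_count_expand // -/N (bigID (fun r => (r <= R)%N)) /= -/(small q).
  have cancel (a b c : algC) : c + (a + b) - c - a = b by ring.
  rewrite {}cancel.
  apply: le_trans (ler_norm_sum _ _ _) _.
  apply: (@le_trans _ _ (\sum_(r <- divisors q.1) e%:R)); last first.
    by rewrite big_const_seq count_predT iter_addr_0 -[leLHS]mulr_natl -natrM.
  rewrite big_mkcond /= big_seq [leRHS]big_seq; apply: ler_sum => r.
  rewrite -dvdn_divisors // => ru; case: ifP => [/andP[r1]|_]; last exact: ler0n.
  rewrite -ltnNge => Rr; have r0 := ltnW r1.
  rewrite -(@ler_pXn2r _ 4) ?nnegrE ?ler0n //.
  have r0' : 0 < r%:R :> algC by rewrite ltr0n.
  rewrite -(ler_pM2l r0').
  apply: le_trans (box_ramanujan_kloosterman r1 (unity_rootP r0) _ _ _ _ _ _ _) _.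
  rewrite -natrX -natrM ler_nat; apply: leq_trans (Hgood q qs qG r ru Rr).
  rewrite !leq_mul2r leq_mul2l; apply/orP; right; apply/orP; right.
  apply: leq_trans qG; rewrite dvdn_leq ?gcdn_gt0 ?q0 ?orbT //.
  by rewrite dvdn_gcd dvdn_gcdl (dvdn_trans (dvdn_gcdr _ _) ru).
(* For a pair with a large common divisor the count, the main term and the small moduli are bounded
   separately. *)
have q0 := s0 q qs.
apply: le_trans (ler_normB _ _) _; rewrite natrD; apply: lerD.
  by apply: le_trans (ler_normB _ _) _; rewrite !normr_nat natrD.
apply: le_trans (ler_norm_sum _ _ _) _.
apply: (@le_trans _ _ (\sum_(r <- divisors q.1) e1%:R)); last first.
  by rewrite big_const_seq count_predT iter_addr_0 -[leLHS]mulr_natl -natrM.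
rewrite big_mkcond /=; apply: ler_sum => r _.
case: ifP => [/andP[r1 rR]|_]; last exact: ler0n.
rewrite -(@ler_pXn2r _ 2) ?nnegrE ?ler0n //.
apply: le_trans (box_ramanujan_trivial r1 (unity_rootP (ltnW r1)) _ _ _ _ _ _ _) _.
by rewrite -natrX ler_nat Hbad.
Qed.

(** * Sharp boxes: comparison with smoothed ones and a trivial bound *)

Definition box_count (x : int) (n : nat) (y : int) (n' u : nat) (l : int) : nat :=
  \sum_(i < n) \sum_(j < n') (u%:Z %| ((x + i%:Z) * (y + j%:Z) + l)%R)%Z.

Lemma leq_sum_shift (F : int -> nat) (x x' : int) (n n' : nat) :
  x' <= x -> x + n%:Z <= x' + n'%:Z ->
  (\sum_(i < n) F (x + i%:Z)%R <= \sum_(i < n') F (x' + i%:Z)%R)%N.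
Proof.
move=> xx nn; have [a aE] : exists a : nat, x = x' + a%:Z by exists `|x - x'|%N; lia.
rewrite -[in leqRHS](@subnKC (a + n) n'); last by lia.
rewrite !big_split_ord /= aE.
under eq_bigr => i _ do rewrite -addrA -PoszD.
by rewrite -addnA addnCA leq_addr.
Qed.

Lemma box_count_mono (x x2 : int) (n n2 : nat) (y y2 : int) (n' n2' u : nat) (l : int) :
  x2 <= x -> x + n%:Z <= x2 + n2%:Z -> y2 <= y -> y + n'%:Z <= y2 + n2'%:Z ->
  (box_count x n y n' u l <= box_count x2 n2 y2 n2' u l)%N.
Proof.
move=> h1 h2 h3 h4; rewrite /box_count.
apply: leq_trans (leq_sum_shift (fun m => \sum_(j < n2')
   ((u%:Z %| (m * (y2 + j%:Z) + l)%R)%Z : nat))%N h1 h2).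
apply: leq_sum => i _.
exact: (leq_sum_shift (fun m => (u%:Z %| ((x + i%:Z) * m + l)%R)%Z : nat) h3 h4).
Qed.

Lemma smooth_countE (x : int) (n p : nat) (y : int) (n' p' u : nat) (l : int) :
  smooth_count x n p y n' p' u l
  = (\sum_(k < p) \sum_(k' < p') box_count (x + k%:Z)%R n (y + k'%:Z)%R n' u l)%N.
Proof.
rewrite /smooth_count /box_count.
rewrite -(pair_bigA _ (fun (i : 'I_n) (k : 'I_p) => \sum_(t' : 'I_n' * 'I_p')
    ((u%:Z %| ((x + i%:Z + k%:Z) * (y + t'.1%:Z + t'.2%:Z) + l)%R)%Z : nat))%N) /=.
rewrite [LHS]exchange_big /=; apply: eq_bigr => k _.
rewrite [RHS]exchange_big /=; apply: eq_bigr => i _.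
rewrite -(pair_bigA _ (fun (j : 'I_n') (k' : 'I_p') =>
    ((u%:Z %| ((x + i%:Z + k%:Z) * (y + j%:Z + k'%:Z) + l)%R)%Z : nat))%N) /=.
rewrite [LHS]exchange_big /=; apply: eq_bigr => k' _; apply: eq_bigr => j _.
by congr (nat_of_bool (_ %| _)%Z); ring.
Qed.

(** The smoothed count is a sum over [p * p'] translates of the enlarged box, each of which contains
    the original box. *)
Lemma smooth_count_ge (x : int) (n p : nat) (y : int) (n' p' u : nat) (l : int) :
  (p * p' * box_count x n y n' u l
   <= smooth_count (x - p%:Z)%R (n + p) p (y - p'%:Z)%R (n' + p') p' u l)%N.
Proof.
rewrite smooth_countE -mulnA.
rewrite -[X in (X * _ <= _)%N]card_ord -sum_nat_const; apply: leq_sum => k _.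
rewrite -[X in (X * _ <= _)%N]card_ord -sum_nat_const; apply: leq_sum => k' _.
have := ltn_ord k; have := ltn_ord k'.
by move=> ? ?; apply: box_count_mono; lia.
Qed.

(** All translates of the shrunk box stay inside the original one. If a side is shorter than the
    smoothing, truncated subtraction makes the left side 0. *)
Lemma smooth_count_le (x : int) (n p : nat) (y : int) (n' p' u : nat) (l : int) :
  (smooth_count x (n - p) p y (n' - p') p' u l <= p * p' * box_count x n y n' u l)%N.
Proof.
rewrite smooth_countE -mulnA.
rewrite -[X in (_ <= X * _)%N]card_ord -sum_nat_const; apply: leq_sum => k _.
rewrite -[X in (_ <= X * _)%N]card_ord -sum_nat_const; apply: leq_sum => k' _.
have := ltn_ord k; have := ltn_ord k'.
have [np|np] := leqP n p.
  by rewrite /box_count (_ : n - p = 0)%N ?big_ord0 //; lia.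
have [np'|np'] := leqP n' p'.
  rewrite {1}/box_count (_ : n' - p' = 0)%N; last by lia.
  by move=> _ _; rewrite big1 // => i _; rewrite big_ord0.
by move=> ? ?; apply: box_count_mono; lia.
Qed.

(** A solution exists only if [g = gcd(u, N)] divides [l], and the solutions then lie in one class
    modulo [u / g]. *)
Lemma linear_congruence_count (x N l : int) (n u : nat) : (0 < u)%N ->
  (\sum_(i < n) (u%:Z %| ((x + i%:Z) * N + l)%R)%Z
   <= (n %/ u).+1 * (gcdn u `|N| * (gcdn u `|N| %| `|l|)))%N.
Proof.
move=> u0; set g := gcdn u `|N|.
have g0 : (0 < g)%N by rewrite gcdn_gt0 u0.
have gu : (g %| u)%N by exact: dvdn_gcdl.
have ug0 : (0 < u %/ g)%N by rewrite divn_gt0 // dvdn_leq.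
have [i0 hi0|no] := pickP (fun i : 'I_n => (u%:Z %| ((x + i%:Z) * N + l)%R)%Z); last first.
  by rewrite big1 // => i _; rewrite no.
have gl : (g %| `|l|)%N.
  have : (g%:Z %| l)%Z.
    rewrite (_ : l = (x + i0%:Z) * N + l - (x + i0%:Z) * N); last by ring.
    apply: rpredB; first by apply: dvdz_trans hi0; rewrite dvdzE.
    by rewrite dvdz_mull // dvdzE /= dvdn_gcdr.
  by rewrite dvdzE.
rewrite gl muln1.
apply: (@leq_trans (\sum_(i < n) ((u %/ g)%:Z %| (- i0%:Z + i%:Z)%R)%Z)).
  apply: leq_sum => i _; case: (boolP (u%:Z %| _)%Z) => // hi.
  rewrite lt0n eqb0 negbK.
  have : (u%:Z %| (- i0%:Z + i%:Z) * N)%Z.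
    rewrite (_ : _ * N = ((x + i%:Z) * N + l) - ((x + i0%:Z) * N + l)); last by ring.
    by rewrite rpredB.
  rewrite !dvdzE abszM !absz_nat => h.
  have : (u %/ g %| `|(- i0%:Z + i%:Z)%R| * (`|N| %/ g))%N.
    rewrite -(dvdn_pmul2r g0) (divnK gu) -mulnA.
    by rewrite (divnK (dvdn_gcdr _ _)).
  by rewrite mulnC Gauss_dvdr // /coprime -(eqn_pmul2r g0) muln_gcdl
     !divnK ?dvdn_gcdl ?dvdn_gcdr // mul1n.
have /andP[_ /leq_trans] := sum_dvd_bounds (- i0%:Z)%R n ug0; apply.
have -> : (n %/ (u %/ g) = n * g %/ u)%N by rewrite divnA.
by rewrite ltn_divLR // mulnAC ltn_pmul2r // ltn_ceil.
Qed.

(** Sum over [g = gcd(u, N)], a common divisor of [u] and [l]: at most [n' / g + 1] of the [N] are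
    multiples of [g], each with weight [g]. It serves for pairs with a large common divisor and for
    small [u]. *)
Lemma box_count_trivial (x : int) (n : nat) (y : int) (n' u : nat) (l : int) : (0 < u)%N ->
  (box_count x n y n' u l <= (n %/ u).+1 * (tau u * (n' + gcdn `|l| u)))%N.
Proof.
move=> u0; rewrite /box_count exchange_big /=.
apply: (@leq_trans (\sum_(j < n') (n %/ u).+1 *
  (gcdn u `|(y + j%:Z)%R| * (gcdn u `|(y + j%:Z)%R| %| `|l|)))%N).
  by apply: leq_sum => j _; exact: linear_congruence_count.
rewrite -big_distrr leq_mul2l /=.
apply: (@leq_trans (\sum_(j < n') \sum_(g <- divisors u)
   g * (g %| `|l|) * (g%:Z %| (y + j%:Z)%R)%Z)%N).
  apply: leq_sum => j _; set g := gcdn u _.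
  apply: leq_trans (leq_sum_divisors (fun g => g * (g %| `|l|) * (g%:Z %| (y + j%:Z)%R)%Z)%N
    u0 (dvdn_gcdl u `|(y + j%:Z)%R|)).
  by rewrite -/g (_ : (g%:Z %| _)%Z = true) ?muln1 // dvdzE /= dvdn_gcdr.
rewrite exchange_big /=.
apply: (@leq_trans (\sum_(g <- divisors u) (n' + gcdn `|l| u))%N); last first.
  by rewrite big_const_seq count_predT iter_addn_0 mulnC.
rewrite big_seq [leqRHS]big_seq; apply: leq_sum => g; rewrite -dvdn_divisors // => gu.
have g0 := dvdn_gt0 u0 gu; rewrite -big_distrr /=.
case: (boolP (g %| `|l|)%N) => gl; last by rewrite muln0 mul0n.
rewrite muln1; have /andP[_ h] := sum_dvd_bounds y n' g0.
apply: leq_trans (leq_mul (leqnn g) h) _.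
rewrite mulnS addnC leq_add //; first by rewrite mulnC leq_trunc_div.
by rewrite dvdn_leq ?gcdn_gt0 ?u0 ?orbT // dvdn_gcd gl.
Qed.

(** * Equidistribution of the admissible residues *)

Section ceiling_sums.
Variable R : realType.
Implicit Types (x y z t : R).

Lemma ceil_div_intE (q : nat) (c k : int) : (0 < q)%N ->
  (Num.ceil (c%:~R / q%:R : R) <= k) = (c <= k * q%:Z).
Proof.
move=> q0; rewrite ceil_le_int ler_pdivrMr ?ltr0n // (_ : q%:R = q%:Z%:~R) //.
by rewrite -intrM ler_int.
Qed.

Lemma ceil_divS (q : nat) (c : int) : (0 < q)%N ->
  Num.ceil ((c + 1)%:~R / q%:R : R) = Num.ceil (c%:~R / q%:R : R) + (q%:Z %| c)%Z%:Z.
Proof.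
move=> q0; have q0' : 0 < q%:Z by lia.
set k := Num.ceil (c%:~R / q%:R : R).
have k1 : c <= k * q%:Z by rewrite -ceil_div_intE.
have k2 : ~~ (c <= (k - 1) * q%:Z) by rewrite -ceil_div_intE // -/k; lia.
apply/eqP; rewrite eq_le ceil_div_intE //.
have L (m : int) : (m <= Num.ceil ((c + 1)%:~R / q%:R : R)) = ~~ (c + 1 <= (m - 1) * q%:Z).
  by rewrite -ceil_div_intE // -ltNge; lia.
rewrite L; case: (boolP (q%:Z %| c)%Z) => [/dvdzP [e eE]|nd] /=.
  have ek : e = k by move: k1 k2; rewrite eE; nia.
  by rewrite eE ek; nia.
have : c != k * q%:Z by apply: contra nd => /eqP ->; rewrite dvdz_mull.
by nia.
Qed.

Lemma ceil_add_div (q : nat) z (n : int) : (0 < q)%N ->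
  Num.ceil (z + n%:~R / q%:R) = Num.ceil ((Num.ceil (q%:R * z) + n)%:~R / q%:R : R).
Proof.
move=> q0; have q0' : 0 < q%:R :> R by rewrite ltr0n.
have E (k : int) : (Num.ceil (z + n%:~R / q%:R) <= k) =
   (Num.ceil ((Num.ceil (q%:R * z) + n)%:~R / q%:R : R) <= k).
  rewrite ceil_div_intE // -lerBrDr !ceil_le_int intrB intrM.
  rewrite -(ler_pM2l q0') mulrDr mulrCA divff ?gt_eqF // mulr1 [RHS]lerBrDr.
  by rewrite [X in _ = (_ <= X)]mulrC.
by apply/eqP; rewrite eq_le E lexx -E lexx.
Qed.

(** As in Hermite's identity, [S (c + 1) = S c + 1], because exactly one [i < q] has
    [q | c + p * i]. *)
Lemma sum_ceil_coprime (q : nat) (p : int) : (0 < q)%N -> coprime q `|p| ->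
  forall x y, \sum_(i < q) (Num.ceil (y + (p * i%:Z)%:~R / q%:R)
                            - Num.ceil (x + (p * i%:Z)%:~R / q%:R))
   = Num.ceil (q%:R * y) - Num.ceil (q%:R * x).
Proof.
move=> q0 cop x y.
pose S (c : int) := \sum_(i < q) Num.ceil ((c + p * i%:Z)%:~R / q%:R : R).
have SE z : \sum_(i < q) Num.ceil (z + (p * i%:Z)%:~R / q%:R) = S (Num.ceil (q%:R * z)).
  by apply: eq_bigr => i _; rewrite ceil_add_div.
have SS c : S (c + 1) = S c + 1.
  rewrite /S; under eq_bigr => i _ do rewrite addrAC ceil_divS //.
  rewrite big_split /=; congr (_ + _).
  have [[u v] /= uv] : exists uv : int * int, uv.1 * p + uv.2 * q%:Z = 1.
    have := Bezoutz p q%:Z; rewrite /gcdz absz_nat gcdnC (eqP cop) => -[u [v uv]].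
    by exists (u, v).
  have dvdE (i : nat) : (q%:Z %| c + p * i%:Z)%Z = (q%:Z %| u * c + i%:Z)%Z.
    apply/idP/idP => h.
      rewrite (_ : _ + _ = u * (c + p * i%:Z) + v * i%:Z * q%:Z).
        by rewrite rpredD // dvdz_mull.
      by rewrite -[i%:Z in LHS]mul1r -uv; ring.
    rewrite (_ : _ + _ = p * (u * c + i%:Z) + v * c * q%:Z).
      by rewrite rpredD // dvdz_mull.
    by rewrite -[c in LHS]mul1r -uv; ring.
  under eq_bigr => i _ do rewrite dvdE.
  rewrite -[RHS]/(Posz 1) -(sum_dvd_period (u * c) q0).
  by elim/big_rec2: _ => // i m n _ ->; rewrite PoszD.
have SD c (n : nat) : S (c + n%:Z) = S c + n%:Z.
  by elim: n => [|n IH]; rewrite ?addr0 // -addn1 PoszD !addrA SS IH.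
rewrite sumrB !SE; set c := Num.ceil (q%:R * y); set d := Num.ceil (q%:R * x).
have [n [-> |->]] : exists n : nat, c = d + n%:Z \/ d = c + n%:Z.
  by exists `|c - d|%N; lia.
- by rewrite SD; lia.
- by rewrite SD; lia.
Qed.

(* Since [t] is within [1 / q^2] of [p / q], the points [t i], [i < q], are
   within [1 / q] of the points [p i / q]. *)
Lemma sum_ceil_block (q : nat) (p : int) t : (0 < q)%N -> coprime q `|p| ->
  `|q%:R * t - p%:~R| <= q%:R^-1 -> forall x y,
  `|(\sum_(i < q) (Num.ceil (y + t * i%:R) - Num.ceil (x + t * i%:R)))%:~R
     - q%:R * (y - x)| <= 3.
Proof.
move=> q0 cop tp x y; have q0' : 0 < q%:R :> R by rewrite ltr0n.
have tE (i : 'I_q) : `|t * i%:R - (p * i%:Z)%:~R / q%:R| <= q%:R^-1.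
  have -> : t * i%:R - (p * i%:Z)%:~R / q%:R = (q%:R * t - p%:~R) * (i%:R / q%:R).
    by rewrite intrM; field; rewrite gt_eqF.
  rewrite normrM -[leRHS]mulr1 ler_pM // ger0_norm ?divr_ge0 ?ler0n //.
  by rewrite ler_pdivrMr // mul1r ler_nat ltnW.
have qz (z : R) (e : int) : Num.ceil (q%:R * (z + e%:~R / q%:R)) = Num.ceil (q%:R * z) + e.
  rewrite mulrDr mulrCA divff ?gt_eqF // mulr1 ceilDrz ?intr_int //.
  by rewrite intrKceil.
(* Moving [x] and [y] by [1 / q] moves [q * x] and [q * y] by 1, which costs 2; rounding [q * x] and
   [q * y] costs one more. *)
have up : \sum_(i < q) (Num.ceil (y + t * i%:R) - Num.ceil (x + t * i%:R))
   <= Num.ceil (q%:R * y) - Num.ceil (q%:R * x) + 2.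
  rewrite (_ : _ + 2 = (Num.ceil (q%:R * y) + 1) - (Num.ceil (q%:R * x) + (- 1))); last by lia.
  rewrite -(qz y) -(qz x) -(sum_ceil_coprime q0 cop); apply: ler_sum => i _.
  have := tE i; rewrite ler_distl mul1r mulN1r => /andP[h1 h2].
  by apply: lerB; apply: le_ceil; lra.
have dn : Num.ceil (q%:R * y) - Num.ceil (q%:R * x) - 2
   <= \sum_(i < q) (Num.ceil (y + t * i%:R) - Num.ceil (x + t * i%:R)).
  rewrite (_ : _ - 2 = (Num.ceil (q%:R * y) + (- 1)) - (Num.ceil (q%:R * x) + 1)); last by lia.
  rewrite -(qz y) -(qz x) -(sum_ceil_coprime q0 cop); apply: ler_sum => i _.
  have := tE i; rewrite ler_distl mul1r mulN1r => /andP[h1 h2].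
  by apply: lerB; apply: le_ceil; lra.
move: up dn; rewrite -!(ler_int R) !intrD !intrN /= => up dn.
have /andP[] := ceil_itv (q%:R * x); have /andP[] := ceil_itv (q%:R * y).
rewrite !intrB => ? ? ? ?; rewrite ler_distl; apply/andP; split; lra.
Qed.

Lemma ceil_diff x y : `|(Num.ceil y - Num.ceil x)%:~R - (y - x)| <= 1.
Proof.
have /andP[] := ceil_itv x; have /andP[] := ceil_itv y.
by rewrite !intrB => ? ? ? ?; rewrite ler_distl; apply/andP; split; lra.
Qed.

Lemma sum_ceil_small (W : nat) t x y :
  `|(\sum_(i < W) (Num.ceil (y + t * i%:R) - Num.ceil (x + t * i%:R)))%:~R
     - W%:R * (y - x)| <= W%:R.
Proof.
have -> : W%:R * (y - x) = \sum_(i < W) ((y + t * i%:R) - (x + t * i%:R)).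
  under eq_bigr => i _ do rewrite opprD addrACA subrr addr0.
  by rewrite sumr_const card_ord mulr_natl.
rewrite rmorph_sum -sumrB; apply: le_trans (ler_norm_sum _ _ _) _.
rewrite -[X in _ <= X%:R]card_ord -sumr_const; apply: ler_sum => i _.
exact: ceil_diff.
Qed.

(** Each full block of length [q] costs 3, the incomplete one at most [q]. *)
Lemma sum_ceil_approx (q : nat) (p : int) t : (0 < q)%N -> coprime q `|p| ->
  `|q%:R * t - p%:~R| <= q%:R^-1 -> forall (W : nat) x y,
  `|(\sum_(i < W) (Num.ceil (y + t * i%:R) - Num.ceil (x + t * i%:R)))%:~R
     - W%:R * (y - x)| <= 3 * W%:R / q%:R + q%:R.
Proof.
move=> q0 cop tp W; rewrite (divn_eq W q).
have q0' : 0 < q%:R :> R by rewrite ltr0n.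
elim: (W %/ q)%N => [|a IH] x y.
  rewrite mul0n add0n; apply: le_trans (sum_ceil_small _ _ _ _) _.
  apply: (@le_trans _ _ q%:R); first by rewrite ler_nat ltnW // ltn_pmod.
  by rewrite lerDr divr_ge0 ?mulr_ge0 ?ler0n.
set b := (W %% q)%N in IH *.
rewrite mulSn -addnA big_split_ord /=.
have -> : \sum_(i < a * q + b) (Num.ceil (y + t * (q + i)%:R) - Num.ceil (x + t * (q + i)%:R))
  = \sum_(i < a * q + b) (Num.ceil ((y + t * q%:R) + t * i%:R)
        - Num.ceil ((x + t * q%:R) + t * i%:R)).
  by apply: eq_bigr => i _; rewrite natrD mulrDr !addrA.
have h1 := sum_ceil_block q0 cop tp x y.
have h2 := IH (x + t * q%:R) (y + t * q%:R).
rewrite intrD natrD.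
rewrite (_ : _ + _ - _ =
  ((\sum_(i < q) (Num.ceil (y + t * i%:R) - Num.ceil (x + t * i%:R)))%:~R - q%:R * (y - x)) +
  ((\sum_(i < a * q + b) (Num.ceil ((y + t * q%:R) + t * i%:R)
        - Num.ceil ((x + t * q%:R) + t * i%:R)))%:~R
    - (a * q + b)%:R * ((y + t * q%:R) - (x + t * q%:R)))); last by ring.
apply: le_trans (ler_normD _ _) _; apply: le_trans (lerD h1 h2) _.
rewrite addrA; apply: lerD => //; rewrite !mulrDr mulrDl mulfK ?gt_eqF //.
Qed.

Lemma dirichlet t (Q : nat) : (0 < Q)%N -> exists q p, [/\ (0 < q)%N, (q <= Q)%N,
  coprime q `|p|%N & `|q%:R * t - p%:~R| <= Q%:R^-1].
Proof.
move=> Q0; have Q0' : 0 < Q%:R :> R by rewrite ltr0n.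
pose fr (i : nat) := i%:R * t - (Num.floor (i%:R * t))%:~R.
have fr01 i : 0 <= fr i < 1.
  have := floor_itv (i%:R * t); rewrite intrD => /andP[] ? ?.
  by rewrite /fr; apply/andP; split; lra.
have gP (i : nat) : (`|Num.floor (Q%:R * fr i)| < Q)%N.
  have /andP[f0 f1] := fr01 i.
  rewrite -(ltr_nat R); have h0 : 0 <= Q%:R * fr i by rewrite mulr_ge0 // ltW.
  have fl0 : 0 <= Num.floor (Q%:R * fr i) by rewrite floor_ge0.
  rewrite (_ : _%:R = (Num.floor (Q%:R * fr i))%:~R); last first.
    by rewrite -[in RHS](gez0_abs fl0).
  apply: le_lt_trans (floor_le _) _.
  by rewrite -[ltRHS]mulr1 ltr_pM2l.
pose g (i : 'I_Q.+1) := Ordinal (gP i).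
have ninj : ~~ injectiveb g.
  by apply/negP => /injectiveP /leq_card; rewrite !card_ord ltnn.
have [i [j [ij gij]]] : exists i j : 'I_Q.+1, (i < j)%N /\ g i = g j.
  move/injectivePn: ninj => [i [j ij gij]].
  have [lt|lt|e] := ltngtP (i : nat) j; [by exists i, j | by exists j, i |].
  by rewrite (val_inj e) eqxx in ij.
pose p0 := Num.floor (j%:R * t) - Num.floor (i%:R * t).
pose q0 := (j - i)%N.
have q00 : (0 < q0)%N by rewrite subn_gt0.
have q0Q : (q0 <= Q)%N by rewrite /q0; have := ltn_ord j; lia.
have near : `|q0%:R * t - p0%:~R| <= Q%:R^-1.
  have e : Num.floor (Q%:R * fr i) = Num.floor (Q%:R * fr j).
    have /andP[i0 _] := fr01 i; have /andP[j0 _] := fr01 j.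
    have := congr1 val gij => /= /(congr1 Posz).
    by rewrite !gez0_abs // floor_ge0 mulr_ge0 // ltW.
  have := floor_itv (Q%:R * fr i); have := floor_itv (Q%:R * fr j).
  rewrite e intrD => /andP[a1 a2] /andP[a3 a4].
  have -> : q0%:R * t - p0%:~R = fr j - fr i.
    by rewrite /q0 natrB 1?ltnW // /p0 intrB /fr; ring.
  rewrite -(ler_pM2l Q0') divff ?gt_eqF // -[X in X * _]ger0_norm ?ler0n // -normrM.
  rewrite mulrBr ler_distl; apply/andP; split; lra.
pose d := gcdn q0 `|p0|.
have d0 : (0 < d)%N by rewrite gcdn_gt0 q00.
have d0' : 0 < d%:R :> R by rewrite ltr0n.
have dp : (d%:Z %| p0)%Z by rewrite dvdzE dvdn_gcdr.
have dq : (d %| q0)%N by rewrite dvdn_gcdl.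
have [p pE] := dvdzP dp; have qE := divnK dq.
exists (q0 %/ d)%N, p; split.
- by rewrite divn_gt0 // dvdn_leq.
- by rewrite (leq_trans (leq_div _ _)).
- rewrite /coprime -(eqn_pmul2r d0) muln_gcdl qE mul1n.
  by rewrite -[X in gcdn _ (_ * X)%N]absz_nat -abszM -pE.
apply: le_trans near.
have -> : q0%:R * t - p0%:~R = ((q0 %/ d)%N%:R * t - p%:~R) * d%:R.
  by rewrite -{1}qE natrM pE intrM; ring.
rewrite normrM normr_nat -[leLHS]mulr1 ler_wpM2l //.
by rewrite ler1n.
Qed.

End ceiling_sums.

Section equidistribution.
Variable R : realType.
Implicit Types (x y a b alpha C : R).

(** The slope is [2 * alpha] because the indices will be taken from one parity class. By the
    Diophantine condition the denominator [q <= Q] found by [dirichlet] is not small, and then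
    [3 * W / q] and [q] are each at most half of the claimed error. *)
Lemma ceil_equidistribution (k A : nat) alpha C :
  0 < C -> (forall (q : nat) (p : int), (0 < q)%N -> C < q%:R ^+ k * `|q%:R * alpha - p%:~R|) ->
  exists K0 : nat, forall K W : nat, (K0 <= K)%N -> (K ^ (A.+1 * k + A + 2) <= W)%N ->
  forall x y, `|(\sum_(i < W) (Num.ceil (y + 2 * alpha * i%:R)
                              - Num.ceil (x + 2 * alpha * i%:R)))%:~R - W%:R * (y - x)|
     <= W%:R / K%:R ^+ A.
Proof.
move=> C0 hC; have [c cP] : exists c : nat, C^-1 < c%:R.
  by exists (Num.truncn C^-1).+1; exact: truncnS_gt.
exists (maxn 12 c) => K W; rewrite geq_max => /andP[K12 cK] KW x y.
have K0 : (0 < K)%N by lia.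
have K0' : 0 < K%:R :> R by rewrite ltr0n.
have W0 : (0 < W)%N by apply: leq_trans KW; rewrite expn_gt0 K0.
have W0' : 0 < W%:R :> R by rewrite ltr0n.
set Q := (K ^ (A.+1 * k + 1))%N.
have Q0 : (0 < Q)%N by rewrite expn_gt0 K0.
have Q0' : 0 < Q%:R :> R by rewrite ltr0n.
have [q [p [q0 qQ cop near]]] := dirichlet (2 * alpha) Q0.
have q0' : 0 < q%:R :> R by rewrite ltr0n.
have near2 : `|q%:R * (2 * alpha) - p%:~R| <= q%:R^-1.
  by apply: le_trans near _; rewrite lef_pV2 ?posrE // ler_nat.
apply: le_trans (sum_ceil_approx q0 cop near2 W x y) _.
have KA0 : 0 < K%:R ^+ A :> R by rewrite exprn_gt0.
(* Otherwise [2 * q < 12 * K ^ A <= K ^ A.+1], and [2 * q * alpha] within [1 / Q] of an integer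
   contradicts the Diophantine condition, since [1 / K < C]. *)
have q6 : 6 * K%:R ^+ A <= q%:R :> R.
  rewrite leNgt; apply/negP => qs.
  have q2 : (0 < 2 * q)%N by rewrite muln_gt0.
  have := hC (2 * q)%N p q2; apply/negP; rewrite -leNgt.
  apply: (@le_trans _ _ ((K%:R ^+ A.+1) ^+ k * Q%:R^-1)).
    apply: ler_pM; rewrite ?exprn_ge0 ?normr_ge0 ?ler0n //.
      apply: lerXn2r; rewrite ?nnegrE ?exprn_ge0 ?ler0n //.
      rewrite exprS natrM; apply: (@le_trans _ _ (12 * K%:R ^+ A)); first by lra.
      by rewrite ler_pM2r // ler_nat.
    by rewrite natrM [2 * q%:R]mulrC -mulrA.
  rewrite /Q natrX exprD -exprM invfM mulrA divff ?mul1r ?expr1 ?gt_eqF ?exprn_gt0 //.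
  rewrite -[leRHS]invrK lef_pV2 ?posrE ?invr_gt0 //; apply: le_trans (ltW cP) _.
  by rewrite ler_nat.
rewrite ler_pdivlMr //.
have h1 : 3 * W%:R / q%:R * K%:R ^+ A <= W%:R / 2 :> R.
  rewrite mulrAC ler_pdivrMr //; nra.
have h2 : q%:R * K%:R ^+ A <= W%:R / 2 :> R.
  rewrite ler_pdivlMr //; apply: (@le_trans _ _ (Q%:R * K%:R ^+ A * K%:R)).
    apply: ler_pM; rewrite ?mulr_ge0 ?ler_nat ?exprn_ge0 ?ler0n ?(leq_trans _ K12) //.
    by rewrite ler_pM2r // ler_nat.
  rewrite -!natrX -!natrM ler_nat; apply: leq_trans KW.
  by rewrite -mulnA -expnSr -expnD; apply: leq_pexp2l => //; clear; lia.
by rewrite mulrDl; lra.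
Qed.

Definition lo a alpha (u : nat) : int := Num.ceil (a + (alpha * u%:R - u%:R ^+ 2 / 2)).

Definition Lseq a b alpha (u : nat) : seq int :=
  [seq lo a alpha u + i%:Z | i <- iota 0 `|lo b alpha u - lo a alpha u|].

Lemma lo_le a b alpha u : a <= b -> lo a alpha u <= lo b alpha u.
Proof. by move=> ab; apply: le_ceil; rewrite lerD2r. Qed.

Lemma mem_Lseq a b alpha (u : nat) (l : int) : a <= b ->
  (l \in Lseq a b alpha u) = (a <= l%:~R + u%:R ^+ 2 / 2 - alpha * u%:R < b).
Proof.
move=> ab; have := lo_le alpha u ab => lol.
have -> : (a <= l%:~R + u%:R ^+ 2 / 2 - alpha * u%:R < b)
        = (lo a alpha u <= l) && (l < lo b alpha u).
  by rewrite ceil_le_int ceil_gt_int; congr (_ && _); apply/idP/idP => ?; lra.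
apply/mapP/andP => [[i]|[h1 h2]].
  by rewrite mem_iota => /andP[_ ih] ->; split; lia.
by exists `|l - lo a alpha u|%N; [rewrite mem_iota | ]; lia.
Qed.

Lemma count_dvd_interval (r : nat) (c lam : int) (n : nat) : (0 < r)%N ->
  (count (fun l => (r%:Z %| (l - lam)%R)%Z) [seq c + i%:Z | i <- iota 0 n])%:Z
  = Num.ceil ((c + n%:Z - lam)%:~R / r%:R : R) - Num.ceil ((c - lam)%:~R / r%:R : R).
Proof.
move=> r0; elim: n => [|n IH]; first by rewrite addr0 subrr.
rewrite -addn1 iotaD add0n map_cat count_cat PoszD IH /= addn0.
rewrite [in RHS](_ : c + (n + 1)%:Z - lam = c + n%:Z - lam + 1); last by lia.
by rewrite ceil_divS //; lia.
Qed.

Lemma count_Lseq (r : nat) a b alpha (u : nat) (lam : int) : (0 < r)%N -> a <= b ->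
  (count (fun l => (r%:Z %| (l - lam)%R)%Z) (Lseq a b alpha u))%:Z
  = Num.ceil ((b - lam%:~R) / r%:R + (alpha * u%:R - u%:R ^+ 2 / 2) / r%:R)
    - Num.ceil ((a - lam%:~R) / r%:R + (alpha * u%:R - u%:R ^+ 2 / 2) / r%:R).
Proof.
move=> r0 ab; rewrite count_dvd_interval // gez0_abs ?subr_ge0 ?lo_le //.
rewrite [lo a alpha u + _]addrC subrK; have r0' : r%:R != 0 :> R by rewrite pnatr_eq0 -lt0n.
have key z : Num.ceil ((lo z alpha u - lam)%:~R / r%:R : R)
    = Num.ceil ((z - lam%:~R) / r%:R + (alpha * u%:R - u%:R ^+ 2 / 2) / r%:R).
  have := ceil_add_div ((z + (alpha * u%:R - u%:R ^+ 2 / 2)) / r%:R) (- lam) r0.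
  by rewrite [_%:R * (_ / _)]mulrC divfK // => <-; congr Num.ceil; rewrite intrN; field.
by rewrite !key.
Qed.

(** For [u = r * t] the phase divided by [r] is [alpha * t - r * t ^ 2 / 2]. Replacing [t] by
    [t + 2 * w] changes the quadratic part by an integer, so on each parity class the phase is
    linear modulo one with slope [2 * alpha]. *)
Lemma residue_equidistribution (k A : nat) alpha C :
  0 < C -> (forall (q : nat) (p : int), (0 < q)%N -> C < q%:R ^+ k * `|q%:R * alpha - p%:~R|) ->
  exists K0 : nat, forall K W r t0 : nat, (K0 <= K)%N -> (0 < r)%N ->
  (K ^ (A.+2 * k + A + 4) <= W)%N -> forall a b (lam : int), a <= b ->
  `|(\sum_(i < W) count (fun l => (r%:Z %| (l - lam)%R)%Z) (Lseq a b alpha (r * (t0 + i))))%:R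
     - W%:R * ((b - a) / r%:R)| <= W%:R / K%:R ^+ A.
Proof.
move=> C0 hC; have [K0 K0P] := ceil_equidistribution A.+1 C0 hC.
exists (maxn 2 K0) => K W r t0; rewrite geq_max => /andP[K2 cK] r0 KW a b lam ab.
have r0' : r%:R != 0 :> R by rewrite pnatr_eq0 -lt0n.
set y := (b - lam%:~R) / r%:R; set x := (a - lam%:~R) / r%:R.
have yx : (b - a) / r%:R = y - x by rewrite /y /x; field.
pose phi (t i : nat) : R := alpha * (t + i)%:R - r%:R * (t + i)%:R ^+ 2 / 2.
pose f (t i : nat) : int := Num.ceil (y + phi t i) - Num.ceil (x + phi t i).
have -> : (\sum_(i < W) count (fun l => (r%:Z %| (l - lam)%R)%Z)
     (Lseq a b alpha (r * (t0 + i))))%:R = (\sum_(i < W) f t0 i)%:~R :> R.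
  rewrite natr_sum rmorph_sum /=; apply: eq_bigr => i _.
  rewrite -[LHS]/((Posz _)%:~R) count_Lseq //; congr (_ %:~R).
  rewrite /f -/x -/y (_ : (_ - _) / r%:R = phi t0 i) //.
  by rewrite /phi natrM; field.
have f_even t w : f t w.*2 = Num.ceil ((y + phi t 0) + 2 * alpha * w%:R)
                        - Num.ceil ((x + phi t 0) + 2 * alpha * w%:R).
  pose m : int := - ((2 * r * t * w + 2 * r * w ^ 2)%N : int).
  have E z : z + phi t w.*2 = (z + phi t 0%N) + 2 * alpha * w%:R + m%:~R.
    by rewrite /phi /m addn0 intrN -pmulrn -muln2 !(natrD, natrM, natrX); field.
  by rewrite /f !E !(ceilDrz _ (intr_int _ m)) opprD addrACA subrr addr0.
have f_odd t w : f t w.*2.+1 = f t.+1 w.*2.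
  by rewrite /f /phi addnS addSn.
have f_split h : \sum_(i < h.*2) f t0 i = \sum_(w < h) f t0 w.*2 + \sum_(w < h) f t0.+1 w.*2.
  elim: h => [|h IH]; first by rewrite !big_ord0 addr0.
  by rewrite doubleS !big_ord_recr /= IH f_odd -addrA addrACA.
have K0' : 0 < K%:R :> R by rewrite ltr0n; lia.
have KA0 : 0 < K%:R ^+ A :> R by rewrite exprn_gt0.
rewrite yx; set h := W./2.
have WE : (W = h.*2 + odd W)%N by rewrite addnC odd_double_half.
have hW : (K ^ (A.+2 * k + A.+1 + 2) <= h)%N.
  rewrite geq_half_double -muln2 mulnC; apply: leq_trans KW.
  rewrite (_ : A.+2 * k + A + 4 = (A.+2 * k + A.+1 + 2).+1)%N; last by clear; lia.
  by rewrite expnS leq_mul2r K2 orbT.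
have hE (t : nat) := K0P K h cK hW (x + phi t 0%N) (y + phi t 0%N).
have {}hE t : `|(\sum_(w < h) f t w.*2)%:~R - h%:R * (y - x)| <= h%:R / K%:R ^+ A.+1.
  have := hE t; under [in X in _ -> X]eq_bigr => w _ do rewrite f_even.
  by rewrite (_ : y + phi t 0%N - (x + phi t 0%N) = y - x) //; ring.
(* One index is left over when [W] is odd. It costs at most 1, which is no more than half of
   [W / K ^ A]. *)
have Wodd : `|(\sum_(i < W) f t0 i - \sum_(i < h.*2) f t0 i)%:~R - (odd W)%:R * (y - x)| <= 1.
  have -> : \sum_(i < W) f t0 i = \sum_(i < h.*2 + odd W) f t0 i by rewrite -WE.
  case: (odd W) => /=; last first.
    by rewrite addn0 subrr mul0r subrr normr0 ler01.
  rewrite addn1 big_ord_recr /= [_ + f t0 _]addrC addrK mul1r /f.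
  have := ceil_diff (x + phi t0 h.*2) (y + phi t0 h.*2).
  by rewrite (_ : y + phi t0 h.*2 - (x + phi t0 h.*2) = y - x) //; ring.
have K1 : (1 <= K)%N by apply: leq_trans K2.
have WK : 2 <= W%:R / K%:R ^+ A :> R.
  rewrite ler_pdivlMr // -natrX -natrM ler_nat; apply: leq_trans KW.
  rewrite (leq_trans (leq_mul K2 (leqnn _))) // -expnS leq_pexp2l //; clear; lia.
have h1 := hE t0; have h2 := hE t0.+1.
have hK : h%:R / K%:R ^+ A.+1 *+ 2 <= W%:R / K%:R ^+ A / 2 :> R.
  have hW2 : 2 * h%:R <= W%:R :> R by rewrite -natrM ler_nat {1}WE -muln2 mulnC leq_addr.
  have Ki : K%:R^-1 <= 2^-1 :> R by rewrite lef_pV2 ?posrE // ler_nat.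
  rewrite exprS invfM -mulr_natl !mulrA [leRHS]mulrAC ler_pM2r ?invr_gt0 //.
  by apply: ler_pM; rewrite ?mulr_ge0 ?invr_ge0 ?ler0n.
rewrite (_ : _ - _ = (\sum_(i < W) f t0 i - \sum_(i < h.*2) f t0 i)%:~R - (odd W)%:R * (y - x)
   + (((\sum_(w < h) f t0 w.*2)%:~R - h%:R * (y - x))
   + ((\sum_(w < h) f t0.+1 w.*2)%:~R - h%:R * (y - x)))); last first.
  have -> : W%:R = (h.*2 + odd W)%:R :> R by rewrite -WE.
  rewrite intrB f_split intrD natrD -muln2 natrM; ring.
apply: le_trans (ler_normD _ _) _.
apply: le_trans (lerD Wodd (le_trans (ler_normD _ _) (lerD h1 h2))) _.
by move: hK; rewrite mulr2n; lra.
Qed.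
End equidistribution.

(** * From pairs of indices to boxes *)

Section difference_counts.
Variable R : realType.
Implicit Types (a b alpha : R).

(* The pairs [(j + u, j)] counted by the pair correlation of [[a, b)]; the list [Lseq a b alpha u]
   consists of the [l] with [a <= l + u^2/2 - alpha u < b], see [mem_Lseq]. *)
Definition ccount a b alpha (N u : nat) : nat :=
  \sum_(j < N - u) has (fun l => (N%:Z %| (u%:Z * j.+1%:Z - l)%R)%Z) (Lseq a b alpha u).

Lemma sum_Lseq a b alpha (u : nat) (F : int -> nat) :
  (\sum_(l <- Lseq a b alpha u) F l =
   \sum_(k < `|(lo b alpha u - lo a alpha u)%R|) F (lo a alpha u + k%:Z)%R)%N.
Proof.
rewrite big_map -(big_mkord xpredT (fun k => F (lo a alpha u + k%:Z)%R)).
by rewrite /index_iota subn0.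
Qed.

(** The interval of [m] contains every quotient [(u * j.+1 - l) / N], and [l] and [m] leave at most
    one [j]. *)
Lemma ccount_le a b alpha (N u : nat) (x : int) (n : nat) : (0 < u)%N ->
  (forall (m l : int) (j : nat), (j < N - u)%N -> l \in Lseq a b alpha u ->
     u%:Z * j.+1%:Z = l + m * N%:Z -> x <= m < x + n%:Z) ->
  (ccount a b alpha N u <=
   \sum_(l <- Lseq a b alpha u) \sum_(i < n) (u%:Z %| ((x + i%:Z) * N%:Z + l)%R)%Z)%N.
Proof.
move=> u0 range.
apply: (@leq_trans (\sum_(j < N - u) \sum_(l <- Lseq a b alpha u) \sum_(i < n)
    (u%:Z * j.+1%:Z == l + (x + i%:Z) * N%:Z)%R)%N).
  apply: leq_sum => j _; case: hasP => // -[l ll /dvdzP[m mE]].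
  have /andP[m1 m2] : x <= m < x + n%:Z.
    by apply: (range m l j) => //; lia.
  rewrite (big_rem l) //=; apply: leq_trans (leq_addr _ _).
  have i_lt : (`|m - x| < n)%N by lia.
  rewrite (bigD1 (Ordinal i_lt)) //=; apply: leq_trans (leq_addr _ _).
  by rewrite lt0n eqb0 negbK; apply/eqP; rewrite gez0_abs; [lia | rewrite subr_ge0].
rewrite exchange_big /=; apply: leq_sum => l _.
rewrite exchange_big /=; apply: leq_sum => i _.
apply: leq_sum_unique => [j /eqP jE | j j' /eqP jE /eqP jE'].
  by apply/dvdzP; exists j.+1%:Z; lia.
have uZ : u%:Z != 0 by lia.
by apply/val_inj; have := mulfI uZ (etrans jE (esym jE')) => -[].
Qed.

(** Every [m] of the interval for which [u] divides [m * N + l] gives an admissible [j]. No [j]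
    arises twice: the list consists of at most [N] consecutive integers, which are distinct modulo
    [N]. *)
Lemma ccount_ge a b alpha (N u : nat) (x : int) (n : nat) : (0 < u)%N ->
  (`|(lo b alpha u - lo a alpha u)%R| <= N)%N ->
  (forall (i : nat) (l : int), (i < n)%N -> l \in Lseq a b alpha u ->
     u%:Z <= (x + i%:Z) * N%:Z + l <= u%:Z * (N%:Z - u%:Z)) ->
  (\sum_(l <- Lseq a b alpha u) \sum_(i < n) (u%:Z %| ((x + i%:Z) * N%:Z + l)%R)%Z
    <= ccount a b alpha N u)%N.
Proof.
move=> u0 sN range; set L := `|(lo b alpha u - lo a alpha u)%R|%N in sN.
apply: (@leq_trans (\sum_(j < N - u) \sum_(l <- Lseq a b alpha u) \sum_(i < n)
    (u%:Z * j.+1%:Z == l + (x + i%:Z) * N%:Z)%R)%N).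
  rewrite [leqRHS]exchange_big /= big_seq [leqRHS]big_seq; apply: leq_sum => l ll.
  rewrite [leqRHS]exchange_big /=; apply: leq_sum => i _.
  case: (boolP (u%:Z %| _)%Z) => // /dvdzP [j' j'E].
  have /andP[h1 h2] := range i l (ltn_ord i) ll.
  have j1 : 1 <= j' by nia.
  have j2 : j' <= N%:Z - u%:Z by nia.
  have j_lt : (`|j' - 1| < N - u)%N by lia.
  rewrite (bigD1 (Ordinal j_lt)) //=; apply: leq_trans (leq_addr _ _).
  rewrite lt0n eqb0 negbK; apply/eqP.
  by rewrite (_ : (`|(j' - 1)%R|%N.+1)%:Z = j'); lia.
apply: leq_sum => j _; rewrite sum_Lseq pair_big /=.
apply: leq_sum_unique => [[k i] /= /eqP kE | [k i] [k' i'] /= /eqP kE /eqP kE'].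
  apply/hasP; exists (lo a alpha u + k%:Z).
    by apply/mapP; exists (nat_of_ord k) => //; rewrite mem_iota ltn_ord.
  by apply/dvdzP; exists (x + i%:Z); lia.
have kN : (k < N)%N by apply: leq_trans (ltn_ord k) sN.
have kN' : (k' < N)%N by apply: leq_trans (ltn_ord k') sN.
have e : k%:Z - k'%:Z = (i'%:Z - i%:Z) * N%:Z.
  transitivity ((lo a alpha u + k%:Z + (x + i%:Z) * N%:Z)
     - (lo a alpha u + k'%:Z + (x + i'%:Z) * N%:Z) + (i'%:Z - i%:Z) * N%:Z); first by ring.
  by rewrite -kE -kE' subrr add0r.
have ii : i'%:Z - i%:Z = 0 by nia.
have kk : k = k' by apply/val_inj; move: e; rewrite ii mul0r /=; lia.
have {}ii : i = i' by apply/val_inj; move: ii => /=; lia.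
by rewrite kk ii.
Qed.

Lemma Lseq_size a b alpha (u : nat) : a <= b ->
  (size (Lseq a b alpha u))%:R <= b - a + 1.
Proof.
move=> ab; rewrite size_map size_iota.
have := ceil_diff (a + (alpha * u%:R - u%:R ^+ 2 / 2)) (b + (alpha * u%:R - u%:R ^+ 2 / 2)).
rewrite -/(lo a alpha u) -/(lo b alpha u) => h.
have -> : (`|lo b alpha u - lo a alpha u|%N)%:R = (lo b alpha u - lo a alpha u)%:~R :> R.
  by rewrite -[in RHS](@gez0_abs (lo b alpha u - lo a alpha u)) // subr_ge0 lo_le.
by move: h; rewrite ler_distl => /andP[_]; lra.
Qed.

End difference_counts.

Section blocks.
Variable R : realType.
Variables (a b alpha : R) (a0 N0 H U V p p' : nat).
Hypotheses (ab : a <= b) (a_ge : - a0%:R <= a) (b_le : b <= a0%:R) (alpha_le : `|alpha| <= a0%:R).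
Hypotheses (U0 : (0 < U)%N) (UV : (U + V <= 2 * N0)%N).

(** In [u j = l + m N] with [1 <= j <= N - u], [l] equals [- u^2 / 2] up to [O(u)], so [m] runs from
    about [u^2 / (2 N)] to [u - u^2 / (2 N)]. [D] is the lower end at the corner of the block; [e0]
    covers the variation of [u] by [V] and of [N] by [H], and the terms in [a], [b], [alpha]. *)
Let D := (U ^ 2 %/ (2 * N0))%N.
Let e0 := (3 * V + 2 * H + 4 * a0 + 2)%N.
Let d : R := U%:R ^+ 2 / (2 * N0%:R).

Let N0_gt0 : 0 < N0%:R :> R.
Proof. by rewrite ltr0n; lia. Qed.

Let dE : d * N0%:R = U%:R ^+ 2 / 2.
Proof. by rewrite /d; field; rewrite gt_eqF. Qed.

Let d_bounds : [/\ 0 <= d, d <= 2 * N0%:R, D%:R <= d & d < D%:R + 1].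
Proof.
have N2 : (0 < 2 * N0)%N by lia.
have N2' : 0 < 2 * N0%:R :> R by rewrite mulr_gt0.
have UN : U%:R <= 2 * N0%:R :> R by rewrite -natrM ler_nat; lia.
split.
- by rewrite divr_ge0 ?exprn_ge0 // ltW.
- by rewrite ler_pdivrMr // expr2 ler_pM.
- by rewrite ler_pdivlMr // -natrM -natrM -natrX ler_nat leq_trunc_div.
- by rewrite ltr_pdivrMr // natr1 -natrM -natrM -natrX ltr_nat ltn_ceil.
Qed.

Section one_modulus.
Variables (N u : nat).
Hypotheses (NN : (N0 <= N < N0 + H)%N) (uu : (U <= u < U + V)%N).

Let u_bounds : [/\ U%:R <= u%:R :> R, u%:R <= U%:R + V%:R :> R, 1 <= u%:R :> R & u%:R <= 2 * N0%:R :> R].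
Proof. by split; rewrite -?natrD -?natrM ?ler_nat ?ler1n; lia. Qed.

Let N_bounds : N0%:R <= N%:R :> R /\ N%:R <= N0%:R + H%:R :> R.
Proof. by split; rewrite -?natrD ler_nat; lia. Qed.

Let au_bound : `|alpha * u%:R| <= a0%:R * u%:R.
Proof. by rewrite normrM normr_nat ler_wpM2r. Qed.

Let square_ge : (d - 2 * H%:R) * N%:R <= u%:R ^+ 2 / 2.
Proof.
have [d0 d2 _ _] := d_bounds; have [n1 n2] := N_bounds; have [u1 u2 u3 u4] := u_bounds.
have H0 : 0 <= H%:R :> R by exact: ler0n.
have UU : U%:R ^+ 2 <= u%:R ^+ 2 :> R by rewrite lerXn2r ?nnegrE.
have : d * (N%:R - N0%:R) <= (2 * N0%:R) * H%:R by apply: ler_pM; lra.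
have : N0%:R * H%:R <= N%:R * H%:R :> R by rewrite ler_wpM2r.
move: dE; rewrite mulrBl mulrBr; nra.
Qed.

Let square_le : u%:R ^+ 2 / 2 <= (d + 2 * V%:R) * N%:R.
Proof.
have [d0 d2 _ _] := d_bounds; have [n1 n2] := N_bounds; have [u1 u2 u3 u4] := u_bounds.
have V0 : 0 <= V%:R :> R by exact: ler0n.
have UV' : U%:R + V%:R <= 2 * N0%:R :> R by rewrite -natrD -natrM ler_nat.
have UU : u%:R ^+ 2 <= (U%:R + V%:R) ^+ 2 :> R by rewrite lerXn2r ?nnegrE // addr_ge0.
have h1 : V%:R * (2 * U%:R + V%:R) <= V%:R * (4 * N0%:R) :> R by rewrite ler_wpM2l //; lra.
have h2 : (d + 2 * V%:R) * N0%:R <= (d + 2 * V%:R) * N%:R by rewrite ler_wpM2l //; lra.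
move: dE h2; rewrite [(_ + _) * N0%:R]mulrDl; nra.
Qed.

(** Outer interval for [m], independent of [u] and [N] in the block; [range_solution] is the inner
    one. Both have length [U - 2 * D] up to [O(e0)]. *)
Lemma solution_range (m l : int) (j : nat) : (j < N - u)%N -> l \in Lseq a b alpha u ->
  u%:Z * j.+1%:Z = l + m * N%:Z ->
  D%:Z - e0%:Z <= m <= U%:Z - D%:Z + e0%:Z.
Proof.
move=> jN; rewrite mem_Lseq // => /andP[l1 l2] jE.
have [d0 d2 d3 d4] := d_bounds; have [n1 n2] := N_bounds; have [u1 u2 u3 u4] := u_bounds.
have := au_bound; rewrite ler_norml => /andP[au1 au2]; have ba := b_le; have aa := a_ge.
have Ngt0 : 0 < N%:R :> R by lra.
have jE' : u%:R * (j%:R + 1) = l%:~R + m%:~R * N%:R :> R.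
  by rewrite natr1 !pmulrn -!intrM -intrD jE.
have j1 : 0 <= j%:R :> R by [].
have j2 : j%:R + 1 <= N%:R - u%:R :> R by rewrite lerBrDr natr1 -natrD ler_nat; move: jN; clear; lia.
have uN : u%:R <= N%:R :> R by lra.
have a00 : 0 <= a0%:R :> R by [].
have a0u : a0%:R <= a0%:R * u%:R :> R by rewrite ler_peMr.
have a0N : a0%:R * u%:R <= a0%:R * N%:R :> R by rewrite ler_wpM2l.
have uj1 : u%:R <= u%:R * (j%:R + 1) :> R by rewrite ler_peMr // lerDr.
have uj2 : u%:R * (j%:R + 1) <= u%:R * (N%:R - u%:R) :> R by rewrite ler_wpM2l.
have sq := square_ge.
have lo_m : d - 2 * H%:R - 2 * a0%:R <= m%:~R :> R.
  rewrite -(ler_pM2r Ngt0); lra.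
have hi_m : m%:~R <= u%:R - (d - 2 * H%:R) + 2 * a0%:R :> R.
  rewrite -(ler_pM2r Ngt0); lra.
have e0E : e0%:R = 3 * V%:R + 2 * H%:R + 4 * a0%:R + 2 :> R by rewrite /e0 3!natrD 3!natrM.
have V0 : 0 <= V%:R :> R by [].
rewrite -!(ler_int R) !intrD !intrN -!pmulrn e0E; apply/andP; split; lra.
Qed.

Lemma range_solution (m l : int) : l \in Lseq a b alpha u ->
  D%:Z + e0%:Z + 1 <= m <= U%:Z - D%:Z - e0%:Z - 1 ->
  u%:Z <= m * N%:Z + l <= u%:Z * (N%:Z - u%:Z).
Proof.
rewrite mem_Lseq // => /andP[l1 l2]; rewrite -!(ler_int R) !(intrD, intrM, intrN) -!pmulrn.
have e0E : e0%:R = 3 * V%:R + 2 * H%:R + 4 * a0%:R + 2 :> R by rewrite /e0 3!natrD 3!natrM.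
rewrite e0E => /andP[m1 m2].
have [d0 d2 d3 d4] := d_bounds; have [n1 n2] := N_bounds; have [u1 u2 u3 u4] := u_bounds.
have := au_bound; rewrite ler_norml => /andP[au1 au2]; have ba := b_le; have aa := a_ge.
have Ngt0 : 0 < N%:R :> R by lra.
have a00 : 0 <= a0%:R :> R by [].
have V0 : 0 <= V%:R :> R by [].
have H0 : 0 <= H%:R :> R by [].
have a0u : a0%:R <= a0%:R * u%:R :> R by rewrite ler_peMr.
have a0N : a0%:R * u%:R <= a0%:R * (2 * N%:R) :> R by rewrite ler_wpM2l //; lra.
have sq := square_le.
have low : (d + 2 * V%:R + 2 + 4 * a0%:R) * N%:R <= m%:~R * N%:R by rewrite ler_wpM2r //; lra.
have high : m%:~R * N%:R <= (u%:R - d - 2 * V%:R - 4 * a0%:R) * N%:R by rewrite ler_wpM2r //; lra.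
apply/andP; split.
  lra.
lra.
Qed.
End one_modulus.

Definition block_count : nat := \sum_(i < H) \sum_(U <= u < U + V) ccount a b alpha (N0 + i) u.

Lemma block_count_le : (p * p' * block_count <=
  \sum_(U <= u < U + V) \sum_(l <- Lseq a b alpha u)
    smooth_count (D%:Z - e0%:Z - p%:Z)%R (U - 2 * D + 2 * e0 + 1 + p) p
      (N0%:Z - p'%:Z)%R (H + p') p' u l)%N.
Proof.
set n := (U - 2 * D + 2 * e0 + 1)%N.
apply: (@leq_trans (p * p' * \sum_(U <= u < U + V) \sum_(l <- Lseq a b alpha u)
   box_count (D%:Z - e0%:Z)%R n N0%:Z H u l)%N); last first.
  rewrite big_distrr /=; apply: leq_sum => u _; rewrite big_distrr /=.
  by apply: leq_sum => l _; exact: smooth_count_ge.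
rewrite leq_mul2l; apply/orP; right; rewrite /block_count exchange_big /=.
rewrite big_nat_cond [leqRHS]big_nat_cond; apply: leq_sum => u /andP[uu _].
rewrite /box_count; under [leqRHS]eq_bigr => l _ do rewrite exchange_big /=.
rewrite [leqRHS]exchange_big /=; apply: leq_sum => i _.
have u0 : (0 < u)%N by lia.
apply: leq_trans (ccount_le (x := D%:Z - e0%:Z) (n := n) u0 _) _.
  move=> m l j jN ll jE; have iH := ltn_ord i.
  have NN : (N0 <= N0 + i < N0 + H)%N by lia.
  by have := solution_range NN uu jN ll jE; rewrite /n; lia.
by apply: leq_sum => l _; apply: leq_sum => k _; rewrite PoszD.
Qed.

Lemma block_count_ge : (forall u, (`|(lo b alpha u - lo a alpha u)%R| <= N0)%N) ->
  (\sum_(U <= u < U + V) \sum_(l <- Lseq a b alpha u)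
    smooth_count (D%:Z + e0%:Z + 1)%R (U - 2 * D - (2 * e0 + 2) - p) p
      N0%:Z (H - p') p' u l <= p * p' * block_count)%N.
Proof.
move=> sN; set n := (U - 2 * D - (2 * e0 + 2))%N.
apply: (@leq_trans (p * p' * \sum_(U <= u < U + V) \sum_(l <- Lseq a b alpha u)
   box_count (D%:Z + e0%:Z + 1)%R n N0%:Z H u l)%N).
  rewrite big_distrr /=; apply: leq_sum => u _; rewrite big_distrr /=.
  by apply: leq_sum => l _; exact: smooth_count_le.
rewrite leq_mul2l; apply/orP; right; rewrite /block_count [leqRHS]exchange_big /=.
rewrite big_nat_cond [leqRHS]big_nat_cond; apply: leq_sum => u /andP[uu _].
rewrite /box_count; under [leqLHS]eq_bigr => l _ do rewrite exchange_big /=.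
rewrite [leqLHS]exchange_big /=; apply: leq_sum => i _.
have u0 : (0 < u)%N by lia.
apply: leq_trans (ccount_ge (x := D%:Z + e0%:Z + 1) (n := n) u0 _ _).
- by apply: leq_sum => l _; apply: leq_sum => k _; rewrite PoszD.
- by apply: leq_trans (sN u) _; rewrite leq_addr.
move=> k l kn ll; have iH := ltn_ord i.
have NN : (N0 <= N0 + i < N0 + H)%N by lia.
by apply: (range_solution NN uu ll); move: kn; rewrite /n; lia.
Qed.

End blocks.

(** * Error terms of one block *)

Lemma smooth_box_mass_le (r n p n' p' n1 h1 X c : nat) :
  (n <= n1)%N -> (p <= n1)%N -> (n' <= h1)%N -> (p' <= h1)%N ->
  (n1 <= c * p)%N -> (h1 <= c * p')%N -> (n1 + r <= X)%N ->
  (smooth_box_mass r n p n' p' <= (p * p' * (c * X * (h1 + r))) ^ 2)%N.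
Proof.
move=> nn pn nh ph n1p h1p nX; rewrite /smooth_box_mass.
apply: (@leq_trans ((c * p) * X * (p * X) * ((c * p') * (h1 + r) * (p' * (h1 + r)))))%N.
  have nX' : (n + r <= X)%N by apply: leq_trans nX; rewrite leq_add2r.
  have pX' : (p + r <= X)%N by apply: leq_trans nX; rewrite leq_add2r.
  have nh' : (n' + r <= h1 + r)%N by rewrite leq_add2r.
  have ph' : (p' + r <= h1 + r)%N by rewrite leq_add2r.
  by rewrite !leq_mul ?(leq_trans nn) ?(leq_trans nh).
by rewrite leq_eqVlt; apply/orP; left; apply/eqP; ring.
Qed.

Section block_error.
Variables (s : seq (nat * int)) (n1 p h1 p' R G E f K X Umax : nat).
Hypotheses (sU : forall q, q \in s -> (0 < q.1 < Umax)%N)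
  (s_tau : forall q, q \in s -> (tau q.1 <= K)%N)
  (s_gcd : forall q, q \in s -> (gcdn `|q.2| q.1 <= h1)%N)
  (tauK : forall r, (0 < r < Umax)%N -> (tau r <= K)%N)
  (p0 : (0 < p)%N) (p0' : (0 < p')%N) (K0 : (0 < K)%N)
  (pn : (p <= n1)%N) (ph : (p' <= h1)%N) (n1p : (n1 <= K ^ 7 * p)%N) (h1p : (h1 <= K ^ 7 * p')%N)
  (RU : (R <= Umax)%N) (Rh : (R <= h1)%N) (UX : (n1 + Umax <= X)%N)
  (sE : forall r, (1 < r)%N -> (r <= R)%N -> forall x y : int,
    (count (fun q : nat * int => (r %| q.1)%N && (r%:Z %| (q.2 - x)%R)%Z) s <=
     count (fun q : nat * int => (r %| q.1)%N && (r%:Z %| (q.2 - y)%R)%Z) s + E)%N)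
  (f_ge : forall r, (R < r < Umax)%N ->
     (2 * G * K ^ 31 * (h1 + r) ^ 4 <= r * f ^ 4)%N).

Let bad := fun q : nat * int => ~~ (gcdn `|q.2| q.1 <= G)%N.

(** Errors of the small moduli, of the large moduli and of the bad pairs, after division by the
    smoothing factor [p * p']. *)
Definition block_error : nat :=
  (X * (h1 * R ^ 3 * E + size s * K * f + count bad s * (5 * K ^ 8 * h1)))%N.

Lemma smooth_count_block (x y : int) (n n' : nat) : (n <= n1)%N -> (n' <= h1)%N ->
  let A := (\sum_(q <- s) q.1 * smooth_count x n p y n' p' q.1 q.2)%N in
  (A <= p * p' * (n * n' * size s + block_error))%N /\
  (p * p' * (n * n' * size s) <= A + p * p' * block_error)%N.
Proof.
move=> nn nh A.
have s0 q : q \in s -> (0 < q.1)%N by move=> /sU /andP[].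
have Hgood q : q \in s -> (gcdn `|q.2| q.1 <= G)%N -> forall r, (r %| q.1)%N -> (R < r)%N ->
    (2 * G * tau r ^ 3 * smooth_box_mass r n p n' p' ^ 2 <= r * (p * p' * (X * f)) ^ 4)%N.
  move=> qs qG r rq Rr; have /andP[q0 qU] := sU qs.
  have r0 := dvdn_gt0 q0 rq; have rU : (r < Umax)%N by apply: leq_ltn_trans qU; exact: dvdn_leq.
  have rX : (n1 + r <= X)%N by apply: leq_trans UX; rewrite leq_add2l ltnW.
  have m := smooth_box_mass_le nn pn nh ph n1p h1p rX.
  have t : (tau r <= K)%N by apply: tauK; rewrite r0.
  (* [K ^ 3] bounds [tau r ^ 3], and the smoothing ratio [K ^ 7] enters to the fourth power: hence
     the exponent [31 = 3 + 28]. *)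
  apply: (@leq_trans (2 * G * K ^ 3 * ((p * p' * (K ^ 7 * X * (h1 + r))) ^ 2) ^ 2)).
    by apply: leq_mul; rewrite ?leq_mul2l leq_exp2r ?t ?m ?orbT.
  have := f_ge (_ : R < r < Umax)%N; rewrite Rr rU => /(_ isT) h.
  apply: (@leq_trans ((p * p' * X) ^ 4 * (2 * G * K ^ 31 * (h1 + r) ^ 4))).
    by rewrite leq_eqVlt; apply/orP; left; apply/eqP; ring.
  apply: leq_trans (leq_mul (leqnn _) h) _.
  by rewrite leq_eqVlt; apply/orP; left; apply/eqP; ring.
have Hbad r : (r <= R)%N ->
    (smooth_box_mass r n p n' p' <= (p * p' * (K ^ 7 * X * (2 * h1))) ^ 2)%N.
  move=> rR; have rX : (n1 + r <= X)%N.
    by apply: leq_trans UX; rewrite leq_add2l (leq_trans rR).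
  apply: leq_trans (smooth_box_mass_le nn pn nh ph n1p h1p rX) _.
  by rewrite leq_exp2r // !leq_mul // mul2n -addnn leq_add2l (leq_trans rR).
have [h h'] := weighted_smooth_count x y s0 sE Hgood Hbad.
rewrite -/A in h h'; set Err := (X in (_ <= _ + X)%N) in h h'.
suff EE : (Err <= p * p' * block_error)%N.
  have e : (n * p * (n' * p') * size s = p * p' * (n * n' * size s))%N by ring.
  rewrite e in h h'; split; first by rewrite mulnDr (leq_trans h) // leq_add2l.
  by rewrite (leq_trans h') // leq_add2l.
rewrite /Err /block_error.
rewrite [leqRHS](_ : _ = X * (p * p' * (h1 * R ^ 3 * E)) + X * (p * p' * (size s * K * f))
   + X * (p * p' * (count bad s * (5 * K ^ 8 * h1))))%N; last by ring.
have nX : (n <= X)%N by apply: leq_trans UX; rewrite (leq_trans nn) // leq_addr.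
apply: leq_add; [apply: leq_add|].
- rewrite [leqRHS](_ : _ = X * p * (h1 * p') * (R ^ 3 * E))%N; last by ring.
  by apply: leq_mul => //; apply: leq_mul; apply: leq_mul.
- apply: (@leq_trans (\sum_(q <- s) K * (p * p' * (X * f)))%N).
    rewrite big_mkcond big_seq [leqRHS]big_seq; apply: leq_sum => q qs.
    by case: ifP => // _; rewrite leq_mul ?s_tau.
  rewrite big_const_seq count_predT iter_addn_0.
  by rewrite leq_eqVlt; apply/orP; left; apply/eqP; ring.
apply: (@leq_trans (\sum_(q <- s | bad q) X * (p * p' * (5 * K ^ 8 * h1)))%N); last first.
  rewrite big_const_seq iter_addn_0.
  by rewrite leq_eqVlt; apply/orP; left; apply/eqP; ring.
rewrite big_seq_cond [leqRHS]big_seq_cond; apply: leq_sum => q /andP[qs qb].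
have /andP[q0 qU] := sU qs.
have K8 : (K <= K ^ 8)%N by rewrite -{1}(expn1 K) leq_pexp2l.
have K8' : (1 <= K ^ 8)%N by rewrite expn_gt0 K0.
have t1 : (q.1 * smooth_count x n p y n' p' q.1 q.2 <= X * (p * p' * (2 * K ^ 8 * h1)))%N.
  apply: (@leq_trans (q.1 * (p * p' * ((n %/ q.1).+1 * (K * (2 * h1)))))).
    rewrite leq_mul2l; apply/orP; right; rewrite smooth_countE -mulnA.
    apply: (@leq_trans (\sum_(k < p) \sum_(k' < p') ((n %/ q.1).+1 * (K * (2 * h1))))%N).
      apply: leq_sum => k _; apply: leq_sum => k' _.
      apply: leq_trans (box_count_trivial _ _ _ _ _ q0) _.
      by rewrite !leq_mul ?s_tau // mul2n -addnn leq_add ?s_gcd.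
    by rewrite !sum_nat_const !card_ord.
  apply: (@leq_trans ((n + q.1) * (p * p' * (K * (2 * h1))))).
    rewrite [leqLHS](_ : _ = ((n %/ q.1).+1 * q.1) * (p * p' * (K * (2 * h1))))%N; last by ring.
    by apply: leq_mul => //; rewrite mulSn addnC leq_add2r leq_trunc_div.
  apply: leq_mul.
    by apply: leq_trans UX; rewrite leq_add // ltnW.
  rewrite leq_mul2l; apply/orP; right.
  by rewrite mulnCA mulnA leq_mul2r leq_mul2l K8 !orbT.
have t2 : (n * p * (n' * p') <= X * (p * p' * (K ^ 8 * h1)))%N.
  rewrite [leqRHS](_ : _ = X * p * (h1 * p') * K ^ 8)%N; last by ring.
  by rewrite -[leqLHS]muln1; apply: leq_mul => //; apply: leq_mul; apply: leq_mul.
have t3 : (tau q.1 * (p * p' * (K ^ 7 * X * (2 * h1))) <= X * (p * p' * (2 * K ^ 8 * h1)))%N.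
  apply: (@leq_trans (K * (p * p' * (K ^ 7 * X * (2 * h1))))).
    by rewrite leq_mul ?s_tau.
  by rewrite leq_eqVlt; apply/orP; left; apply/eqP; ring.
rewrite [leqRHS](_ : _ = X * (p * p' * (2 * K ^ 8 * h1)) + X * (p * p' * (K ^ 8 * h1))
   + X * (p * p' * (2 * K ^ 8 * h1)))%N; last by ring.
by rewrite !leq_add.
Qed.
End block_error.

Section block_asymptotics.
Variable R : realType.

(** Perturbation of [C = H * V * c * rho], where [x], later [1 / K], controls all relative errors.
    The upper bound for [C] is used again in the lower one, where the weight [U + V] instead of [U]
    costs [x * C]. *)
Lemma real_block (x c rho U V H n1 h1 n2 h2 S ERR C bad : R) :
  0 < x -> x <= 1 -> 0 <= c -> 0 <= rho -> rho <= 1 -> 0 < U -> 0 <= V -> 0 <= H ->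
  0 <= n1 -> 0 <= h1 -> 0 <= n2 -> 0 <= h2 -> 0 <= S -> 0 <= C -> 0 <= bad ->
  n1 <= U * (rho + 14 * x) -> h1 <= H * (1 + x) -> S <= V * (c + x) ->
  U * (rho - 14 * x) <= n2 -> H * (1 - x) <= h2 -> V * (c - x) <= S ->
  V <= x * U ->
  ERR <= U * (H * V * (6 * (c + 2)) * x + bad) ->
  U * C <= n1 * h1 * S + ERR -> n2 * h2 * S <= (U + V) * C + ERR ->
  `|C - H * V * c * rho| <= H * V * (100 * (c + 2)) * x + 3 * bad.
Proof.
move=> x0 x1 c0 r0 r1 U0 V0 H0 n10 h10 n20 h20 S0 C0 b0 n1E h1E SE n2E h2E SE2 VU ERRE up dn.
have HV0 : 0 <= H * V by exact: mulr_ge0.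
have rx0 : 0 <= rho + 14 * x by lra.
have cx0 : 0 <= c + x by lra.
have p1 : n1 * h1 * S <= (U * (rho + 14 * x)) * (H * (1 + x)) * (V * (c + x)).
  by apply: ler_pM => //; [exact: mulr_ge0 | apply: ler_pM].
have xx : x * x <= x by rewrite ler_piMr // ltW.
have rr : rho * x <= x by rewrite ler_piMl // ltW.
have q1 : (rho + 14 * x) * (1 + x) <= rho + 29 * x by nra.
have q2 : (rho + 14 * x) * (1 + x) * (c + x) <= rho * c + (29 * c + 30) * x.
  apply: (@le_trans _ _ ((rho + 29 * x) * (c + x))); first by rewrite ler_wpM2r.
  by nra.
have upC : C <= H * V * (rho * c + (35 * c + 42) * x) + bad.
  rewrite -(ler_pM2l U0); apply: le_trans up _.
  have : n1 * h1 * S <= U * (H * V * (rho * c + (29 * c + 30) * x)).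
    apply: le_trans p1 _.
    rewrite (_ : _ * _ * _ = U * (H * V * ((rho + 14 * x) * (1 + x) * (c + x)))); last by ring.
    by rewrite ler_pM2l // ler_wpM2l.
  move: ERRE; lra.
have p2 : U * (H * V * (rho * c - (14 * c + 2 + c) * x)) <= n2 * h2 * S.
  have nhS : 0 <= n2 * h2 * S by rewrite !mulr_ge0.
  have UHV : 0 <= U * (H * V) by rewrite mulr_ge0 // ltW.
  (* If [rho <= 14 * x] or [c <= x], the lower bound is not positive and follows from nonnegativity;
     otherwise all factors are nonnegative and can be multiplied. *)
  have triv y : y <= 0 -> U * (H * V * y) <= n2 * h2 * S.
    by move=> y0; apply: le_trans nhS; rewrite mulrA; exact: mulr_ge0_le0.
  have [rs|rb] := leP rho (14 * x).
    apply: triv; have : rho * c <= 14 * x * c by rewrite ler_wpM2r.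
    have : 0 <= c * x by rewrite mulr_ge0 // ltW.
    by lra.
  have [cs|cb] := leP c x.
    apply: triv; have : rho * c <= x by apply: le_trans cs; rewrite ler_piMl.
    have : 0 <= c * x by rewrite mulr_ge0 // ltW.
    by lra.
  have a1 : 0 <= rho - 14 * x by lra.
  have a2 : 0 <= 1 - x by lra.
  have a3 : 0 <= c - x by lra.
  apply: (@le_trans _ _ ((U * (rho - 14 * x)) * (H * (1 - x)) * (V * (c - x)))).
    rewrite [leRHS](_ : _ = U * (H * V * ((rho - 14 * x) * (1 - x) * (c - x)))); last by ring.
    rewrite ler_pM2l // ler_wpM2l //.
    have b1 : rho - 15 * x <= (rho - 14 * x) * (1 - x) by nra.
    apply: (@le_trans _ _ ((rho - 15 * x) * (c - x))); last by rewrite ler_wpM2r.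
    by nra.
  by rewrite !ler_pM ?mulr_ge0 // ltW.
have dnC : H * V * (rho * c - (15 * c + 2) * x) - (H * V * (6 * (c + 2)) * x + bad)
     - x * C <= C.
  have VC : V * C <= U * (x * C) by rewrite mulrA ler_wpM2r // mulrC.
  rewrite -(ler_pM2l U0); move: ERRE dn p2 VC; lra.
have xC : x * C <= H * V * (36 * c + 42) * x + bad.
  have hx : x * C <= x * (H * V * (rho * c + (35 * c + 42) * x) + bad) by rewrite ler_wpM2l // ltW.
  have xb : x * bad <= bad by rewrite ler_piMl.
  have : x * (H * V * (rho * c + (35 * c + 42) * x)) <= H * V * (36 * c + 42) * x.
    have HVx : 0 <= H * V * x by rewrite mulr_ge0 // ltW.
    rewrite [leLHS](_ : _ = H * V * x * (rho * c + (35 * c + 42) * x)); last by ring.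
    rewrite [leRHS](_ : _ = H * V * x * (36 * c + 42)); last by ring.
    apply: ler_wpM2l => //.
    have : rho * c <= c by rewrite ler_piMl.
    have : (35 * c + 42) * x <= 35 * c + 42 by rewrite ler_piMr //; lra.
    by lra.
  by lra.
have HVx : 0 <= H * V * x by rewrite mulr_ge0 // ltW.
have HVcx : 0 <= H * V * (c * x) by rewrite mulr_ge0 // mulr_ge0 // ltW.
rewrite ler_distl; apply/andP; split; lra.
Qed.
End block_asymptotics.

Lemma expn4_add (x y : nat) : ((x + y) ^ 4 <= 8 * (x ^ 4 + y ^ 4))%N.
Proof.
have sq (u v : nat) : ((u + v) ^ 2 <= 2 * (u ^ 2 + v ^ 2))%N.
  by have := sqr_ge0 (u%:Z - v%:Z); nia.
have h1 := sq x y; have h2 := sq (x ^ 2)%N (y ^ 2)%N.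
rewrite (expnM _ 2 2) (expnM x 2 2) (expnM y 2 2).
apply: (@leq_trans ((2 * (x ^ 2 + y ^ 2)) ^ 2)); first by rewrite leq_exp2r.
rewrite expnMn (_ : (8 * _ = 2 ^ 2 * (2 * ((x ^ 2) ^ 2 + (y ^ 2) ^ 2)))%N).
  by rewrite leq_mul2l h2.
by rewrite mulnA.
Qed.

Lemma leq_div_double (m d : nat) : (0 < d)%N -> (d <= m)%N -> (m <= 2 * (m %/ d) * d)%N.
Proof.
move=> d0 dm; have : (0 < m %/ d)%N by rewrite divn_gt0.
have := ltn_ceil m d0; nia.
Qed.

(** * Size conditions relating [K], [N0] and [H] *)

Section parameters.
Variables (K N0 H a0 : nat).
Hypotheses (hK : (1000 + 100 * a0 <= K)%N) (hN : (K ^ 410 <= N0)%N)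
  (hH : (K ^ 2 * H <= N0)%N) (hH3 : (N0 ^ 3 * K ^ 200 <= H ^ 4)%N).

Let K0 : (0 < K)%N. Proof. by move: hK; clear; lia. Qed.

Lemma param_H_ge : (K ^ 200 <= H)%N.
Proof.
rewrite -(@leq_exp2r _ _ 4) //; apply: leq_trans hH3.
apply: (@leq_trans ((K ^ 410) ^ 3 * K ^ 200)); last by rewrite leq_mul2r leq_exp2r // hN orbT.
by rewrite -!expnM -expnD leq_pexp2l.
Qed.

(** Split the fourth power of the sum. The part of order [H ^ 4] is beaten by [r > K ^ 100], as
    [11 + 31 + 48 < 100]; the part [r ^ 4] uses [r ^ 3 <= 8 * N0 ^ 3] and
    [N0 ^ 3 * K ^ 200 <= H ^ 4]. *)
Lemma param_f_ge (r : nat) : (K ^ 100 < r < 2 * N0)%N ->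
  (2 * K ^ 11 * K ^ 31 * (H + H %/ K ^ 6 + r) ^ 4 <= r * (H %/ K ^ 12) ^ 4)%N.
Proof.
move=> /andP[Rr rN]; set f := (H %/ K ^ 12)%N; set h1 := (H + _)%N.
have h1H : (h1 <= 2 * H)%N by rewrite /h1 mul2n -addnn leq_add2l leq_div.
have fH : (H <= 2 * f * K ^ 12)%N.
  apply: leq_div_double; first by rewrite expn_gt0 K0.
  by apply: leq_trans param_H_ge; rewrite leq_pexp2l.
have H4 : (H ^ 4 <= 16 * f ^ 4 * K ^ 48)%N.
  apply: (@leq_trans ((2 * f * K ^ 12) ^ 4)); first by rewrite leq_exp2r.
  by rewrite expnMn expnMn -expnM.
have h14 : (h1 ^ 4 <= 16 * H ^ 4)%N.
  by apply: (@leq_trans ((2 * H) ^ 4)); [rewrite leq_exp2r | rewrite expnMn].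
have K2 : (128 <= K)%N by move: hK; clear; lia.
have K10 : (2 ^ 13 <= K ^ 10)%N.
  apply: (@leq_trans (K ^ 2)); last by rewrite leq_pexp2l.
  by apply: (@leq_trans (128 ^ 2)); [rewrite (_ : 128 = 2 ^ 7)%N // -expnM leq_exp2l | rewrite leq_exp2r].
have N3 : (256 * K ^ 42 * N0 ^ 3 <= f ^ 4)%N.
  rewrite -(@leq_pmul2r (K ^ 158)); last by rewrite expn_gt0 K0.
  apply: (@leq_trans (256 * (N0 ^ 3 * K ^ 200))).
    by rewrite leq_eqVlt; apply/orP; left; apply/eqP; rewrite (expnD K 42 158); ring.
  apply: (@leq_trans (256 * (16 * f ^ 4 * K ^ 48))); first by rewrite leq_mul2l (leq_trans hH3).
  rewrite [leqLHS](_ : _ = f ^ 4 * (2 ^ 12 * K ^ 48))%N; last first.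
    by rewrite (_ : 2 ^ 12 = 256 * 16)%N //; move: (f ^ 4)%N (K ^ 48)%N => u v; ring.
  rewrite leq_mul2l; apply/orP; right.
  apply: (@leq_trans (K ^ 10 * K ^ 48)); last by rewrite -expnD leq_pexp2l.
  by rewrite leq_mul2r (leq_trans _ K10) ?orbT // leq_exp2l.
apply: (@leq_trans (2 * K ^ 11 * K ^ 31 * (8 * (16 * (16 * f ^ 4 * K ^ 48) + r ^ 4)))).
  rewrite leq_mul2l; apply/orP; right; apply: leq_trans (expn4_add _ _) _.
  rewrite leq_mul2l leq_add2r; apply: leq_trans h14 _.
  by rewrite leq_mul2l H4 orbT.
rewrite -(@leq_pmul2l 2) // -!(mulnA 2) -expnD.
have -> : (2 * (2 * (K ^ (42) * (8 * (16 * (16 * f ^ 4 * K ^ 48) + r ^ 4)))) =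
  (2 ^ 13 * (K ^ 42 * K ^ 48) * f ^ 4) + r * (32 * K ^ 42 * r ^ 3))%N.
  have c13 : (2 ^ 13 = 8 * 16 * 16 * 4)%N by [].
  rewrite [X in (16 * _ + X)%N](expnS r 3) c13.
  by move: (f ^ 4)%N (K ^ 48)%N (K ^ 42)%N (r ^ 3)%N => u v w z; ring.
rewrite mul2n -addnn; apply: leq_add.
  rewrite leq_mul2r; apply/orP; right; apply: leq_trans (ltnW Rr).
  by rewrite -expnD (expnD K 10 90) leq_mul2r K10 orbT.
rewrite leq_mul2l; apply/orP; right; apply: leq_trans N3.
apply: (@leq_trans (32 * K ^ 42 * (2 * N0) ^ 3)).
  by rewrite leq_mul2l leq_exp2r // (ltnW rN) orbT.
rewrite expnMn leq_eqVlt; apply/orP; left; apply/eqP.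
by rewrite (_ : 256 = 32 * 2 ^ 3)%N //; move: (K ^ 42)%N (N0 ^ 3)%N (2 ^ 3)%N => u v w; ring.
Qed.

End parameters.

Section block_instance.
Variable R : realType.
Variables (a b alpha : R) (a0 K N0 H U : nat).

Definition upairs (V W : nat) : seq (nat * int) :=
  [seq (u, l) | u <- index_iota V (V + W), l <- Lseq a b alpha u].

Lemma sum_upairs (V W : nat) (F : nat * int -> nat) :
  (\sum_(q <- upairs V W) F q
   = \sum_(V <= u < V + W) \sum_(l <- Lseq a b alpha u) F (u, l))%N.
Proof. by rewrite /upairs big_allpairs_dep. Qed.

Lemma mem_upairs (V W : nat) (q : nat * int) : q \in upairs V W ->
  (V <= q.1 < V + W)%N /\ q.2 \in Lseq a b alpha q.1.
Proof.
by move=> /allpairsPdep [u [l [uu ll ->]]] /=; rewrite mem_index_iota in uu.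
Qed.

Hypotheses (ab : a <= b) (a_ge : - a0%:R <= a) (b_le : b <= a0%:R) (alpha_le : `|alpha| <= a0%:R).
Hypotheses (hK : (1000 + 100 * a0 <= K)%N) (hN : (K ^ 410 <= N0)%N)
  (hH : (K ^ 2 * H <= N0)%N) (hH3 : (N0 ^ 3 * K ^ 200 <= H ^ 4)%N)
  (hU : (N0 <= U * K)%N) (UV : (U + N0 %/ K ^ 6 <= 2 * N0)%N)
  (hgcd : forall (u : nat) (l : int), (0 < u < 2 * N0)%N -> l \in Lseq a b alpha u ->
     (gcdn `|l| u <= H)%N)
  (htau : forall r, (0 < r < 2 * N0)%N -> (tau r <= K)%N).

(** [V] is the length of a block of [u] and also the smoothing length in [m], whose end points are
    only known up to [O(V)] in the block anyway. *)
Let V := (N0 %/ K ^ 6)%N.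
Let s := upairs U V.
Let E := (V %/ K ^ 399).+1.

Hypothesis (hE : forall r, (1 < r)%N -> (r <= K ^ 100)%N -> forall x y : int,
    (count (fun q : nat * int => (r %| q.1)%N && (r%:Z %| (q.2 - x)%R)%Z) s <=
     count (fun q : nat * int => (r %| q.1)%N && (r%:Z %| (q.2 - y)%R)%Z) s + E)%N).
Hypothesis (hS : `|(size s)%:R - V%:R * (b - a)| <= V%:R / K%:R).

Let nbad := count (fun q : nat * int => ~~ (gcdn `|q.2| q.1 <= K ^ 11)%N) s.

Let K0 : (0 < K)%N. Proof. by move: hK; clear; lia. Qed.
Let K1000 : (1000 <= K)%N. Proof. by move: hK; clear; lia. Qed.
Let Kpow i j : (i <= j)%N -> (K ^ i <= K ^ j)%N. Proof. exact: leq_pexp2l. Qed.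
Let K60 : (0 < K ^ 6)%N. Proof. by rewrite expn_gt0 K0. Qed.

Let V_le : (K ^ 6 * V <= N0)%N. Proof. by rewrite mulnC leq_trunc_div. Qed.

Let V_ge : (K ^ 400 <= V)%N.
Proof. by rewrite leq_divRL // -expnD (leq_trans _ hN) // Kpow. Qed.

Let N0_le : (N0 <= 2 * V * K ^ 6)%N.
Proof. by apply: leq_div_double => //; rewrite (leq_trans _ hN) // Kpow. Qed.

Let U0 : (0 < U)%N.
Proof.
have : (0 < N0)%N by rewrite (leq_trans _ hN) // expn_gt0 K0.
by move: hU; clear; case: U => [|n] //; rewrite mul0n; lia.
Qed.

Let D := (U ^ 2 %/ (2 * N0))%N.
Let e0 := (3 * V + 2 * H + 4 * a0 + 2)%N.

Let small_terms : (K ^ 2 * (2 * e0 + 1 + V + 2) <= 14 * N0)%N.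
Proof.
have h1 : (K ^ 2 * V <= N0)%N by rewrite (leq_trans _ V_le) // leq_mul // Kpow.
have h2 : (K ^ 2 * (4 * a0 + 4) <= N0)%N.
  rewrite (leq_trans _ hN) // (leq_trans (leq_mul (leqnn _) (_ : _ <= K)%N)) //.
    by move: hK; clear; lia.
  by rewrite -expnSr Kpow.
have h3 := hH.
rewrite /e0; apply: (@leq_trans (7 * (K ^ 2 * V) + 4 * (K ^ 2 * H) + 2 * (K ^ 2 * (4 * a0 + 4)))).
  move: (K ^ 2)%N; clear; nia.
by move: h1 h2 h3; move: (K ^ 2 * V)%N (K ^ 2 * H)%N (K ^ 2 * (4 * a0 + 4))%N; clear; lia.
Qed.

Let small_terms_le : (2 * e0 + 1 + V <= N0)%N.
Proof.
have h : (14 <= K ^ 2)%N by rewrite (leq_trans _ (_ : K <= _)%N) ?(leq_trans _ K1000) // -{1}(expn1 K) Kpow.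
have := small_terms; move: (2 * e0 + 1 + V)%N (K ^ 2)%N h; clear; nia.
Qed.

Let n1 := (U - 2 * D + 2 * e0 + 1 + V)%N.
Let n2 := (U - 2 * D - (2 * e0 + 2) - V)%N.
Let p' := (H %/ K ^ 6)%N.
Let h1 := (H + p')%N.
Let f := (H %/ K ^ 12)%N.
Let ERR := block_error s h1 (K ^ 100) (K ^ 11) E f K (6 * N0).
Let C := block_count a b alpha N0 H U V.

Let hH200 := param_H_ge hK hN hH3.

Let p'0 : (0 < p')%N.
Proof. by rewrite divn_gt0 // (leq_trans _ hH200) // Kpow. Qed.

Let V0 : (0 < V)%N.
Proof. by rewrite (leq_trans _ V_ge) // expn_gt0 K0. Qed.

Let smooth_bounds (x y : int) (n n' : nat) : (n <= n1)%N -> (n' <= h1)%N ->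
  let A := (\sum_(q <- s) q.1 * smooth_count x n V y n' p' q.1 q.2)%N in
  (A <= V * p' * (n * n' * size s + ERR))%N /\
  (V * p' * (n * n' * size s) <= A + V * p' * ERR)%N.
Proof.
have sU q : q \in s -> (0 < q.1 < 2 * N0)%N.
  by move=> /mem_upairs [qU _]; move: qU U0 UV; rewrite -/V; move: (q.1); clear; lia.
(* The smoothing lengths are [N0] and [H] divided by [K ^ 6]; one more factor [K] absorbs the
   constants. *)
have K7 : (K ^ 7 = K ^ 6 * K)%N by rewrite -expnSr.
apply: (@smooth_count_block s n1 V h1 p' (K ^ 100) (K ^ 11) E f K (6 * N0) (2 * N0)) => //.
- by move=> q qs; apply: htau; exact: sU.
- move=> q qs; have := sU q qs; have [_ ql] := mem_upairs qs.
  by move=> qq; rewrite (leq_trans (hgcd qq ql)) // leq_addr.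
- by rewrite /n1 leq_addl.
- by rewrite /h1 leq_addl.
- apply: (@leq_trans (4 * N0)).
    have := small_terms_le; rewrite /n1; move: UV; clear; lia.
  apply: (@leq_trans (4 * (2 * V * K ^ 6))); first by rewrite leq_mul2l N0_le.
  rewrite K7; move: K1000 (K ^ 6)%N; clear; nia.
- have H6 : (H <= 2 * p' * K ^ 6)%N.
    by apply: leq_div_double => //; rewrite (leq_trans _ hH200) // Kpow.
  apply: (@leq_trans (2 * H)).
    by rewrite /h1 mul2n -addnn leq_add2l leq_div.
  apply: (@leq_trans (2 * (2 * p' * K ^ 6))); first by rewrite leq_mul2l H6.
  rewrite K7; move: K1000 (K ^ 6)%N; clear; nia.
- rewrite (leq_trans (Kpow (_ : _ <= 410)%N)) // (leq_trans hN) //; clear; lia.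
- by rewrite (leq_trans (Kpow (_ : _ <= 200)%N)) // (leq_trans hH200) // leq_addr.
- have := small_terms_le; rewrite /n1; move: UV; clear; lia.
- by move=> r; exact: (param_f_ge hK hN hH3).
Qed.

(** The weight [u] of the smoothed sums lies between [U] and [U + V]: hence [U] here and [U + V] in
    [nat_dn]. *)
Let nat_up : (U * C <= n1 * h1 * size s + ERR)%N.
Proof.
have pp : (0 < V * p')%N by rewrite muln_gt0 V0.
rewrite -(leq_pmul2l pp).
have [h _] := smooth_bounds (D%:Z - e0%:Z - V%:Z)%R (N0%:Z - p'%:Z)%R (leqnn n1) (leqnn h1).
apply: leq_trans h; rewrite mulnCA.
have := block_count_le H V p' ab a_ge b_le alpha_le U0 UV; rewrite -/V -/C -/D -/e0 => h.
apply: leq_trans (leq_mul (leqnn U) h) _.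
rewrite sum_upairs big_distrr /= big_nat_cond [leqRHS]big_nat_cond; apply: leq_sum => u /andP[/andP[uU _] _].
rewrite big_distrr /=; apply: leq_sum => l _.
by rewrite leq_mul2r uU orbT.
Qed.

Let nat_dn : (n2 * (H - p') * size s <= (U + V) * C + ERR)%N.
Proof.
have pp : (0 < V * p')%N by rewrite muln_gt0 V0.
rewrite -(leq_pmul2l pp).
have nn : (n2 <= n1)%N by rewrite /n1 /n2; clear; lia.
have hh : (H - p' <= h1)%N by rewrite /h1; clear; lia.
have [_ h] := smooth_bounds (D%:Z + e0%:Z + 1)%R N0%:Z nn hh.
apply: leq_trans h _; rewrite mulnDr leq_add2r mulnCA.
have sN u : (`|(lo b alpha u - lo a alpha u)%R| <= N0)%N.
  have := Lseq_size alpha u ab; rewrite size_map size_iota => sz.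
  have : (2 * a0 + 1 <= N0)%N.
    rewrite (leq_trans _ hN) // (leq_trans _ (Kpow (_ : 1 <= _)%N)) // expn1.
    by move: hK; clear; lia.
  apply: leq_trans; rewrite -(ler_nat R); apply: le_trans sz _.
  have ha := a_ge; have hb := b_le; rewrite natrD natrM; lra.
have := block_count_ge H V p' ab a_ge b_le alpha_le U0 UV sN; rewrite -/V -/C -/D -/e0 => h.
apply: leq_trans (leq_mul (leqnn (U + V)) h).
rewrite sum_upairs big_distrr /= big_nat_cond [leqRHS]big_nat_cond; apply: leq_sum => u /andP[/andP[_ uU] _].
rewrite big_distrr /=; apply: leq_sum => l _.
by rewrite leq_mul2r (ltnW uU) orbT.
Qed.

Let x : R := K%:R^-1.
Let c : R := b - a.
Let rho : R := Num.max 0 (1 - U%:R / N0%:R).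

Let K0' : 0 < K%:R :> R. Proof. by rewrite ltr0n. Qed.
Let N00 : (0 < N0)%N. Proof. by rewrite (leq_trans _ hN) // expn_gt0 K0. Qed.
Let N00' : 0 < N0%:R :> R. Proof. by rewrite ltr0n. Qed.
Let U0' : 0 < U%:R :> R. Proof. by rewrite ltr0n. Qed.
Let x0 : 0 < x. Proof. by rewrite invr_gt0. Qed.
Let Kx : K%:R * x = 1. Proof. by rewrite divff // gt_eqF. Qed.
Let x1 : x <= 1. Proof. by rewrite invf_le1 ?ler1n. Qed.

Let x_le (y z : nat) (i : nat) : (K ^ i * y <= z)%N -> y%:R <= z%:R * x ^+ i.
Proof.
move=> h; rewrite /x exprVn ler_pdivlMr ?exprn_gt0 // -natrX -natrM ler_nat mulnC //.
Qed.

Let N0_xU : N0%:R * x <= U%:R.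
Proof. by rewrite ler_pdivrMr // -natrM ler_nat. Qed.

Let d_real : [/\ D%:R <= U%:R ^+ 2 / (2 * N0%:R) :> R & U%:R ^+ 2 / (2 * N0%:R) < D%:R + 1 :> R].
Proof.
have N2 : (0 < 2 * N0)%N by rewrite muln_gt0.
have N2' : 0 < 2 * N0%:R :> R by rewrite mulr_gt0.
split.
- by rewrite ler_pdivlMr // -natrM -natrM -natrX ler_nat leq_trunc_div.
- by rewrite ltr_pdivrMr // natr1 -natrM -natrM -natrX ltr_nat ltn_ceil.
Qed.

Let Urho : U%:R * (1 - U%:R / N0%:R) = U%:R - 2 * (U%:R ^+ 2 / (2 * N0%:R)) :> R.
Proof. by field; rewrite gt_eqF. Qed.

Let rest_le : (2 * e0 + 1 + V + 2)%:R <= U%:R * (14 * x).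
Proof.
have := x_le (_ : K ^ 2 * (2 * e0 + 1 + V + 2) <= 14 * N0)%N; move=> /(_ small_terms) h.
apply: le_trans h _; rewrite natrM expr2.
by have := ler_wpM2r (ltW x0) N0_xU; lra.
Qed.

Let n1_le : n1%:R <= U%:R * (rho + 14 * x).
Proof.
have [_ d2] := d_real; have r0 := rest_le.
have rho0 : 0 <= rho by rewrite le_max lexx.
have rho1 : 1 - U%:R / N0%:R <= rho by rewrite le_max lexx orbT.
rewrite mulrDr; apply: le_trans (lerD (_ : (U - 2 * D)%:R - 2 <= U%:R * rho) r0).
  by rewrite /n1 !natrD; lra.
have Ur : U%:R * (1 - U%:R / N0%:R) <= U%:R * rho by rewrite ler_pM2l.
(* Where [2 * D] reaches [U], truncated subtraction gives 0, in accordance with the cut-off in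
   [rho]. *)
have [le|lt] := leqP U (2 * D).
  have -> : (U - 2 * D = 0)%N by apply/eqP; rewrite subn_eq0.
  have : 0 <= U%:R * rho by rewrite mulr_ge0 // ltW.
  by lra.
rewrite natrB ?(ltnW lt) // natrM; move: Ur; rewrite Urho; lra.
Qed.

Let n2_ge : U%:R * (rho - 14 * x) <= n2%:R.
Proof.
have [d1 _] := d_real; have r0 := rest_le.
rewrite mulrBr.
have n20 : 0 <= n2%:R :> R by [].
have ge : U%:R - 2 * D%:R - (2 * e0 + 1 + V + 2)%:R <= n2%:R :> R.
  rewrite !lerBlDr -[2]/(2%:R) -natrM -!natrD ler_nat /n2; clear; lia.
rewrite /rho; case: (leP 0 (1 - U%:R / N0%:R)) => h.
  rewrite Urho; lra.
have : 0 <= (2 * e0 + 1 + V + 2)%:R :> R by [].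
by rewrite mulr0; lra.
Qed.

Let p'_le : p'%:R <= H%:R * x.
Proof.
apply: le_trans (x_le (_ : K ^ 6 * p' <= H)%N) _; first by rewrite mulnC leq_trunc_div.
by rewrite ler_wpM2l // -[leRHS]expr1 ler_wiXn2l // ltW.
Qed.

(** Division by [U >= N0 / K] costs one [K]. The small moduli lose [K ^ 300] against
    [E <= V / K ^ 398], the large ones [K] against [f <= H / K ^ 12]. The bad pairs are kept as they
    are. *)
Let ERR_le : ERR%:R <= U%:R * (H%:R * V%:R * (6 * (c + 2)) * x
    + 60 * K%:R ^+ 9 * H%:R * nbad%:R).
Proof.
have hp := p'_le; have hS' := hS; have N0U := N0_xU.
have c0 : 0 <= c by rewrite subr_ge0.
have xx : x ^+ 2 <= x by rewrite -[leRHS]expr1 ler_wiXn2l // ltW.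
have h1_le : h1%:R <= 2 * H%:R :> R.
  have : H%:R * x <= H%:R by rewrite ler_piMr.
  by rewrite /h1 natrD; lra.
have S_le : (size s)%:R <= V%:R * (c + 1).
  move: hS'; rewrite ler_distl => /andP[_]; rewrite -/c -/x.
  have : V%:R * x <= V%:R by rewrite ler_piMr.
  by lra.
have E_le : E%:R <= V%:R * x ^+ 398.
  have e : (E <= 2 * (V %/ K ^ 399))%N.
    have : (0 < V %/ K ^ 399)%N by rewrite divn_gt0 ?expn_gt0 ?K0 // (leq_trans (Kpow (_ : _ <= 400)%N)).
    by rewrite /E; clear; lia.
  apply: x_le; apply: leq_trans (leq_mul (leqnn _) e) _.
  apply: leq_trans (leq_trunc_div V (K ^ 399)).
  rewrite mulnCA mulnA mulnC leq_mul2l; apply/orP; right.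
  by rewrite (expnS K 398) leq_mul2r (leq_trans _ K1000) // orbT.
have f_le : f%:R <= H%:R * x ^+ 12 by apply: x_le; rewrite mulnC leq_trunc_div.
have xK n : x ^+ n * K%:R ^+ n = 1 by rewrite -exprMn mulrC Kx expr1n.
have HV0 : 0 <= H%:R * V%:R :> R by rewrite mulr_ge0.
have x2 : 2 * x <= 1.
  rewrite mulrC -ler_pdivlMr // mul1r /x lef_pV2 ?posrE // ler_nat.
  by rewrite (leq_trans _ K1000).
have t1 : (h1 * (K ^ 100) ^ 3 * E)%:R <= 2 * (H%:R * V%:R) * x ^+ 98.
  rewrite -expnM 2!natrM natrX.
  apply: (@le_trans _ _ ((2 * H%:R) * K%:R ^+ 300 * (V%:R * x ^+ 398))).
    by apply: ler_pM; rewrite ?mulr_ge0 ?exprn_ge0 // ler_wpM2r ?exprn_ge0.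
  have x3 : x ^+ 398 = x ^+ 300 * x ^+ 98 by rewrite -exprD.
  rewrite x3 (_ : _ * _ = 2 * (H%:R * V%:R) * x ^+ 98 * (x ^+ 300 * K%:R ^+ 300)).
    by rewrite xK mulr1.
  by move: (x ^+ 300) (x ^+ 98) (K%:R ^+ 300) => u v w; ring.
have t2 : (size s * K * f)%:R <= H%:R * V%:R * (c + 1) * x ^+ 11.
  rewrite !natrM.
  apply: (@le_trans _ _ ((V%:R * (c + 1)) * K%:R * (H%:R * x ^+ 12))).
    by apply: ler_pM; rewrite ?mulr_ge0 // ler_wpM2r.
  rewrite [x ^+ 12]exprS (_ : _ * _ = H%:R * V%:R * (c + 1) * x ^+ 11 * (K%:R * x)).
    by rewrite Kx mulr1.
  by move: (x ^+ 11) => u; ring.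
have t3 : (nbad * (5 * K ^ 8 * h1))%:R <= 10 * K%:R ^+ 8 * H%:R * nbad%:R :> R.
  rewrite 3!natrM natrX.
  rewrite [leRHS](_ : _ = nbad%:R * (5 * K%:R ^+ 8 * (2 * H%:R))).
    by rewrite ler_wpM2l // ler_wpM2l // mulr_ge0 // exprn_ge0.
  by move: (K%:R ^+ 8) => u; ring.
have x98 : 2 * x ^+ 98 <= x ^+ 2.
  apply: (@le_trans _ _ (2 * x ^+ 3)); first by rewrite ler_pM2l // ler_wiXn2l // ltW.
  by rewrite exprS mulrA ler_piMl // exprn_ge0 // ltW.
have x11 : x ^+ 11 <= x ^+ 2 by rewrite ler_wiXn2l // ltW.
have N6 : (6 * N0)%:R <= 6 * K%:R * U%:R :> R.
  by rewrite -!natrM ler_nat -mulnA leq_mul2l mulnC hU orbT.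
rewrite /ERR /block_error -/nbad natrM 2!natrD.
apply: (@le_trans _ _ (6 * K%:R * U%:R * (H%:R * V%:R * x ^+ 2
    + H%:R * V%:R * (c + 1) * x ^+ 2 + 10 * K%:R ^+ 8 * H%:R * nbad%:R))).
  apply: ler_pM; rewrite ?ler0n ?addr_ge0 ?ler0n //.
  apply: lerD => //; apply: lerD.
    apply: le_trans t1 _; rewrite mulrAC mulrC; apply: ler_wpM2l => //.
  by apply: le_trans t2 _; rewrite ler_wpM2l // mulr_ge0 // addr_ge0.
have Kxx : K%:R * x ^+ 2 = x by rewrite expr2 mulrA Kx mul1r.
rewrite [leLHS](_ : _ = U%:R * (6 * (H%:R * V%:R) * (c + 2) * (K%:R * x ^+ 2)
   + 60 * (K%:R * K%:R ^+ 8) * H%:R * nbad%:R)); last first.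
  by move: (K%:R ^+ 8) (x ^+ 2) => u v; ring.
rewrite Kxx -exprS ler_pM2l // lerD2r.
by apply: le_of_eq; ring.
Qed.

(** The bad pairs remain in the bound, because they are estimated only in total over all blocks. *)
Lemma block_asymptotic :
  `|C%:R - H%:R * V%:R * (b - a) * rho|
   <= H%:R * V%:R * (100 * (b - a + 2)) * x + 3 * (60 * K%:R ^+ 9 * H%:R * nbad%:R).
Proof.
have hS' := hS.
have c0 : 0 <= c by rewrite subr_ge0.
have r0 : 0 <= rho by rewrite le_max lexx.
have r1 : rho <= 1.
  by rewrite ge_max ler01 gerBl divr_ge0.
apply: (@real_block R x c rho U%:R V%:R H%:R n1%:R h1%:R n2%:R (H - p')%N%:R (size s)%:R
   ERR%:R C%:R (60 * K%:R ^+ 9 * H%:R * nbad%:R)) => //.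
- by have := p'_le; rewrite /h1 natrD; lra.
- by move: hS'; rewrite ler_distl -/c -/x => /andP[_]; lra.
- have p'H : (p' <= H)%N by rewrite leq_div.
  by have := p'_le; rewrite natrB //; lra.
- by move: hS'; rewrite ler_distl -/c -/x => /andP[h _]; lra.
- apply: le_trans (x_le V_le) _; apply: (@le_trans _ _ (N0%:R * x ^+ 2)).
    by rewrite ler_wpM2l // ler_wiXn2l // ltW.
  by rewrite expr2 mulrA [x * _]mulrC ler_wpM2r // ltW.
- by rewrite -!natrM -natrD ler_nat.
- by rewrite -natrD -!natrM -natrD ler_nat.
Qed.

End block_instance.

(** * Pairs with a large common divisor *)

Lemma sum_multiples (U V r : nat) : (0 < r)%N -> exists t W : nat,
  [/\ (W * r < V + r)%N, (V < W.+1 * r)%N &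
   forall F : nat -> nat,
     (\sum_(U <= u < U + V | r %| u) F u = \sum_(i < W) F (r * (t + i)))%N].
Proof.
move=> r0; set t := ((U + r.-1) %/ r)%N.
have tU : (U <= r * t < U + r)%N.
  have h1 := leq_trunc_div (U + r.-1) r; have h2 := ltn_ceil (U + r.-1) r0.
  by move: h1 h2; rewrite -/t; move: r0; clear; nia.
suff [W [h1 h2 hF]] : exists W : nat, [/\ (U + V <= r * (t + W))%N, (r * (t + W) < U + V + r)%N &
   forall F : nat -> nat,
     (\sum_(U <= u < U + V | r %| u) F u = \sum_(i < W) F (r * (t + i)))%N].
  exists t, W; move: h1 h2 tU; rewrite mulnDr; split => //; move: h1 h2 tU; rewrite ?mulSn (mulnC W r); clear; lia.
elim: V => [|V [W [h1 h2 hF]]].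
  by exists 0%N; rewrite !addn0; case/andP: tU => ? ?; split => // F; rewrite big_geq // big_ord0.
case: (boolP (r %| U + V)%N) => [dv|nd].
  have e : (U + V = r * (t + W))%N.
    case/dvdnP: dv => e eE; move: h1 h2; rewrite eE mulnC leq_pmul2l // -mulnSr ltn_pmul2l //.
    by move=> h1 h2; congr (_ * _)%N; apply/eqP; rewrite eqn_leq h1 -ltnS.
  exists W.+1; split; try by move: e r0; clear; nia.
  by move=> F; rewrite addnS big_mkcond big_nat_recr ?leq_addr //= dv -big_mkcond hF big_ord_recr /= e.
exists W; split; [|by move: h2; clear; lia|].
  have : (U + V != r * (t + W))%N by apply: contra nd => /eqP ->; exact: dvdn_mulr.
  by move: h1; clear; lia.
by move=> F; rewrite addnS big_mkcond big_nat_recr ?leq_addr //= (negbTE nd) addn0 -big_mkcond hF.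
Qed.

Lemma sum_nat_shift (U V : nat) (F : nat -> nat) :
  (\sum_(U <= u < U + V) F u = \sum_(i < V) F (U + i))%N.
Proof.
rewrite -{1}(add0n U) big_addn addKn big_mkord.
by apply: eq_bigr => i _; rewrite addnC.
Qed.

Section pair_counts.
Variable R : realType.
Variables (a b alpha : R) (K B N0 : nat).
Hypotheses (ab : a <= b) (K1 : (1 < K)%N).
Hypothesis equi : forall r t W : nat, (0 < r)%N -> (K ^ B <= W)%N -> forall lam : int,
  `|(\sum_(i < W) count (fun l => (r%:Z %| (l - lam)%R)%Z) (Lseq a b alpha (r * (t + i))))%:R
     - W%:R * ((b - a) / r%:R)| <= W%:R / K%:R ^+ 400.

Let K0 : (0 < K)%N := ltnW K1.
Let K0' : 0 < K%:R :> R. Proof. by rewrite ltr0n. Qed.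

Lemma upairs_size (U V : nat) : (K ^ B <= V)%N ->
  `|(size (upairs a b alpha U V))%:R - V%:R * (b - a)| <= V%:R / K%:R.
Proof.
move=> KV; have := equi U (isT : (0 < 1)%N) KV 0; rewrite divr1.
have -> : (\sum_(i < V) count (fun l => (1%:Z %| (l - 0)%R)%Z) (Lseq a b alpha (1 * (U + i))))%N
  = size (upairs a b alpha U V).
  rewrite -sum1_size sum_upairs sum_nat_shift; apply: eq_bigr => i _.
  rewrite mul1n sum1_size (eq_count (a2 := predT)) ?count_predT // => l.
  by rewrite dvd1z.
move=> h; apply: le_trans h _; rewrite ler_wpM2l // lef_pV2 ?posrE ?exprn_gt0 //.
by rewrite -[leLHS]expr1 ler_eXn2l ?ltr1n.
Qed.

Lemma count_upairs (U V r t W : nat) (lam : int) :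
  (forall F : nat -> nat,
     (\sum_(U <= u < U + V | r %| u) F u = \sum_(i < W) F (r * (t + i)))%N) ->
  (count (fun q : nat * int => (r %| q.1)%N && (r%:Z %| (q.2 - lam)%R)%Z) (upairs a b alpha U V)
   = \sum_(i < W) count (fun l => (r%:Z %| (l - lam)%R)%Z) (Lseq a b alpha (r * (t + i))))%N.
Proof.
move=> hF; rewrite -sum1_count big_mkcond sum_upairs /=.
rewrite -(hF (fun u => count (fun l => (r%:Z %| (l - lam)%R)%Z) (Lseq a b alpha u))).
rewrite [RHS]big_mkcond; apply: eq_bigr => u _; case: (r %| u)%N => /=.
  by rewrite -big_mkcond sum1_count.
by rewrite big1.
Qed.

(** As [r <= K ^ 100], the block contains at least [K ^ B] multiples of [r], as [equi] requires; two
    residues differ by at most [2 * W / K ^ 400]. *)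
Lemma upairs_residues (U V : nat) : (K ^ (B + 101) <= V)%N ->
  forall r, (1 < r)%N -> (r <= K ^ 100)%N -> forall x y : int,
  (count (fun q : nat * int => (r %| q.1)%N && (r%:Z %| (q.2 - x)%R)%Z) (upairs a b alpha U V) <=
   count (fun q : nat * int => (r %| q.1)%N && (r%:Z %| (q.2 - y)%R)%Z) (upairs a b alpha U V)
     + (V %/ K ^ 399).+1)%N.
Proof.
move=> KV r r1 rK x y; have r0 := ltnW r1.
have [t [W [h1 h2 hF]]] := sum_multiples U V r0.
rewrite !(count_upairs _ hF).
have KB0 : (0 < K ^ B)%N by rewrite expn_gt0 K0.
have KW : (K ^ B <= W)%N.
  rewrite -ltnS -(@ltn_pmul2r r) //; apply: leq_ltn_trans h2.
  apply: leq_trans KV; rewrite expnD leq_mul //; apply: leq_trans rK _.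
  by rewrite leq_pexp2l.
have WV : (W <= V)%N.
  have V0 : (1 < V)%N.
    apply: leq_trans KV; apply: leq_trans K1 _; rewrite -{1}(expn1 K) leq_pexp2l //.
    by rewrite addn_gt0 orbT.
  by move: h1 r1 V0; clear; nia.
have := equi t r0 KW x; have := equi t r0 KW y.
set cx := (\sum_(i < W) _)%N; set cy := (\sum_(i < W) _)%N.
rewrite !ler_distl => /andP[c1 c2] /andP[c3 c4].
rewrite addnS -(ler_nat R) -natr1 natrD.
have VE : V%:R / K%:R ^+ 399 < (V %/ K ^ 399)%N%:R + 1 :> R.
  rewrite ltr_pdivrMr ?exprn_gt0 // natr1 -natrX -natrM ltr_nat ltn_ceil //.
  by rewrite expn_gt0 K0.
have WE : 2 * (W%:R / K%:R ^+ 400) <= V%:R / K%:R ^+ 399 :> R.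
  rewrite (exprS _ 399) invfM !mulrA ler_pM2r ?invr_gt0 ?exprn_gt0 //.
  rewrite ler_pdivrMr // mulrC; apply: ler_pM => //; rewrite ?ler_nat //.
by move: c1 c4 VE WE; set C1 := (_ / _); set C2 := (_ / _); lra.
Qed.

Hypothesis tauK : forall u, (0 < u < 2 * N0)%N -> (tau u <= K)%N.
Hypothesis gcdK : forall (u : nat) (l : int), (0 < u < 2 * N0)%N -> l \in Lseq a b alpha u ->
     (gcdn `|l| u * K ^ B.+1 <= N0)%N.

(** Sum over the common divisor [d > K ^ 11]. By [gcdK], [d <= N0 / K ^ B.+1], which leaves enough
    multiples of [d] for [equi]: the pairs with [d | u] and [d | l] number at most
    [(b - a + 1) / K ^ 11] per multiple [u]. Summing the multiples over [d] costs [tau u <= K]. *)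
Lemma bad_total : (0 < N0)%N ->
  (count (fun q : nat * int => ~~ (gcdn `|q.2| q.1 <= K ^ 11)%N)
     (upairs a b alpha 1 (2 * N0 - 1)))%:R
  <= 2 * N0%:R * K%:R * ((b - a + 1) / K%:R ^+ 11).
Proof.
move=> N00; set s := upairs _ _ _ _ _; pose Dm := (N0 %/ K ^ B.+1)%N.
have KB0 : (0 < K ^ B.+1)%N by rewrite expn_gt0 K0.
pose cnt d := count (fun q : nat * int => (d %| q.1)%N && (d%:Z %| (q.2 - 0)%R)%Z) s.
have step1 : (count (fun q : nat * int => ~~ (gcdn `|q.2| q.1 <= K ^ 11)%N) s
   <= \sum_(d < Dm.+1 | K ^ 11 < d) cnt d)%N.
  rewrite -sum1_count /cnt; under [leqRHS]eq_bigr => d _ do rewrite -sum1_count big_mkcond.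
  rewrite [leqRHS]exchange_big big_mkcond /= big_seq [leqRHS]big_seq; apply: leq_sum => q qs.
  case: ifP => // qb; rewrite -ltnNge in qb.
  have [qU ql] := mem_upairs qs; have qU' : (0 < q.1 < 2 * N0)%N by move: qU N00; move: (q.1); clear; lia.
  have := gcdK qU' ql; set g := gcdn _ _ in qb * => gK.
  have gD : (g < Dm.+1)%N by rewrite ltnS leq_divRL.
  rewrite (bigD1 (Ordinal gD)) //= /g dvdn_gcdr subr0 dvdzE /= dvdn_gcdl /=.
  exact: leq_addr.
have step2 (d : nat) : (K ^ 11 < d)%N -> (d <= Dm)%N ->
   (cnt d)%:R <= (\sum_(1 <= u < 1 + (2 * N0 - 1) | d %| u) 1)%N%:R * ((b - a + 1) / K%:R ^+ 11) :> R.
  move=> Kd dD; have d0 : (0 < d)%N by apply: leq_trans Kd.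
  have [t [W [h1 h2 hF]]] := sum_multiples 1 (2 * N0 - 1) d0.
  rewrite (hF (fun=> 1%N)) sum1_card card_ord /cnt (count_upairs _ hF).
  have KW : (K ^ B <= W)%N.
    have dN : (d * K ^ B.+1 <= N0)%N by rewrite -leq_divRL.
    have KB1 : (K ^ B < K ^ B.+1)%N by rewrite ltn_exp2l.
    have : (K ^ B.+1 * d <= 2 * N0 - 1)%N by rewrite mulnC (leq_trans dN) //; move: N00; clear; lia.
    move=> /leq_ltn_trans /(_ h2); rewrite ltn_pmul2r // ltnS.
    by apply: leq_trans; rewrite ltnW.
  have := equi t d0 KW 0; rewrite ler_distl => /andP[_ h]; apply: le_trans h _.
  have d0' : 0 < d%:R :> R by rewrite ltr0n.
  have K11 : 0 < K%:R ^+ 11 :> R by rewrite exprn_gt0.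
  rewrite -mulrDr ler_wpM2l // [leRHS]mulrDl mul1r lerD //.
    rewrite ler_wpM2l ?subr_ge0 // lef_pV2 ?posrE // -natrX ler_nat ltnW //.
  by rewrite lef_pV2 ?posrE ?exprn_gt0 // ler_eXn2l ?ltr1n.
have step3 : (\sum_(d < Dm.+1 | K ^ 11 < d) \sum_(1 <= u < 1 + (2 * N0 - 1) | d %| u) 1
   <= 2 * N0 * K)%N.
  rewrite (exchange_big_dep xpredT) //=.
  apply: (@leq_trans (\sum_(1 <= u < 1 + (2 * N0 - 1)) K)%N); last first.
    by rewrite sum_nat_const_nat leq_mul2r; apply/orP; right; clear; lia.
  rewrite big_nat_cond [leqRHS]big_nat_cond; apply: leq_sum => u /andP[uu _].
  have uU : (0 < u < 2 * N0)%N by move: uu N00; clear; lia.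
  apply: leq_trans (tauK uU); case/andP: uU => u0 _.
  rewrite -(big_mkord (fun d => (K ^ 11 < d) && (d %| u))%N (fun=> 1%N)) sum1_count.
  rewrite -size_filter /tau; apply: uniq_leq_size; first by rewrite filter_uniq ?iota_uniq.
  by move=> d; rewrite mem_filter -dvdn_divisors // => /andP[/andP[]].
apply: (@le_trans _ _ (\sum_(d < Dm.+1 | (K ^ 11 < d)%N) (cnt d)%:R)).
  by rewrite -natr_sum ler_nat.
apply: (@le_trans _ _ (\sum_(d < Dm.+1 | (K ^ 11 < d)%N)
   (\sum_(1 <= u < 1 + (2 * N0 - 1) | (d %| u)%N) 1)%N%:R * ((b - a + 1) / K%:R ^+ 11))).
  by apply: ler_sum => d Kd; apply: step2 => //; rewrite -ltnS.
rewrite -big_distrl -natr_sum /=; apply: ler_wpM2r.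
  by rewrite divr_ge0 ?exprn_ge0 // addr_ge0 // subr_ge0.
by rewrite -!natrM ler_nat.
Qed.

End pair_counts.

(** * Summation over the blocks *)

Section triangle_weights.
Variable R : realType.

(** For [u <= N], the proportion of the indices [j] for which [j + u] stays in range. *)
Definition tri (N u : nat) : R := Num.max 0 (1 - u%:R / N%:R).

Lemma tri_ge0 (N u : nat) : 0 <= tri N u. Proof. by rewrite le_max lexx. Qed.

Lemma tri_le1 (N u : nat) : tri N u <= 1.
Proof. by rewrite ge_max ler01 gerBl divr_ge0. Qed.

Lemma sum_tri (N M : nat) : (0 < N)%N -> (N <= M)%N ->
  \sum_(1 <= u < M) tri N u = (N%:R - 1) / 2.
Proof.
move=> N0 NM; have N0' : N%:R != 0 :> R by rewrite pnatr_eq0 -lt0n.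
rewrite (@big_cat_nat _ _ _ N) //= [X in _ + X]big_nat_cond [X in _ + X]big1 => [|u /andP[/andP[Nu _] _]].
  rewrite addr0 (_ : \sum_(1 <= u < N) tri N u = \sum_(1 <= u < N) (1 - u%:R / N%:R)).
    have S n : \sum_(1 <= u < n.+1) (u%:R : R) = n%:R * (n%:R + 1) / 2.
      elim: n => [|n IH]; first by rewrite big_geq // mul0r mul0r.
      by rewrite big_nat_recr //= IH -natr1; field.
    rewrite sumrB -big_distrl /= sumr_const_nat.
    case: N N0 N0' {NM} => // n _ n0; rewrite S subn1 /= -!natr1 in n0 *.
    by field.
  apply: eq_big_nat => u /andP[_ uN]; rewrite /tri max_r //.
  by rewrite subr_ge0 ler_pdivrMr ?ltr0n // mul1r ler_nat ltnW.
rewrite /tri max_l // subr_le0 ler_pdivlMr ?ltr0n // mul1r ler_nat //.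
Qed.

Lemma tri_dist (N0 N U u : nat) (e : R) : (0 < N0)%N -> (0 < N)%N ->
  `|U%:R / N0%:R - u%:R / N%:R| <= e -> `|tri N0 U - tri N u| <= e.
Proof.
move=> _ _; rewrite !ler_distl => /andP[h1 h2]; rewrite /tri.
by apply/andP; split; case: (leP 0 (1 - U%:R / N0%:R)); case: (leP 0 (1 - u%:R / N%:R)); lra.
Qed.

End triangle_weights.

Lemma sum_blocks (V : nmodType) (U W nb : nat) (F : nat -> V) :
  \sum_(U <= u < U + nb * W) F u
  = \sum_(k < nb) \sum_(U + k * W <= u < U + k * W + W) F u.
Proof.
elim: nb => [|nb IH]; first by rewrite mul0n addn0 big_geq // big_ord0.
rewrite big_ord_recr /= -IH mulSn [(W + _)%N]addnC addnA.
by rewrite (@big_cat_nat _ _ _ (U + nb * W)) //= leq_addr.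
Qed.

(** Only pairs whose first index is the larger; the others are counted by [cplus] for the reflected
    interval. *)
Definition cplus (R : realType) (a b alpha : R) (N : nat) : nat :=
  \sum_(1 <= u < N) ccount a b alpha N u.

Section block_sums.
Variable R : realType.
Variables (a b alpha : R) (a0 K K1 B N0 H : nat).
Hypotheses (ab : a <= b) (a_ge : - a0%:R <= a) (b_le : b <= a0%:R) (alpha_le : `|alpha| <= a0%:R).
Hypotheses (hK : (1000 + 100 * a0 <= K)%N) (hN : (K ^ (B + 510) <= N0)%N)
  (hH : (K ^ 2 * H <= N0)%N) (hH3 : (N0 ^ 3 * K ^ 200 <= H ^ 4)%N)
  (hgcd : forall (u : nat) (l : int), (0 < u < 2 * N0)%N -> l \in Lseq a b alpha u ->
     (gcdn `|l| u <= H)%N)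
  (hgcdK : forall (u : nat) (l : int), (0 < u < 2 * N0)%N -> l \in Lseq a b alpha u ->
     (gcdn `|l| u * K ^ B.+1 <= N0)%N)
  (htau : forall r, (0 < r < 2 * N0)%N -> (tau r <= K1)%N) (hK1 : (K1 ^ 2 = K)%N)
  (equi : forall r t W : nat, (0 < r)%N -> (K ^ B <= W)%N -> forall lam : int,
  `|(\sum_(i < W) count (fun l => (r%:Z %| (l - lam)%R)%Z) (Lseq a b alpha (r * (t + i))))%:R
     - W%:R * ((b - a) / r%:R)| <= W%:R / K%:R ^+ 400).

Let K0 : (0 < K)%N. Proof. by move: hK; clear; lia. Qed.
Let K0' : 0 < K%:R :> R. Proof. by rewrite ltr0n. Qed.
Let K1000 : (1000 <= K)%N. Proof. by move: hK; clear; lia. Qed.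
Let Kpow i j : (i <= j)%N -> (K ^ i <= K ^ j)%N. Proof. exact: leq_pexp2l. Qed.
Let N00 : (0 < N0)%N. Proof. by rewrite (leq_trans _ hN) // expn_gt0 K0. Qed.
Let N00' : 0 < N0%:R :> R. Proof. by rewrite ltr0n. Qed.
Let hN410 : (K ^ 410 <= N0)%N. Proof. by rewrite (leq_trans _ hN) // Kpow // (leq_trans _ (leq_addl B 510)). Qed.

Let V := (N0 %/ K ^ 6)%N.
(** The [u < U0] are treated trivially. The blocks end at [M], beyond [N0 + H] so that every [u < N]
    is reached; counts and weights vanish for [u >= N]. *)
Let U0 := (N0 %/ K).+1.
Let nb := ((N0 + H) %/ V).+1.
Let M := (U0 + nb * V)%N.
Let c : R := b - a.
Let x : R := K%:R^-1.

Let K1_le : (K1 <= K)%N. Proof. by rewrite -hK1; case: (K1) => // n; rewrite -{1}(expn1 n.+1) leq_pexp2l. Qed.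
Let htauK r : (0 < r < 2 * N0)%N -> (tau r <= K)%N.
Proof. by move=> /htau /leq_trans; apply. Qed.

Let V_ge : (K ^ (B + 500) <= V)%N.
Proof.
by rewrite leq_divRL ?expn_gt0 ?K0 // -expnD (leq_trans _ hN) // Kpow // -addnA leq_add2l.
Qed.

Let V0 : (0 < V)%N. Proof. by rewrite (leq_trans _ V_ge) // expn_gt0 K0. Qed.

Let M_gt : (N0 + H < M)%N.
Proof. by rewrite /M ltn_addl // ltn_ceil. Qed.

Let M_le : (M <= 2 * N0)%N.
Proof.
have h1 : (1000 * (N0 %/ K) <= N0)%N.
  by apply: leq_trans (leq_trunc_div N0 K); rewrite mulnC leq_mul2l K1000 orbT.
have K2 : (1000 <= K ^ 2)%N by rewrite (leq_trans K1000) // -{1}(expn1 K) Kpow.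
have K6 : (1000 <= K ^ 6)%N by rewrite (leq_trans K1000) // -{1}(expn1 K) Kpow.
have h2 : (1000 * H <= N0)%N by apply: leq_trans hH; rewrite leq_mul2r K2 orbT.
have h3 : (1000 * V <= N0)%N.
  by apply: leq_trans (leq_trunc_div N0 (K ^ 6)); rewrite mulnC leq_mul2l K6 orbT.
have h4 : (1000 <= N0)%N by rewrite (leq_trans K1000) // (leq_trans _ hN410) // -{1}(expn1 K) Kpow.
have h5 := leq_trunc_div (N0 + H) V.
rewrite /M /nb /U0 mulSn; move: h1 h2 h3 h4 h5; move: ((N0 + H) %/ V * V)%N (N0 %/ K)%N (V); clear; lia.
Qed.

Let nbad (k : nat) := count (fun q : nat * int => ~~ (gcdn `|q.2| q.1 <= K ^ 11)%N)
  (upairs a b alpha (U0 + k * V) V).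

Let block_k (k : 'I_nb) :
  `|(block_count a b alpha N0 H (U0 + k * V) V)%:R
    - H%:R * V%:R * (b - a) * tri R N0 (U0 + k * V)|
  <= H%:R * V%:R * (100 * (b - a + 2)) * x + 3 * (60 * K%:R ^+ 9 * H%:R * (nbad k)%:R).
Proof.
apply: (@block_asymptotic R a b alpha a0 K N0 H (U0 + k * V)) => //.
- rewrite (leq_trans (_ : _ <= U0 * K)%N) // ?leq_mul2r ?leq_addr ?orbT //.
  by rewrite ltnW // ltn_ceil.
- apply: leq_trans M_le; rewrite /M -addnA leq_add2l addnC -mulSn leq_mul2r.
  by rewrite ltn_ord orbT.
- move=> r r1 rK; apply: (upairs_residues (B := B)) => //.
    by rewrite (leq_trans _ K1000).
  by rewrite (leq_trans _ V_ge) // Kpow // leq_add2l.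
- apply: (upairs_size (B := B)) => //.
    by rewrite (leq_trans _ K1000).
  by rewrite (leq_trans _ V_ge) // Kpow // leq_addr.
Qed.

Let sum_nbad : \sum_(k < nb) (nbad k)%:R <= 2 * N0%:R * K%:R * ((c + 1) / K%:R ^+ 11).
Proof.
have K1' : (1 < K)%N by rewrite (leq_trans _ K1000).
have := bad_total ab K1' equi htauK hgcdK N00; apply: le_trans.
rewrite -natr_sum ler_nat.
have cE u w : count (fun q : nat * int => ~~ (gcdn `|q.2| q.1 <= K ^ 11)%N) (upairs a b alpha u w)
  = (\sum_(u <= v < u + w) \sum_(l <- Lseq a b alpha v) ~~ (gcdn `|l| v <= K ^ 11)%N)%N.
  rewrite -(sum_upairs a b alpha u w (fun q => ~~ (gcdn `|q.2| q.1 <= K ^ 11)%N : nat)).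
  by rewrite -sum1_count big_mkcond; apply: eq_bigr => q _; case: (~~ _).
rewrite cE; under eq_bigr => k _ do rewrite /nbad cE.
rewrite -(sum_blocks U0 V nb (fun v => \sum_(l <- Lseq a b alpha v) ~~ (gcdn `|l| v <= K ^ 11)%N)%N).
rewrite subnKC ?muln_gt0 // (@big_cat_nat _ _ _ U0 1) //=; last first.
  by rewrite (leq_trans _ M_le) // leq_addr.
rewrite (@big_cat_nat _ _ _ M U0 (2 * N0)) ?leq_addr //=.
by rewrite addnCA leq_addr.
Qed.

Let x0 : 0 < x. Proof. by rewrite invr_gt0. Qed.
Let Kx : K%:R * x = 1. Proof. by rewrite divff // gt_eqF. Qed.
Let K10 : (0 < K1)%N. Proof. by rewrite lt0n; apply/eqP => e; move: hK1 K0; rewrite e => <-. Qed.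
Let K10' : 0 < K1%:R :> R. Proof. by rewrite ltr0n. Qed.
Let y : R := K1%:R^-1.
Let y0 : 0 < y. Proof. by rewrite invr_gt0. Qed.
Let K1x : K1%:R * x = y.
Proof. by rewrite /x /y -hK1 natrX expr2 invfM mulrA divff ?mul1r // gt_eqF. Qed.
Let xy : x <= y. Proof. by rewrite lef_pV2 ?posrE // ler_nat. Qed.
Let y1 : y <= 1. Proof. by rewrite invf_le1 ?ler1n. Qed.
Let x_le (v z : nat) (i : nat) : (K ^ i * v <= z)%N -> v%:R <= z%:R * x ^+ i.
Proof.
by move=> h; rewrite /x exprVn ler_pdivlMr ?exprn_gt0 // -natrX -natrM ler_nat mulnC.
Qed.

Let H_le : H%:R <= N0%:R * x ^+ 2 :> R. Proof. exact: x_le. Qed.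
Let V_le : V%:R <= N0%:R * x ^+ 2 :> R.
Proof.
apply: (le_trans (x_le (_ : K ^ 6 * V <= N0)%N)); first by rewrite mulnC leq_trunc_div.
have x1 : x <= 1 := le_trans xy y1.
by rewrite ler_wpM2l // ler_wiXn2l // ltW.
Qed.
Let U0_le : U0%:R <= 2 * N0%:R * x :> R.
Proof.
have := x_le (_ : K ^ 1 * U0 <= 2 * N0)%N; rewrite natrM expr1; apply.
rewrite expn1 /U0 mulnS [(K * (N0 %/ K))%N]mulnC.
have h1 := leq_trunc_div N0 K.
have h2 : (K <= N0)%N by rewrite (leq_trans _ hN410) // -{1}(expn1 K) Kpow.
by move: h1 h2; move: (N0 %/ K * K)%N; clear; lia.
Qed.

(** A range of length [O(u + a0)] for small [u], where [e0] in [solution_range] may exceed [u]. *)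
Lemma coarse_range (N u j : nat) (m l : int) : (0 < u)%N -> (j < N - u)%N ->
  l \in Lseq a b alpha u -> u%:Z * j.+1%:Z = l + m * N%:Z ->
  - (2 * a0)%:Z <= m <= u%:Z + (2 * a0)%:Z.
Proof.
move=> u0 jN; rewrite mem_Lseq // => /andP[l1 l2] jE.
have ha := a_ge; have hb := b_le.
have : `|alpha * u%:R| <= a0%:R * u%:R by rewrite normrM normr_nat ler_wpM2r.
rewrite ler_norml => /andP[au1 au2].
have jE' : u%:R * (j%:R + 1) = l%:~R + m%:~R * N%:R :> R.
  by rewrite natr1 !pmulrn -!intrM -intrD jE.
have j1 : 0 <= j%:R :> R by [].
have j2 : j%:R + 1 <= N%:R - u%:R :> R.
  by rewrite lerBrDr natr1 -natrD ler_nat; move: jN; clear; lia.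
have u1 : 1 <= u%:R :> R by rewrite ler1n.
have Ngt0 : 0 < N%:R :> R by lra.
have uN : u%:R <= N%:R :> R by lra.
have a00 : 0 <= a0%:R :> R by [].
have a0u : a0%:R <= a0%:R * u%:R :> R by rewrite ler_peMr.
have a0N : a0%:R * u%:R <= a0%:R * N%:R :> R by rewrite ler_wpM2l.
have uj1 : u%:R <= u%:R * (j%:R + 1) :> R by rewrite ler_peMr // lerDr.
have uj2 : u%:R * (j%:R + 1) <= u%:R * (N%:R - u%:R) :> R by rewrite ler_wpM2l.
have uu : 0 <= u%:R ^+ 2 :> R by rewrite exprn_ge0.
have lo_m : - (2 * a0%:R) <= m%:~R :> R by rewrite -(ler_pM2r Ngt0); lra.
have hi_m : m%:~R <= u%:R + 2 * a0%:R :> R by rewrite -(ler_pM2r Ngt0); lra.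
by rewrite -!(ler_int R) !intrD !intrN -!pmulrn natrM lo_m hi_m.
Qed.

Let Lseq_size_le u : (size (Lseq a b alpha u) <= 2 * a0 + 1)%N.
Proof.
rewrite -(ler_nat R); apply: le_trans (Lseq_size alpha u ab) _.
by have ha := a_ge; have hb := b_le; rewrite natrD natrM; lra.
Qed.

(** The loss is [tau u <= K1], and about [N0 / K] values of [u] are treated in this way. As
    [K = K1 ^ 2], a saving [1 / K1] remains, which is the final one. *)
Let small_u (u : nat) : (0 < u < 2 * N0)%N ->
  (\sum_(i < H) ccount a b alpha (N0 + i) u <= (2 * a0 + 1) * ((4 * a0 + 3) * (K1 * (2 * H))))%N.
Proof.
move=> uU; have /andP[u0 _] := uU; set n := (u + 4 * a0 + 1)%N.
apply: (@leq_trans (\sum_(l <- Lseq a b alpha u) box_count (- (2 * a0)%:Z)%R n N0%:Z H u l)%N).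
  rewrite /box_count; under [leqRHS]eq_bigr => l _ do rewrite exchange_big /=.
  rewrite [leqRHS]exchange_big /=; apply: leq_sum => i _.
  apply: leq_trans (ccount_le (x := - (2 * a0)%:Z) (n := n) u0 _) _.
    by move=> m l j jN ll jE; have := coarse_range u0 jN ll jE; rewrite /n; clear; lia.
  by apply: leq_sum => l _; apply: leq_sum => k _; rewrite PoszD.
apply: (@leq_trans (\sum_(l <- Lseq a b alpha u) (4 * a0 + 3) * (K1 * (2 * H)))%N); last first.
  by rewrite big_const_seq count_predT iter_addn_0 mulnC leq_mul2r Lseq_size_le orbT.
rewrite big_seq [leqRHS]big_seq; apply: leq_sum => l ll.
apply: leq_trans (box_count_trivial _ _ _ _ _ u0) _.
apply: leq_mul; last by rewrite leq_mul ?htau // mul2n -addnn leq_add2l hgcd.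
rewrite addnS ltnS; apply: (@leq_trans ((u * (4 * a0 + 2)) %/ u)); last by rewrite mulKn.
by apply: leq_div2r; rewrite /n; move: u0; clear; nia.
Qed.

Definition all_count : nat := \sum_(i < H) \sum_(1 <= u < M) ccount a b alpha (N0 + i) u.
Definition all_tri : R := \sum_(i < H) \sum_(1 <= u < M) tri R (N0 + i) u.

(** The weight may be frozen at the corner of the block, since [V] and [H] are at most
    [N0 * x ^ 2]. *)
Let block_tri (k : 'I_nb) :
  `|H%:R * V%:R * tri R N0 (U0 + k * V)
    - \sum_(U0 + k * V <= u < U0 + k * V + V) \sum_(i < H) tri R (N0 + i) u|
   <= H%:R * V%:R * (3 * x ^+ 2).
Proof.
set U := (U0 + k * V)%N.
have UM : (U + V <= 2 * N0)%N.
  apply: leq_trans M_le; rewrite /M /U -addnA leq_add2l addnC -mulSn leq_mul2r.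
  by rewrite ltn_ord orbT.
have e1 (z : R) : H%:R * V%:R * z = \sum_(U <= u < U + V) \sum_(i < H) z.
  rewrite sumr_const_nat addKn sumr_const card_ord -mulrnA.
  by rewrite -[RHS]mulr_natl natrM.
rewrite !e1 -sumrB; apply: le_trans (ler_norm_sum _ _ _) _.
rewrite big_nat_cond [leRHS]big_nat_cond; apply: ler_sum => u /andP[/andP[uU uV] _].
rewrite -sumrB; apply: le_trans (ler_norm_sum _ _ _) _; apply: ler_sum => i _.
have N0N : N0%:R <= (N0 + i)%:R :> R by rewrite ler_nat leq_addr.
have NH : (N0 + i)%:R <= N0%:R + H%:R :> R by rewrite -natrD ler_nat leq_add2l ltnW.
have n00 := N00'; have N1 : 0 < (N0 + i)%:R :> R by lra.
apply: tri_dist => //; first by rewrite addn_gt0 N00.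
have u1 : U%:R <= u%:R :> R by rewrite ler_nat.
have u2 : u%:R <= U%:R + V%:R :> R by rewrite -natrD ler_nat ltnW.
have U2 : U%:R <= 2 * N0%:R :> R by rewrite -natrM ler_nat (leq_trans _ UM) // leq_addr.
have hV := V_le; have hH' := H_le.
have xx : 0 < x ^+ 2 by rewrite exprn_gt0.
set N : R := (N0 + i)%:R in N0N NH N1 *.
have U00 : 0 <= U%:R :> R by [].
rewrite ler_distl; apply/andP; split.
  rewrite lerBlDr; apply: (@le_trans _ _ (U%:R / N0%:R + x ^+ 2)); last by lra.
  rewrite ler_pdivrMr // mulrDl; apply: (@le_trans _ _ (U%:R + N0%:R * x ^+ 2)); first by lra.
  apply: lerD; last by rewrite mulrC ler_wpM2l // ltW.
  by rewrite mulrAC ler_pdivlMr // ler_wpM2l.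
apply: (@le_trans _ _ (U%:R / N + 3 * x ^+ 2)); last by rewrite lerD2r ler_pM2r ?invr_gt0.
rewrite ler_pdivrMr // mulrDl mulrAC.
have : U%:R * (N - N0%:R) / N <= 2 * N0%:R * x ^+ 2.
  rewrite ler_pdivrMr //; apply: (@le_trans _ _ ((2 * N0%:R) * (N0%:R * x ^+ 2))).
    by apply: ler_pM => //; lra.
  rewrite -[leRHS]mulrA ler_wpM2l ?mulr_ge0 //.
  by rewrite mulrC ler_wpM2l // ltW.
have : 0 <= N0%:R * x ^+ 2 by rewrite mulr_ge0 // ltW.
rewrite (_ : U%:R * (N - N0%:R) / N = U%:R - U%:R * N0%:R / N); last first.
  by rewrite mulrBr mulrBl mulfK // gt_eqF.
by lra.
Qed.

Let c0 : 0 <= c. Proof. by rewrite subr_ge0. Qed.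
Let c_le : c <= 2 * a0%:R.
Proof. by have ha := a_ge; have hb := b_le; rewrite /c; lra. Qed.

Lemma all_countE : all_count = (\sum_(1 <= u < U0) \sum_(i < H) ccount a b alpha (N0 + i) u
    + \sum_(k < nb) block_count a b alpha N0 H (U0 + k * V) V)%N.
Proof.
rewrite /all_count exchange_big /= (@big_cat_nat _ _ _ U0) //= ?leq_addr //; congr (_ + _)%N.
rewrite sum_blocks; apply: eq_bigr => k _.
by rewrite /block_count exchange_big.
Qed.

Lemma all_triE : all_tri = \sum_(1 <= u < U0) \sum_(i < H) tri R (N0 + i) u
    + \sum_(k < nb) \sum_(U0 + k * V <= u < U0 + k * V + V) \sum_(i < H) tri R (N0 + i) u.
Proof.
rewrite /all_tri exchange_big /= (@big_cat_nat _ _ _ U0) //= ?leq_addr //; congr (_ + _)%R.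
by rewrite sum_blocks.
Qed.

Let U0_le2 : (U0 <= 2 * N0)%N.
Proof. by rewrite (leq_trans _ M_le) // leq_addr. Qed.

Let small_count : (\sum_(1 <= u < U0) \sum_(i < H) ccount a b alpha (N0 + i) u)%:R
  <= 4 * ((2 * a0%:R + 1) * (4 * a0%:R + 3)) * (N0%:R * H%:R * y) :> R.
Proof.
apply: (@le_trans _ _ (U0 * ((2 * a0 + 1) * ((4 * a0 + 3) * (K1 * (2 * H)))))%:R).
  rewrite ler_nat; apply: (@leq_trans (\sum_(1 <= u < U0) (2 * a0 + 1) * ((4 * a0 + 3) * (K1 * (2 * H))))%N).
    rewrite big_nat_cond [leqRHS]big_nat_cond; apply: leq_sum => u /andP[/andP[u1 u2] _].
    by apply: small_u; rewrite u1 (leq_trans u2).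
  by rewrite sum_nat_const_nat leq_mul2r subn1 leq_pred orbT.
rewrite !(natrM, natrD).
have h : U0%:R * K1%:R <= 2 * N0%:R * y :> R.
  by rewrite -K1x [K1%:R * x]mulrC mulrA ler_wpM2r.
have g : 0 <= (2 * a0%:R + 1) * (4 * a0%:R + 3) * (2 * H%:R) :> R.
  by rewrite !mulr_ge0 // addr_ge0 // mulr_ge0.
by have := ler_wpM2l g h; lra.
Qed.

Let small_tri : \sum_(1 <= u < U0) \sum_(i < H) tri R (N0 + i) u <= 2 * (N0%:R * H%:R * y).
Proof.
apply: (@le_trans _ _ (\sum_(1 <= u < U0) H%:R)).
  apply: ler_sum => u _; apply: le_trans (ler_sum _ (fun i _ => tri_le1 _ _ _)) _.
  by rewrite sumr_const card_ord.
rewrite sumr_const_nat -[leLHS]mulr_natl.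
apply: (@le_trans _ _ (U0%:R * H%:R)); first by rewrite ler_wpM2r // ler_nat leq_subr.
apply: (@le_trans _ _ (2 * N0%:R * y * H%:R)); last by lra.
rewrite ler_wpM2r //; apply: le_trans U0_le _; rewrite ler_wpM2l // mulr_ge0 //.
Qed.

Let small_tri0 : 0 <= \sum_(1 <= u < U0) \sum_(i < H) tri R (N0 + i) u.
Proof. by do 2!(apply: sumr_ge0 => ? _); exact: tri_ge0. Qed.

Let nbV : nb%:R * V%:R <= 2 * N0%:R :> R.
Proof. by rewrite -!natrM ler_nat (leq_trans _ M_le) // leq_addl. Qed.

Let large_part : `|(\sum_(k < nb) block_count a b alpha N0 H (U0 + k * V) V)%N%:R
   - c * \sum_(k < nb) \sum_(U0 + k * V <= u < U0 + k * V + V) \sum_(i < H) tri R (N0 + i) u|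
  <= N0%:R * H%:R * y * (2 * (100 * (c + 2) + 3 * c) + 360 * (c + 1)).
Proof.
have x_1 : x <= 1 := le_trans xy y1.
rewrite natr_sum mulr_sumr -sumrB; apply: le_trans (ler_norm_sum _ _ _) _.
apply: (@le_trans _ _ (\sum_(k < nb) (H%:R * V%:R * (100 * (c + 2) + 3 * c) * x
    + 180 * K%:R ^+ 9 * H%:R * (nbad k)%:R))).
  apply: ler_sum => k _.
  set bc := (block_count _ _ _ _ _ _ _)%:R; set bt := \sum_(_ <= u < _) _.
  have h1 := block_k k; have h2 := block_tri k; rewrite -/bt in h2; rewrite -/bc -/c in h1.
  set z := H%:R * V%:R * tri R N0 (U0 + k * V) in h2.
  have -> : bc - c * bt = (bc - c * z) + c * (z - bt) by ring.
  apply: le_trans (ler_normD _ _) _.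
  rewrite normrM (ger0_norm c0).
  have h3 := ler_wpM2l c0 h2.
  have xx : x ^+ 2 <= x by rewrite -[leRHS]expr1 ler_wiXn2l // ltW.
  have h4 : 3 * c * (H%:R * V%:R) * x ^+ 2 <= 3 * c * (H%:R * V%:R) * x.
    by rewrite ler_wpM2l // !mulr_ge0.
  have e : c * z = H%:R * V%:R * c * tri R N0 (U0 + k * V) by rewrite /z; ring.
  rewrite e; move: h1 h3 h4; move: (K%:R ^+ 9) (x ^+ 2) => p q; lra.
rewrite big_split /= sumr_const card_ord -[X in X + _]mulr_natl -mulr_sumr.
have h := sum_nbad.
have hz : N0%:R * H%:R * x <= N0%:R * H%:R * y by apply: (ler_wpM2l _ xy); rewrite mulr_ge0.
(* The threshold [K ^ 11] exceeds the losses [K ^ 9] and [K] by one factor [K]. *)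
have t1 : 180 * K%:R ^+ 9 * H%:R * (\sum_(k < nb) (nbad k)%:R) <= 360 * (c + 1) * (N0%:R * H%:R * y).
  apply: (@le_trans _ _ (180 * K%:R ^+ 9 * H%:R * (2 * N0%:R * K%:R * ((c + 1) / K%:R ^+ 11)))).
    by rewrite ler_wpM2l // !mulr_ge0 ?exprn_ge0.
  apply: (@le_trans _ _ (360 * (c + 1) * (N0%:R * H%:R * x))).
    apply: le_of_eq; rewrite -exprVn -/x (exprS x 10) (exprS x 9).
    rewrite [LHS](_ : _ = 360 * (c + 1) * (N0%:R * H%:R * x) * (K%:R ^+ 9 * x ^+ 9) * (K%:R * x)).
      by rewrite -exprMn Kx expr1n !mulr1.
    by move: (K%:R ^+ 9) (x ^+ 9) => u w; ring.
  by apply: (ler_wpM2l _ hz); have := c0; lra.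
have t2 : nb%:R * (H%:R * V%:R * (100 * (c + 2) + 3 * c) * x)
   <= 2 * (100 * (c + 2) + 3 * c) * (N0%:R * H%:R * y).
  have cc : 0 <= 100 * (c + 2) + 3 * c by have := c0; lra.
  apply: (@le_trans _ _ ((2 * N0%:R) * (H%:R * (100 * (c + 2) + 3 * c) * x))).
    rewrite [leLHS](_ : _ = (nb%:R * V%:R) * (H%:R * (100 * (c + 2) + 3 * c) * x)); last by ring.
    by rewrite ler_wpM2r // !mulr_ge0 // ltW.
  rewrite [leLHS](_ : _ = 2 * (100 * (c + 2) + 3 * c) * (N0%:R * H%:R * x)); last by ring.
  by apply: (ler_wpM2l _ hz); rewrite mulr_ge0.
by lra.
Qed.

Lemma all_count_tri : `|all_count%:R - c * all_tri| <= 2000 * (a0%:R + 1) ^+ 2 * (N0%:R * H%:R * y).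
Proof.
rewrite all_countE all_triE natrD mulrDr.
have h1 := small_count; have h2 := small_tri; have h20 := small_tri0; have h3 := large_part.
set SC := (\sum_(1 <= u < U0) _)%N%:R in h1 *; set ST := \sum_(1 <= u < U0) _ in h2 h20 *.
set LC := (\sum_(k < nb) _)%N%:R in h3 *; set LT := \sum_(k < nb) _ in h3 *.
have SC0 : 0 <= SC by rewrite ler0n.
have z0 : 0 <= N0%:R * H%:R * y by rewrite !mulr_ge0 // ltW.
set z := N0%:R * H%:R * y in h1 h2 h3 z0 *.
have cl := c_le; have c00 := c0.
have cST : c * ST <= 4 * a0%:R * z.
  by apply: le_trans (ler_pM c00 h20 cl h2) _; lra.
have cST0 : 0 <= c * ST by rewrite mulr_ge0.
have L : z * (2 * (100 * (c + 2) + 3 * c) + 360 * (c + 1)) <= z * (1132 * a0%:R + 760).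
  by rewrite ler_wpM2l //; lra.
have a00 : 0 <= a0%:R :> R by [].
have az : 0 <= a0%:R * z by rewrite mulr_ge0.
have aaz : 0 <= a0%:R ^+ 2 * z by rewrite mulr_ge0 // exprn_ge0.
move: h3; rewrite !ler_distl => /andP[h31 h32].
by apply/andP; split; lra.
Qed.

Lemma all_count_cplus : all_count = (\sum_(i < H) cplus a b alpha (N0 + i))%N.
Proof.
apply: eq_bigr => i _; rewrite /cplus (@big_cat_nat _ _ _ (N0 + i)) ?addn_gt0 ?N00 //=; last first.
  by rewrite (leq_trans _ (ltnW M_gt)) // leq_add2l ltnW.
rewrite [X in (_ + X)%N]big_nat_cond [X in (_ + X)%N]big1 ?addn0 // => u /andP[/andP[h _] _].
by rewrite /ccount; move: h; rewrite -subn_eq0 => /eqP ->; rewrite big_ord0.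
Qed.

Let N0y : 1 <= N0%:R * y.
Proof. by rewrite ler_pdivlMr // mul1r ler_nat (leq_trans K1_le) // (leq_trans _ hN410) // -{1}(expn1 K) Kpow. Qed.

Let all_tri_bounds : H%:R * (N0%:R - 1) / 2 <= all_tri <= H%:R * (N0%:R + H%:R) / 2.
Proof.
have e : all_tri = \sum_(i < H) ((N0 + i)%:R - 1) / 2.
  apply: eq_bigr => i _; apply: sum_tri; first by rewrite addn_gt0 N00.
  by rewrite (leq_trans _ (ltnW M_gt)) // leq_add2l ltnW.
have k (z : R) : H%:R * z = \sum_(i < H) z by rewrite sumr_const card_ord -[RHS]mulr_natl.
rewrite e -!mulrA !k; apply/andP; split; apply: ler_sum => i _.
  by rewrite natrD ler_pM2r ?invr_gt0 // lerD2r lerDl.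
have : i%:R <= H%:R :> R by rewrite ler_nat ltnW.
by rewrite natrD; lra.
Qed.

(** Dividing each count by its own [N] instead of [N0] or [N0 + H] is a relative change of at most
    [1 / K ^ 2], and the triangle weights sum to about [N0 / 2] for each [N]. *)
Lemma cplus_block_average :
  `|\sum_(i < H) (cplus a b alpha (N0 + i))%:R / (N0 + i)%:R - H%:R * (b - a) / 2|
  <= 3000 * (a0%:R + 1) ^+ 2 * (H%:R * y).
Proof.
rewrite -/c; set S := \sum_(i < H) _.
have CE : all_count%:R = \sum_(i < H) (cplus a b alpha (N0 + i))%:R :> R.
  by rewrite all_count_cplus natr_sum.
have S1 : S * N0%:R <= all_count%:R.
  rewrite CE mulr_suml; apply: ler_sum => i _.
  have N1 : 0 < (N0 + i)%:R :> R by rewrite ltr0n addn_gt0 N00.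
  by rewrite mulrAC ler_pdivrMr // ler_wpM2l // ler_nat leq_addr.
have S2 : all_count%:R <= S * (N0%:R + H%:R).
  rewrite CE mulr_suml; apply: ler_sum => i _.
  have N1 : 0 < (N0 + i)%:R :> R by rewrite ltr0n addn_gt0 N00.
  by rewrite mulrAC ler_pdivlMr // ler_wpM2l // -natrD ler_nat leq_add2l ltnW.
have := all_count_tri; rewrite ler_distl => /andP[t1 t2].
have /andP[b1 b2] := all_tri_bounds.
have cl := c_le; have c00 := c0; have n00 := N00'; have ny := N0y.
have Hy : H%:R <= N0%:R * y.
  apply: le_trans H_le _; rewrite ler_wpM2l // (le_trans _ xy) // -[leRHS]expr1 ler_wiXn2l //.
    exact: ltW.
  exact: le_trans xy y1.
have cb1 := ler_wpM2l c00 b1; have cb2 := ler_wpM2l c00 b2.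
have H0 : 0 <= H%:R :> R by [].
have a00 : 0 <= a0%:R :> R by [].
have yy := ltW y0.
have z0 : 0 <= H%:R * y by rewrite mulr_ge0.
have z1 : 0 <= N0%:R * (H%:R * y) by rewrite mulr_ge0.
have zz : c * (H%:R * H%:R) <= 2 * a0%:R * (N0%:R * (H%:R * y)).
  by apply: ler_pM => //; rewrite [leRHS]mulrCA ler_wpM2l.
have zz1 : c * H%:R <= 2 * a0%:R * (N0%:R * (H%:R * y)).
  by apply: ler_pM => //; rewrite mulrCA ler_peMr.
have az : 0 <= a0%:R * (N0%:R * (H%:R * y)) by rewrite mulr_ge0.
have aaz : 0 <= a0%:R ^+ 2 * (N0%:R * (H%:R * y)) by rewrite mulr_ge0 // exprn_ge0.
set T := N0%:R * (H%:R * y) in z1 zz zz1 az aaz.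
have NT : N0%:R * H%:R * y = T by rewrite /T mulrA.
rewrite NT in t1 t2.
rewrite ler_distl; apply/andP; split.
  have NH : 0 < N0%:R + H%:R :> R by lra.
  rewrite -(ler_pM2r NH).
  have g : 0 <= 3000 * (a0%:R + 1) ^+ 2 * (H%:R * y) * H%:R :> R.
    apply: mulr_ge0 H0; apply: mulr_ge0 z0; apply: mulr_ge0; first by rewrite ler0n.
    exact: sqr_ge0.
  have e : (H%:R * c / 2 - 3000 * (a0%:R + 1) ^+ 2 * (H%:R * y)) * (N0%:R + H%:R)
    = c * (H%:R * N0%:R) / 2 + c * (H%:R * H%:R) / 2 - 3000 * (a0%:R + 1) ^+ 2 * T
      - 3000 * (a0%:R + 1) ^+ 2 * (H%:R * y) * H%:R by rewrite /T; ring.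
  rewrite e; apply: le_trans S2; move: t1 cb1 zz zz1 z1 az aaz g; lra.
rewrite -(ler_pM2r n00); move: (le_trans S1 t2) cb2 zz z1 az aaz; rewrite /T; lra.
Qed.

End block_sums.

(** * Choice of the parameters *)

Section eventually.
Variable R : realType.
Implicit Types (a b alpha C kappa eta M : R).

Lemma powR_eventually (c e1 e2 : R) : e1 < e2 ->
  \forall M \near +oo_R, c * M `^ e1 <= M `^ e2.
Proof.
move=> e12; have d0 : 0 < e2 - e1 by rewrite subr_gt0.
near=> M.
have M0 : 0 < M by near: M; exact: nbhs_pinfty_gt.
have Mn0 : M != 0 by rewrite gt_eqF.
rewrite -{1}(subrK e1 e2) powRD ?Mn0 ?implybT // ler_wpM2r ?powR_ge0 //.
have h : Num.max c 1 `^ (e2 - e1)^-1 <= M by near: M; exact: nbhs_pinfty_ge.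
have c1 : 0 <= Num.max c 1 by rewrite le_max ler01 orbT.
apply: (@le_trans _ _ (Num.max c 1)); first by rewrite le_max lexx.
have := ge0_ler_powR (ltW d0) _ _ h; rewrite !nnegrE powR_ge0 (ltW M0) => /(_ isT isT).
by rewrite -powRrM mulVf ?gt_eqF // powRr1.
Unshelve. all: by end_near.
Qed.

Lemma powR_eventually_ge (c e : R) : 0 < e -> \forall M \near +oo_R, c <= M `^ e.
Proof.
move=> e0; near=> M.
by rewrite -[leLHS]mulr1 -[X in c * X](powRr0 M); near: M; exact: powR_eventually.
Unshelve. all: by end_near.
Qed.

(** With [u = v * d] and [l = m * d], dividing [l + u^2 / 2 - alpha * u = O(a0)] by [u] puts
    [(2 * m + d * v^2) / (2 * v)] within [a0 / u] of [alpha]. A large [d] makes the denominator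
    [2 * v] too small for the Diophantine condition. *)
Lemma Lseq_gcd_bound a b alpha C kappa (a0 u : nat) (l : int) :
  a <= b -> - a0%:R <= a -> b <= a0%:R ->
  (forall (p : int) (q : nat), (0 < q)%N -> C / q%:R `^ kappa < `|alpha - p%:~R / q%:R|) ->
  (0 < u)%N -> l \in Lseq a b alpha u ->
  C * (gcdn `|l| u)%:R `^ kappa * u%:R <= a0%:R * (2 * u)%:R `^ kappa.
Proof.
move=> ab ha hb hC u0; rewrite mem_Lseq // => /andP[l1 l2].
set d := gcdn `|l| u.
have d0 : (0 < d)%N by rewrite gcdn_gt0 u0 orbT.
have [v uE] : exists v, (u = v * d)%N by apply/dvdnP; exact: dvdn_gcdr.
have [m lE] : exists m : int, l = m * d%:Z.
  by apply/dvdzP; rewrite dvdzE /= dvdn_gcdl.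
have v0 : (0 < v)%N by move: u0; rewrite uE muln_gt0 => /andP[].
have v2 : (0 < 2 * v)%N by rewrite muln_gt0.
have := hC (m *+ 2 + (d * v ^ 2)%:Z) (2 * v)%N v2.
have u0' : 0 < u%:R :> R by rewrite ltr0n.
have v0' : 0 < v%:R :> R by rewrite ltr0n.
have d0' : 0 < d%:R :> R by rewrite ltr0n.
have uE' : u%:R = v%:R * d%:R :> R by rewrite uE natrM.
have lE' : l%:~R = m%:~R * d%:R :> R by rewrite lE intrM.
have e : alpha - (m *+ 2 + (d * v ^ 2)%:Z)%:~R / (2 * v)%:R
    = - ((l%:~R + u%:R ^+ 2 / 2 - alpha * u%:R) / u%:R).
  have m2 : (m *+ 2)%:~R = 2 * m%:~R :> R by rewrite mulr2n intrD; ring.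
  rewrite intrD -pmulrn natrM natrM natrX m2 lE' uE'; field.
  by rewrite !gt_eqF.
rewrite e normrN normrM (gtr0_norm (_ : 0 < u%:R^-1)) ?invr_gt0 //.
set z := `|_ - _|; have zl : z <= a0%:R by rewrite ler_norml; apply/andP; split; lra.
move=> h; have q0 : 0 < (2 * v)%:R `^ kappa :> R by rewrite powR_gt0 // ltr0n.
have h2 : C / (2 * v)%:R `^ kappa < a0%:R / u%:R.
  by apply: lt_le_trans h _; rewrite ler_pM2r ?invr_gt0.
have h3 : C * u%:R <= a0%:R * (2 * v)%:R `^ kappa.
  by move: h2; rewrite ltr_pdivrMr // mulrAC ltr_pdivlMr // => /ltW.
rewrite (_ : (2 * u)%:R = (2 * v)%:R * d%:R :> R); last by rewrite -natrM uE mulnA.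
by rewrite powRM // mulrA mulrAC ler_wpM2r // powR_ge0.
Qed.

Lemma diophantine_natpow alpha C kappa (k : nat) : kappa <= k%:R -> 0 < C ->
  (forall (p : int) (q : nat), (0 < q)%N -> C / q%:R `^ kappa < `|alpha - p%:~R / q%:R|) ->
  forall (q : nat) (p : int), (0 < q)%N -> C < q%:R ^+ k * `|q%:R * alpha - p%:~R|.
Proof.
move=> hk C0 hC q p q0; have q0' : 0 < q%:R :> R by rewrite ltr0n.
have q1 : 1 <= q%:R :> R by rewrite ler1n.
have qk : q%:R `^ kappa <= q%:R ^+ k by rewrite -powR_mulrn // ler_powR.
have qk0 : 0 < q%:R `^ kappa :> R by rewrite powR_gt0.
have := hC p q q0; rewrite ltr_pdivrMr // => h.
have e : `|q%:R * alpha - p%:~R| = q%:R * `|alpha - p%:~R / q%:R|.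
  by rewrite -{2}(gtr0_norm q0') -normrM; congr (`|_|); field; rewrite gt_eqF.
rewrite e; apply: lt_le_trans h _; rewrite mulrC; by apply: ler_pM => //; rewrite ?(ltW qk0) // ler_peMl.
Qed.

End eventually.

Section diophantine_parameters.
Variable R : realType.
Variables (kappa eta alpha C : R) (a0 k : nat).
Hypotheses (kappa2 : 2 <= kappa) (kappa_k : kappa <= k%:R) (eta17 : 17 / 18 < eta)
  (eta_kappa : 1 - 2 / (9 * kappa) < eta) (eta1 : eta <= 1) (C0 : 0 < C)
  (hC : forall (p : int) (q : nat), (0 < q)%N -> C / q%:R `^ kappa < `|alpha - p%:~R / q%:R|)
  (alpha_le : `|alpha| <= a0%:R).

(** Up to rounding [K1 = M^sigma] and [H = M^theta], so that [K ^ 2 * H = M^eta]; [B] is the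
    exponent of [residue_equidistribution] for [A = 400]. [D] is quadratic in [k] because
    [sigma * B * kappa] has to be small. *)
Let D := ((100 * k.+1) ^ 2)%N.
Let sigma : R := D%:R^-1.
Let theta : R := eta - 4 * sigma.
Let B := (402 * k + 404)%N.

Let D0 : 0 < D%:R :> R. Proof. by rewrite ltr0n. Qed.
Let s0 : 0 < sigma. Proof. by rewrite invr_gt0. Qed.
Let k2 : 2 <= k%:R :> R. Proof. exact: le_trans kappa2 kappa_k. Qed.
Let DE : D%:R = (100 * (k%:R + 1)) ^+ 2 :> R. Proof. by rewrite natrX natrM natr1. Qed.
Let BE : (2 * (B + 510))%:R = 804 * k%:R + 1828 :> R.
Proof. by rewrite -natrM -natrD /B; congr (_%:R); clear; lia. Qed.
Let B1E : (2 * B.+1)%:R = 804 * k%:R + 810 :> R.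
Proof. by rewrite -natrM -natrD /B; congr (_%:R); clear; lia. Qed.
Let kappa0 : 0 < kappa. Proof. by apply: lt_le_trans kappa2. Qed.

Let s_le : sigma * 1000 <= 1.
Proof.
rewrite /sigma ler_pdivrMl // mulr1 DE; have h := k2.
by have : 0 <= (k%:R - 2) ^+ 2 :> R := sqr_ge0 _; lra.
Qed.

Let sk_le : sigma * (k%:R + 1) ^+ 2 = (100 ^+ 2)^-1.
Proof.
have h : (k%:R + 1) ^+ 2 != 0 :> R by rewrite natr1 expf_neq0 // pnatr_eq0.
by rewrite /sigma DE exprMn invfM -mulrA mulVf ?mulr1.
Qed.

(** For [K ^ (B + 510) <= N0]. *)
Let exponent1 : sigma * (2 * (B + 510))%:R <= 1.
Proof.
rewrite ler_pdivrMl // mulr1 DE BE; have h := k2.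
by have : 0 <= k%:R ^+ 2 :> R := sqr_ge0 _; lra.
Qed.

(** For [N0 ^ 3 * K ^ 200 <= H ^ 4]. *)
Let exponent2 : 3 + sigma * 400%:R < theta * 4.
Proof. by have h1 := s_le; have h2 := eta17; rewrite /theta; lra. Qed.

(** For common divisors, of order [M^(1 - 1 / kappa)], to be at most [H]. *)
Let exponent3 : kappa - 1 < theta * kappa.
Proof.
have h1 : kappa - 2 / 9 < eta * kappa.
  have := eta_kappa; rewrite -(ltr_pM2r kappa0).
  by rewrite (_ : (1 - 2 / (9 * kappa)) * kappa = kappa - 2 / 9) //; field; rewrite gt_eqF.
have h2 : sigma * kappa <= (100 ^+ 2)^-1.
  rewrite -sk_le ler_wpM2l ?(ltW s0) //; have h := k2; have h' := kappa_k.
  by have : 0 <= k%:R ^+ 2 :> R := sqr_ge0 _; lra.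
by rewrite /theta; lra.
Qed.

(** For common divisors to be at most [N0 / K ^ B.+1]. *)
Let exponent4 : kappa - 1 < (1 - sigma * (2 * B.+1)%:R) * kappa.
Proof.
have h2 : sigma * (2 * B.+1)%:R * kappa <= sigma * (810 * (k%:R + 1) ^+ 2).
  rewrite -mulrA ler_wpM2l ?(ltW s0) // B1E; have h := k2; have h' := kappa_k.
  have : (804 * k%:R + 810) * kappa <= (804 * k%:R + 810) * k%:R.
    by apply: (ler_wpM2l _ h'); lra.
  by have : 0 <= k%:R ^+ 2 :> R := sqr_ge0 _; lra.
by have h := sk_le; rewrite mulrBl mul1r; lra.
Qed.

Let powR_nat (M : R) (n : nat) (e : R) : (M `^ e) ^+ n = M `^ (e * n%:R).
Proof. by rewrite powRrM powR_mulrn // powR_ge0. Qed.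

(** Uniform in [a] and [b], whose values will depend on [M], and in [N0] up to [3 * M], which covers
    every block starting in the averaging window. *)
Lemma block_average_eventually : \forall M \near +oo_R, forall a b : R,
  a <= b -> - a0%:R <= a -> b <= a0%:R -> forall N0 : nat, M <= N0%:R <= 3 * M ->
  `|\sum_(i < Num.truncn (M `^ theta)) (cplus a b alpha (N0 + i))%:R / (N0 + i)%:R
     - (Num.truncn (M `^ theta))%:R * (b - a) / 2|
  <= 2 * 3000 * (a0%:R + 1) ^+ 2 * ((Num.truncn (M `^ theta))%:R * M `^ (- sigma)).
Proof.
have lin6 (u n M : R) : u < 2 * n -> n <= 3 * M -> u <= 6 * M by move=> *; lra.
have lin2 (u n : R) : u < n + 1 -> 1 <= n -> u <= 2 * n by move=> *; lra.
have lin27 (p q h z : R) : z <= 27 * p -> (27 * 16) * p <= q -> q <= 16 * h -> z <= h.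
  by move=> *; lra.
have lin_eta (e z : R) : e <= 1 -> z * (2 * 2)%:R + (e - 4 * z) <= 1 by move=> *; lra.
have lin12 (p q w z : R) : 0 <= z * (p * q) -> z * w <= z * (p * q) -> 2 * z * w <= z * (12 * p) * q.
  by move=> *; lra.
have [K0 equi] := residue_equidistribution 400 C0 (diophantine_natpow kappa_k C0 hC).
have [Ct Ct0 hCt] := tau_bound (2 * D).
have s01 : 0 < sigma by [].
have th0 : 0 < theta by have h1 := s_le; have h2 := eta17; rewrite /theta; lra.
near=> M => a b ab a_ge b_le N0 /andP[N0_ge N0_le].
have M1 : 1 <= M by near: M; exact: nbhs_pinfty_ge.
have M0 : 0 < M by exact: lt_le_trans M1.
set K1 := Num.truncn (M `^ sigma); set H := Num.truncn (M `^ theta).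
have pM e : 0 <= M `^ e by exact: powR_ge0.
have pM0 e : 0 < M `^ e by exact: powR_gt0.
have pMD e e' : M `^ (e + e') = M `^ e * M `^ e' by rewrite powRD // (gt_eqF M0) implybT.
have [K1_le K1_gt] : K1%:R <= M `^ sigma /\ M `^ sigma < K1%:R + 1.
  by have /andP[h1 h2] := truncn_itv (pM sigma); rewrite natr1.
have [H_le H_gt] : H%:R <= M `^ theta /\ M `^ theta < H%:R + 1.
  by have /andP[h1 h2] := truncn_itv (pM theta); rewrite natr1.
have big1 : (1000 + 100 * a0 + K0)%:R <= M `^ sigma.
  by near: M; exact: powR_eventually_ge.
have big2 : 2 <= M `^ theta.
  by near: M; exact: powR_eventually_ge.
have K1_ge : (1000 + 100 * a0 + K0 <= K1)%N by rewrite truncn_ge_nat.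
have K1K : (K1 <= K1 ^ 2)%N by move: K1_ge; clear; nia.
have Kn n : (K1 ^ 2)%:R ^+ n <= M `^ (sigma * (2 * n)%:R).
  rewrite natrX -exprM -powR_nat; apply: lerXn2r => //; rewrite nnegrE //.
have H_half : M `^ theta <= 2 * H%:R.
  by apply: lin2 => //; rewrite ler1n truncn_gt0 (le_trans _ big2) // ler1n.
have N00 : (0 < N0)%N by rewrite -(ltr0n R) (lt_le_trans M0).
have N00' : 0 < N0%:R :> R by rewrite ltr0n.
(* A common divisor above [M^e] contradicts [Lseq_gcd_bound]. As [u <= 6 * M], the base there is at
   most [12 * M]. *)
have gcd_contra (u : nat) (l : int) (e : R) : (0 < u < 2 * N0)%N -> l \in Lseq a b alpha u ->
    0 <= e -> (a0%:R * 12 `^ kappa / C) * M `^ (kappa - 1) <= M `^ (e * kappa) ->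
    (gcdn `|l| u)%:R <= M `^ e.
  move=> /andP[u0 uN] lu e0 hM; rewrite leNgt; apply/negP => he.
  have := Lseq_gcd_bound ab a_ge b_le hC u0 lu.
  have u0' : 0 < u%:R :> R by rewrite ltr0n.
  have u2 : 0 <= 2 * u%:R :> R by rewrite mulr_ge0.
  set g := (gcdn `|l| u)%:R in he *.
  have g0 : M `^ (e * kappa) < g `^ kappa.
    by rewrite powRrM; apply: gt0_ltr_powR => //; rewrite nnegrE // ler0n.
  rewrite natrM -(mulr_powRB1 u2 kappa0) => h.
  have h1 : C * g `^ kappa <= 2 * a0%:R * (2 * u%:R) `^ (kappa - 1).
    by rewrite -(ler_pM2r u0'); apply: le_trans h _; apply: le_of_eq; ring.
  have k1 : 0 <= kappa - 1 by rewrite subr_ge0 (le_trans _ kappa2) // ler1n.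
  have uM : 2 * u%:R <= 12 * M.
    have u6 : u%:R <= 6 * M by apply: (lin6 _ N0%:R) => //; rewrite -natrM ltr_nat.
    by rewrite (_ : 12 * M = 2 * (6 * M)) ?ler_wpM2l //; ring.
  have h2 : (2 * u%:R) `^ (kappa - 1) <= 12 `^ (kappa - 1) * M `^ (kappa - 1).
    by rewrite -powRM ?(ltW M0) //; apply: ge0_ler_powR => //; rewrite nnegrE mulr_ge0 // ltW.
  have h12 : 12 `^ kappa = 12 * 12 `^ (kappa - 1) :> R by rewrite mulr_powRB1.
  have h3 : C * g `^ kappa <= a0%:R * 12 `^ kappa * M `^ (kappa - 1).
    apply: le_trans h1 _; rewrite h12.
    have z0 : 0 <= a0%:R * (12 `^ (kappa - 1) * M `^ (kappa - 1)).
      by rewrite !mulr_ge0 // powR_ge0.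
    exact: lin12 z0 (ler_wpM2l (ler0n R a0) h2).
  move: h3; apply/negP; rewrite -ltNge.
  have : a0%:R * 12 `^ kappa * M `^ (kappa - 1) <= C * M `^ (e * kappa).
    rewrite [leLHS](_ : _ = C * (a0%:R * 12 `^ kappa / C * M `^ (kappa - 1))).
      by rewrite ler_pM2l.
    by move: (12 `^ kappa) (M `^ (kappa - 1)) => p q; field; rewrite gt_eqF.
  by move=> /le_lt_trans; apply; rewrite ltr_pM2l.
have hgcd (u : nat) (l : int) : (0 < u < 2 * N0)%N -> l \in Lseq a b alpha u -> (gcdn `|l| u <= H)%N.
  move=> hu lu; rewrite truncn_ge_nat //; apply: (gcd_contra _ _ _ hu lu (ltW th0)).
  by near: M; exact: (powR_eventually _ exponent3).
have hgcdK (u : nat) (l : int) : (0 < u < 2 * N0)%N -> l \in Lseq a b alpha u ->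
    (gcdn `|l| u * (K1 ^ 2) ^ B.+1 <= N0)%N.
  move=> hu lu; have e0 : 0 <= 1 - sigma * (2 * B.+1)%:R.
    by rewrite subr_ge0; apply: le_trans exponent1; rewrite ler_wpM2l ?(ltW s01) // BE B1E lerD2l ler_nat.
  rewrite -(ler_nat R); apply: (le_trans _ N0_ge).
  have h : (gcdn `|l| u)%:R <= M `^ (1 - sigma * (2 * B.+1)%:R).
    apply: (gcd_contra _ _ _ hu lu e0).
    by near: M; exact: (powR_eventually _ exponent4).
  rewrite natrM natrX; apply: le_trans (ler_pM _ _ h (Kn _)) _; rewrite ?ler0n ?exprn_ge0 //.
  by rewrite -pMD subrK powRr1 // ltW.
(* If [tau r > K1], then [tau r ^ (2 * D)] exceeds [M^2], because [sigma * (2 * D) = 2], whereas it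
   is at most [Ct * r = O(M)]. *)
have htau r : (0 < r < 2 * N0)%N -> (tau r <= K1)%N.
  move=> /andP[r0 rN]; rewrite leqNgt; apply/negP => h.
  have := hCt r r0; rewrite leqNgt => /negP; apply.
  rewrite -(ltr_nat R) natrX natrM.
  have h1 : M `^ (sigma * (2 * D)%:R) < (tau r)%:R ^+ (2 * D).
    rewrite -powR_nat ltrXn2r ?nnegrE //.
    by rewrite (lt_le_trans K1_gt) // natr1 ler_nat.
  apply: le_lt_trans h1; rewrite natrM [2%:R * _]mulrC mulrA mulVf ?mul1r ?gt_eqF //.
  have h2 : (Ct%:R * 6) * M `^ 1 <= M `^ 2%:R.
    by near: M; apply: powR_eventually; rewrite ltr1n.
  apply: le_trans h2; rewrite powRr1 ?(ltW M0) // -mulrA.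
  apply: ler_wpM2l; first by rewrite ler0n.
  by apply: (lin6 _ N0%:R) => //; rewrite -natrM ltr_nat.
have hK : (1000 + 100 * a0 <= K1 ^ 2)%N.
  by apply: leq_trans K1K; apply: leq_trans K1_ge; rewrite leq_addr.
have hN : ((K1 ^ 2) ^ (B + 510) <= N0)%N.
  rewrite -(ler_nat R) natrX; apply: le_trans (Kn _) _; apply: (le_trans _ N0_ge).
  exact: ler1_powR.
have hH : ((K1 ^ 2) ^ 2 * H <= N0)%N.
  rewrite -(ler_nat R) natrM natrX; apply: (le_trans _ N0_ge).
  apply: le_trans (ler_pM _ _ (Kn _) H_le) _; rewrite ?ler0n ?exprn_ge0 //.
  rewrite -pMD; apply: ler1_powR => //; exact: lin_eta.
have hH3 : (N0 ^ 3 * (K1 ^ 2) ^ 200 <= H ^ 4)%N.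
  rewrite -(ler_nat R) natrM !natrX.
  have h1 : N0%:R ^+ 3 <= 27 * M `^ 3 :> R.
    rewrite powR_mulrn ?(ltW M0) // (_ : 27 * M ^+ 3 = (3 * M) ^+ 3); last by ring.
    by apply: lerXn2r => //; rewrite nnegrE ltW ?mulr_gt0.
  have h2 : (27 * 16) * M `^ (3 + sigma * 400%:R) <= M `^ (theta * 4).
    by near: M; exact: (powR_eventually _ exponent2).
  have h3 : M `^ (theta * 4) <= 16 * H%:R ^+ 4.
    rewrite -powR_nat (_ : 16 * H%:R ^+ 4 = (2 * H%:R) ^+ 4); last by ring.
    by apply: lerXn2r => //; rewrite nnegrE // mulr_ge0.
  have h4 : N0%:R ^+ 3 * (K1%:R ^+ 2) ^+ 200 <= 27 * M `^ (3 + sigma * 400%:R).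
    rewrite pMD mulrA -[K1%:R ^+ 2]natrX.
    by apply: (ler_pM _ _ h1 (Kn _)); rewrite exprn_ge0.
  exact: lin27 h4 h2 h3.
have equi' (r t W : nat) : (0 < r)%N -> ((K1 ^ 2) ^ B <= W)%N -> forall lam : int,
  `|(\sum_(i < W) count (fun l => (r%:Z %| (l - lam)%R)%Z) (Lseq a b alpha (r * (t + i))))%:R
     - W%:R * ((b - a) / r%:R)| <= W%:R / (K1 ^ 2)%:R ^+ 400.
  move=> r0 hW lam; apply: equi => //.
    by rewrite (leq_trans _ K1K) // (leq_trans _ K1_ge) // leq_addl.
  apply: leq_trans hW; rewrite leq_exp2l; first by rewrite /B; clear; lia.
  by move: K1_ge; clear; nia.
apply: le_trans (cplus_block_average ab a_ge b_le alpha_le hK hN hH hH3 hgcd hgcdK htau (erefl _) equi') _.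
have K10 : 0 < K1%:R :> R by rewrite ltr0n; move: K1_ge; clear; lia.
have K1s : K1%:R^-1 <= 2 * M `^ (- sigma).
  have K1h : M `^ sigma <= 2 * K1%:R.
    by apply: lin2 => //; rewrite ler1n -(ltr0n R).
  rewrite powRN -(ler_pM2r (mulr_gt0 K10 (pM0 sigma))) mulrA mulVf ?gt_eqF // mul1r.
  rewrite [leRHS](_ : _ = 2 * K1%:R * ((M `^ sigma)^-1 * M `^ sigma)); last by ring.
  by rewrite mulVf ?gt_eqF // mulr1.
rewrite [leRHS](_ : _ = 3000 * (a0%:R + 1) ^+ 2 * (H%:R * (2 * M `^ (- sigma)))); last first.
  by move: (M `^ (- sigma)) => z; ring.
apply: ler_wpM2l; last by rewrite ler_wpM2l.
by apply: mulr_ge0; [rewrite ler0n|exact: sqr_ge0].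
Unshelve. all: by end_near.
Qed.

End diophantine_parameters.

(** * Pair correlation *)

(** Cut into pieces of length [H]. As [F] is nonnegative, the last incomplete piece is majorised by
    a full one reaching beyond the range, at the cost of [H * c]. *)
Lemma average_of_blocks (R : realType) (F : nat -> R) (c e : R) (H N1 L : nat) :
  (forall n, 0 <= F n) -> 0 <= c -> (0 < H)%N ->
  (forall N0, (N1 <= N0 <= N1 + L)%N -> `|\sum_(i < H) F (N0 + i)%N - H%:R * c| <= H%:R * e) ->
  `|\sum_(i < L) F (N1 + i)%N - L%:R * c| <= (L + H)%:R * e + H%:R * c.
Proof.
move=> F0 c0 H0; elim/ltn_ind: L N1 => L IH N1 hb.
have b1 : `|\sum_(i < H) F (N1 + i)%N - H%:R * c| <= H%:R * e.
  by apply: hb; rewrite leqnn leq_addr.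
have H0' : 0 < H%:R :> R by rewrite ltr0n.
have e0 : 0 <= e by rewrite -(pmulr_rge0 _ H0') (le_trans _ b1).
have [LH|HL] := ltnP L H.
  have s1 : \sum_(i < L) F (N1 + i)%N <= \sum_(i < H) F (N1 + i)%N.
    rewrite -[leLHS](big_mkord xpredT (fun i => F (N1 + i)%N)).
    rewrite -[leRHS](big_mkord xpredT (fun i => F (N1 + i)%N)).
    by rewrite [leRHS](@big_cat_nat _ _ _ L) //= ?(ltnW LH) // lerDl sumr_ge0.
  have s0 : 0 <= \sum_(i < L) F (N1 + i)%N by rewrite sumr_ge0.
  have Lc : L%:R * c <= H%:R * c by rewrite ler_wpM2r // ler_nat ltnW.
  have L0 : 0 <= L%:R * c by rewrite mulr_ge0.
  have Le : 0 <= L%:R * e by rewrite mulr_ge0.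
  have He : 0 <= H%:R * e by rewrite mulr_ge0.
  move: b1; rewrite natrD !ler_distl => /andP[_ b1].
  by apply/andP; split; lra.
have [L' LE] : exists L', L = (H + L')%N by exists (L - H)%N; rewrite subnKC.
have hL : (L' < L)%N by rewrite LE -[ltnLHS]add0n ltn_add2r.
have := IH L' hL (N1 + H)%N; rewrite LE big_split_ord /= => h.
have {}h : `|\sum_(i < L') F (N1 + (H + i))%N - L'%:R * c| <= (L' + H)%:R * e + H%:R * c.
  under eq_bigr => i _ do rewrite addnA.
  apply: h => N0 /andP[h1 h2]; apply: hb; rewrite (leq_trans (leq_addr _ _) h1) /=.
  by rewrite LE addnA.
rewrite (_ : _ - _ = (\sum_(i < H) F (N1 + i)%N - H%:R * c)
  + (\sum_(i < L') F (N1 + (H + i))%N - L'%:R * c)); last by rewrite natrD; ring.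
apply: le_trans (ler_normD _ _) _; apply: le_trans (lerD b1 h) _.
by rewrite !natrD; apply: le_of_eq; ring.
Qed.

Lemma sum_ord_lt (N : nat) (f : nat -> nat -> bool) :
  (\sum_(i < N) \sum_(j < N) ((j < i) && f i j)
   = \sum_(1 <= u < N) \sum_(j < N - u) f (j + u) j)%N.
Proof.
rewrite exchange_big /= -(big_mkord xpredT (fun j => \sum_(i < N) ((j < i) && f i j)))%N.
transitivity (\sum_(0 <= j < N) \sum_(1 <= u < N | (u < N - j)%N) f (j + u)%N j)%N.
  apply: eq_big_nat => j /andP[_ jN].
  rewrite -(big_mkord xpredT (fun i => ((j < i)%N && f i j) : nat)).
  rewrite (@big_cat_nat _ _ _ j.+1) //= [X in (X + _)%N]big_nat_cond [X in (X + _)%N]big1 ?add0n; last first.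
    by move=> i /andP[/andP[_ ij] _]; rewrite ltnNge -ltnS ij.
  rewrite -(big_nat_widen 1 (N - j) N xpredT (fun u => f (j + u)%N j : nat)) ?leq_subr //.
  rewrite -add1n big_addn; apply: eq_big_nat => u /andP[u1 _].
  by rewrite [(u + j)%N]addnC -[ltnLHS]addn0 ltn_add2l u1.
rewrite (exchange_big_dep_nat xpredT) //=; apply: eq_big_nat => u /andP[u1 uN].
rewrite -(big_mkord xpredT (fun j => f (j + u)%N j : nat)).
rewrite (big_nat_widen 0 (N - u) N) ?leq_subr //=; apply: congr_big_nat => // j jN.
by rewrite !ltn_subRL addnC.
Qed.

Section pair_counting.
Variable R : realType.
Implicit Types (a b alpha : R) (A : set R).

Definition shifted (N : nat) (A : set R) : set R :=
  [set N%:R^-1 * a + m%:~R | a in A & m in [set: int]].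

Lemma shiftedN (N : nat) (A : set R) (x : R) :
  (- x \in shifted N A) = (x \in shifted N (-%R @^-1` A)).
Proof.
apply/idP/idP; rewrite !inE /shifted => -[y Ay [m _ e]].
  by exists (- y); [rewrite /preimage /= opprK|exists (- m) => //; rewrite intrN mulrN -opprD e opprK].
by exists (- y) => //; exists (- m) => //; rewrite intrN mulrN -opprD e.
Qed.

Lemma pair_correlationE (N : nat) (A : set R) (alpha : R) :
  pair_correlation N A (boxed_phase alpha N) =
  (\sum_(1 <= u < N) \sum_(j < N - u)
      ((boxed_phase alpha N (j + u).+1%:R - boxed_phase alpha N j.+1%:R)%R \in shifted N A)
   + \sum_(1 <= u < N) \sum_(j < N - u)
      ((boxed_phase alpha N (j + u).+1%:R - boxed_phase alpha N j.+1%:R)%R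
         \in shifted N (-%R @^-1` A)))%N%:R / N%:R.
Proof.
rewrite /pair_correlation; congr (_%:R / _).
set phi := boxed_phase alpha N; pose f i j := phi i.+1%:R - phi j.+1%:R \in shifted N A.
rewrite -sum1_card big_mkcond /=.
rewrite (eq_bigr (fun ij : 'I_N * 'I_N => ((ij.2 < ij.1) && f ij.1 ij.2) + ((ij.1 < ij.2) && f ij.1 ij.2)))%N; last first.
  move=> [i j] _; rewrite inE /= -/(f i j) -(inj_eq val_inj) /=.
  by case: ltngtP => _ /=; case: (f i j).
rewrite -(pair_bigA _ (fun i j : 'I_N => ((j < i) && f i j) + ((i < j) && f i j)))%N /=.
under eq_bigr do rewrite big_split /=.
rewrite big_split /= [X in (_ + X)%N]exchange_big /= sum_ord_lt.
rewrite (sum_ord_lt N (fun i j => f j i)); congr (_ + _)%N.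
apply: eq_bigr => u _; apply: eq_bigr => j _; congr (nat_of_bool _).
by rewrite -shiftedN opprB.
Qed.

Lemma boxed_phaseB (N u j : nat) alpha : (0 < N)%N ->
  boxed_phase alpha N (j + u).+1%:R - boxed_phase alpha N j.+1%:R
  = N%:R^-1 * (u%:R * j.+1%:R + u%:R ^+ 2 / 2 - alpha * u%:R).
Proof.
move=> N0; rewrite /boxed_phase -!natr1 natrD; field.
by rewrite pnatr_eq0 -lt0n.
Qed.

(** If the difference is [y / N + m], take [l = u * j.+1 - m * N]; then
    [y = l + u^2 / 2 - alpha * u]. *)
Lemma mem_shifted_has (N u j : nat) a b alpha A : (0 < N)%N -> a <= b ->
  (forall y, A y -> a <= y < b) ->
  (((boxed_phase alpha N (j + u).+1%:R - boxed_phase alpha N j.+1%:R)%R \in shifted N A)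
    <= has (fun l => (N%:Z %| (u%:Z * j.+1%:Z - l)%R)%Z) (Lseq a b alpha u))%N.
Proof.
move=> N0 ab hA; have N0' : N%:R != 0 :> R by rewrite pnatr_eq0 -lt0n.
case: (boolP (_ \in _)) => //; rewrite inE boxed_phaseB // => -[y Ay [m _ e]].
rewrite lt0b; apply/hasP; exists (u%:Z * j.+1%:Z - m * N%:Z); last first.
  by rewrite opprB addrC subrK dvdz_mull.
rewrite mem_Lseq // (_ : _ + _ - _ = y); first exact: hA.
have {}e : y + N%:R * m%:~R = u%:R * j.+1%:R + u%:R ^+ 2 / 2 - alpha * u%:R.
  by apply: (mulfI (invr_neq0 N0')); rewrite -e mulrDr mulKf.
by rewrite intrB !intrM -!pmulrn; lra.
Qed.

Lemma has_mem_shifted (N u j : nat) a b alpha A : (0 < N)%N -> a <= b ->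
  (forall y, a <= y < b -> A y) ->
  (has (fun l => (N%:Z %| (u%:Z * j.+1%:Z - l)%R)%Z) (Lseq a b alpha u) <=
   ((boxed_phase alpha N (j + u).+1%:R - boxed_phase alpha N j.+1%:R)%R \in shifted N A))%N.
Proof.
move=> N0 ab hA; have N0' : N%:R != 0 :> R by rewrite pnatr_eq0 -lt0n.
case: hasP => // -[l]; rewrite mem_Lseq // => hl /dvdzP[m e].
rewrite lt0b inE boxed_phaseB //; exists (l%:~R + u%:R ^+ 2 / 2 - alpha * u%:R); first exact: hA.
exists m => //; have e' : u%:R * j.+1%:R = l%:~R + m%:~R * N%:R :> R.
  by rewrite !pmulrn -!intrM -intrD -e addrC subrK.
by rewrite e'; field.
Qed.

Lemma pair_correlation_le (N : nat) a b a' b' alpha A : (0 < N)%N -> a <= b -> a' <= b' ->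
  (forall y, A y -> a <= y < b) -> (forall y, A y -> a' <= - y < b') ->
  pair_correlation N A (boxed_phase alpha N) <=
  (cplus a b alpha N)%:R / N%:R + (cplus a' b' alpha N)%:R / N%:R.
Proof.
move=> N0 ab ab' h1 h2; rewrite pair_correlationE -mulrDl -natrD ler_wpM2r ?invr_ge0 // ler_nat.
apply: leq_add; apply: leq_sum => u _; apply: leq_sum => j _; apply: mem_shifted_has => // y.
by move=> /h2; rewrite opprK.
Qed.

Lemma pair_correlation_ge (N : nat) a b a' b' alpha A : (0 < N)%N -> a <= b -> a' <= b' ->
  (forall y, a <= y < b -> A y) -> (forall y, a' <= y < b' -> A (- y)) ->
  (cplus a b alpha N)%:R / N%:R + (cplus a' b' alpha N)%:R / N%:R <=
  pair_correlation N A (boxed_phase alpha N).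
Proof.
move=> N0 ab ab' h1 h2; rewrite pair_correlationE -mulrDl -natrD ler_wpM2r ?invr_ge0 // ler_nat.
by apply: leq_add; apply: leq_sum => u _; apply: leq_sum => j _; apply: has_mem_shifted.
Qed.

End pair_counting.

Section averages_over_intervals.
Variable R : realType.
Implicit Types (a b alpha M : R) (A : set R).

Lemma bounded_interval_ends A : is_interval A -> bounded_set A ->
  exists a b : R, [/\ a <= b, forall y, A y -> a <= y <= b,
    forall y, a < y < b -> A y & fine (lebesgue_measure A) = b - a].
Proof.
move=> /is_intervalP AE bA.
have [A0|/set0P [x0 Ax0]] := eqVneq A set0.
  exists 0, 0; rewrite A0; split => //; last by rewrite measure0 /= subrr.
  by move=> y /andP[y1 y2]; have := lt_trans y1 y2; rewrite ltxx.
have [K hK] : exists K : R, forall y, A y -> `|y| <= K.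
  by case: bA => K [_ hK]; exists (K + 1); apply: hK; rewrite ltrDl.
have hl : has_lbound A by exists (- K) => y /hK; rewrite ler_norml => /andP[].
have hu : has_ubound A by exists K => y /hK; rewrite ler_norml => /andP[].
exists (inf A), (sup A); split.
- by apply: (@le_trans _ _ x0); [exact: ge_inf|exact: ub_le_sup].
- by move=> y Ay; apply/andP; split; [exact: ge_inf|exact: ub_le_sup].
- move=> y /andP[y1 y2]; rewrite AE /= /Rhull (asboolT hl) (asboolT hu) in_itv.
  by apply/andP; split; case: asboolP => _ //=; exact: ltW.
rewrite {1}AE lebesgue_measure_itv /Rhull (asboolT hl) (asboolT hu) /= lte_fin.
case: ltP => //= h; apply/eqP; rewrite eq_sym subr_eq0 eq_le h /=.
by apply: (@le_trans _ _ x0); [exact: ge_inf|exact: ub_le_sup].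
Qed.

Lemma fsbig_nat_range (G : nat -> R) (x y : R) : 0 <= x -> x <= y ->
  exists N1 L : nat, [/\ x <= N1%:R, (N1 + L)%:R <= y + 1, y - x - 1 <= L%:R <= y - x + 1 &
    \sum_(N \in [set N : nat | x <= N%:R <= y]%classic) G N = \sum_(i < L) G (N1 + i)%N].
Proof.
move=> x0 xy; have y0 := le_trans x0 xy.
have c0 : 0 <= Num.ceil x by rewrite ceil_ge0 (lt_le_trans _ x0) // ltrN10.
have [N1 N1E] : exists n : nat, Num.ceil x = n%:Z by exists `|Num.ceil x|%N; rewrite gez0_abs.
have := ceil_itv x; rewrite N1E intrB -pmulrn => /andP[x1 x2].
have := truncn_itv y0; set N2 := Num.truncn y => /andP[y1 y2].
have N12 : (N1 <= N2.+1)%N.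
  by rewrite -ltnS -(ltr_nat R) -!natr1; move: y2; rewrite -natr1; lra.
exists N1, (N2.+1 - N1)%N; split => //.
- by rewrite subnKC // -natr1 lerD2r.
- by rewrite natrB //; move: y2; rewrite -natr1 => y2; apply/andP; split; lra.
rewrite (_ : [set N : nat | _] = [set` index_iota N1 N2.+1]).
  rewrite -fsbig_seq ?iota_uniq // -{1}(add0n N1) big_addn big_mkord.
  by apply: eq_bigr => i _; rewrite addnC.
apply/seteqP; split => N /=; rewrite mem_index_iota ltnS truncn_ge_nat //.
  move=> /andP[h ->]; rewrite andbT; have := h.
  by rewrite pmulrn -ceil_le_int N1E lez_nat.
by move=> /andP[h ->]; rewrite andbT (le_trans x2) // ler_nat.
Qed.

Lemma sandwich_average (W eps S L T a b : R) : 0 <= eps -> eps <= 1 -> 1 <= W * eps -> 0 < W ->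
  0 <= T -> 0 <= b - a -> W - 1 <= L <= W + 1 ->
  S <= L * (b - a + eps) + 2 * (W * eps * T) ->
  L * (b - a - eps) - 2 * (W * eps * T) <= S ->
  `|W^-1 * S - (b - a)| <= (b - a + 2 + 2 * T) * eps.
Proof.
move=> e0 e1 We W0 T0 ab /andP[L1 L2] S1 S2.
rewrite (_ : _ - _ = W^-1 * (S - W * (b - a))); last by rewrite mulrBr mulKf ?gt_eqF.
rewrite normrM gtr0_norm ?invr_gt0 // mulrC ler_pdivrMr //.
have h1 : (L - W) * (b - a) <= W * eps * (b - a) by rewrite ler_wpM2r //; lra.
have h2 : (W - L) * (b - a) <= W * eps * (b - a) by rewrite ler_wpM2r //; lra.
have h3 : L * eps <= W * eps * 2.
  by have := ler_wpM2r e0 L2; lra.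
by rewrite ler_norml; apply/andP; split; lra.
Qed.

Lemma cplus_long_average (alpha c d W eps T a0 M : R) (N1 L H : nat) :
  0 <= T -> 0 < eps -> eps <= 1 -> 1 <= W -> W <= M -> (0 < H)%N -> H%:R <= W * eps ->
  L%:R <= W + 1 -> M <= N1%:R -> (N1 + L)%:R <= M + W + 1 ->
  c <= d -> - a0 <= c -> d <= a0 ->
  (forall N0 : nat, M <= N0%:R <= 3 * M ->
    `|\sum_(i < H) (cplus c d alpha (N0 + i))%:R / (N0 + i)%:R - H%:R * (d - c) / 2|
    <= T * (H%:R * eps)) ->
  `|\sum_(i < L) (cplus c d alpha (N1 + i))%:R / (N1 + i)%:R - L%:R * ((d - c) / 2)|
  <= W * eps * (3 * T + a0).
Proof.
move=> T0 eps0 eps1 W1 WM H0 HW L2 N1_ge N1L cd hc hd hblk.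
have c0 : 0 <= (d - c) / 2 by rewrite divr_ge0 // subr_ge0.
apply: le_trans (average_of_blocks (F := fun n => (cplus c d alpha n)%:R / n%:R) (e := T * eps)
  (H := H) _ c0 H0 _) _.
- by move=> n; rewrite divr_ge0.
- move=> N0 /andP[h1 h2]; have N0M : M <= N0%:R <= 3 * M.
    apply/andP; split; first by rewrite (le_trans N1_ge) // ler_nat.
    by apply: (@le_trans _ _ (N1 + L)%:R); [rewrite ler_nat|lra].
  by have := hblk N0 N0M; rewrite !mulrA [T * _]mulrC.
have h1 : H%:R * ((d - c) / 2) <= W * eps * a0 by apply: ler_pM => //; lra.
have We : W * eps <= W by rewrite ger_pMr // (lt_le_trans _ W1).
have h2 : (L + H)%:R * (T * eps) <= 3 * W * (T * eps).
  by rewrite ler_wpM2r ?mulr_ge0 ?(ltW eps0) // natrD; lra.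
by lra.
Qed.

Lemma pair_correlation_sum_bounds (alpha a b eps E a0 : R) (N1 L : nat) A : (0 < N1)%N ->
  a <= b -> (forall y, A y -> a <= y <= b) -> (forall y, a < y < b -> A y) ->
  0 < eps -> eps <= 1 -> - a0 + 1 <= a -> b <= a0 - 1 ->
  (forall c d : R, c <= d -> - a0 <= c -> d <= a0 ->
    `|\sum_(i < L) (cplus c d alpha (N1 + i))%:R / (N1 + i)%:R - L%:R * ((d - c) / 2)| <= E) ->
  let S := \sum_(i < L) pair_correlation (N1 + i) A (boxed_phase alpha (N1 + i)) in
  S <= L%:R * (b - a + eps) + 2 * E /\ L%:R * (b - a - eps) - 2 * E <= S.
Proof.
move=> N10 ab A_le A_ge eps0 eps1 ha hb avg S.
have N1i (i : nat) : (0 < N1 + i)%N by rewrite addn_gt0 N10.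
split.
(* [A] and its reflection may contain their right end points, so the half-open intervals are
   lengthened by [eps]. *)
- have hA1 y : A y -> a <= y < b + eps.
    by move=> /A_le /andP[-> h] /=; rewrite ltr_pwDr.
  have hA2 y : A y -> - b <= - y < - a + eps.
    by move=> /A_le /andP[h1 h2]; apply/andP; split; lra.
  have ab1 : a <= b + eps by lra.
  have ab2 : - b <= - a + eps by lra.
  have := ler_sum (index_enum 'I_L) (P := xpredT)
    (fun i _ => pair_correlation_le alpha (N1i i) ab1 ab2 hA1 hA2).
  rewrite big_split /= -/S => h.
  have a1 : - a0 <= a by lra.
  have a2 : - a + eps <= a0 by lra.
  have a3 : - a0 <= - b by lra.
  have a4 : b + eps <= a0 by lra.
  have := avg _ _ ab1 a1 a4; have := avg _ _ ab2 a3 a2; rewrite !ler_distl.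
  move=> /andP[_ h2] /andP[_ h1]; move: h h1 h2; lra.
(* The minimum and the maximum keep the end points in order when [A] is shorter than [eps]. *)
pose a1 := Num.min (a + eps) b; pose b1 := Num.max (b - eps) a.
have a1b : a1 <= b by rewrite ge_min lexx orbT.
have ab1 : - b1 <= - a by rewrite lerN2 le_max lexx orbT.
have hA1 y : a1 <= y < b -> A y.
  move=> /andP[h1 h2]; apply: A_ge; rewrite h2 andbT.
  by move: h1; rewrite ge_min [b <= y]leNgt h2 orbF; lra.
have hA2 y : - b1 <= y < - a -> A (- y).
  move=> /andP[h1 h2]; apply: A_ge.
  have h3 : a < - y by lra.
  have : - y <= b1 by lra.
  by rewrite h3 /= le_max [- y <= a]leNgt h3 orbF; lra.
have a1_le : a1 <= a + eps by rewrite ge_min lexx.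
have b1_ge : b - eps <= b1 by rewrite le_max lexx.
have a1_ge : a <= a1 by rewrite le_min ab lerDl ltW.
have b1_le : b1 <= b by rewrite ge_max ab gerBl ltW.
have := ler_sum (index_enum 'I_L) (P := xpredT)
  (fun i _ => pair_correlation_ge alpha (N1i i) a1b ab1 hA1 hA2).
rewrite big_split /= -/S => h.
have c1 : - a0 <= a1 by lra.
have c2 : - a <= a0 by lra.
have c3 : - a0 <= - b1 by lra.
have c4 : b <= a0 by lra.
have := avg _ _ a1b c1 c4; have := avg _ _ ab1 c3 c2; rewrite !ler_distl.
move=> /andP[h2 _] /andP[h1 _].
have L0 : 0 <= L%:R :> R by [].
have := ler_wpM2l L0 a1_le; have := ler_wpM2l L0 b1_ge.
by move: h h1 h2; lra.
Qed.

End averages_over_intervals.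

Theorem theorem1p4 (R : realType) (kappa eta : R)
    (heta : Num.max (17 / 18) (1 - 2 / (9 * kappa)) < eta <= 1) :
  exists2 s : R, 0 < s &
    forall (alpha : R), diophantine kappa alpha ->
    forall (A : set R), is_interval A -> bounded_set A ->
      (fun M : R =>
         (M `^ eta)^-1 *
           (\sum_(N \in [set N : nat | M <= N%:R <= M + M `^ eta]%classic)
              pair_correlation N A (boxed_phase alpha N))
         - fine (lebesgue_measure A))
      =O_ (+oo_R) (fun M : R => M `^ (- s)).
Proof.
have /andP[] := heta; rewrite gt_max => /andP[eta17 eta_kappa] eta1.
(* Raising the type weakens the Diophantine condition, and at type 2 the second lower bound for
   [eta] is [8 / 9 < 17 / 18]. *)
pose kappa' : R := Num.max kappa 2; pose k := (Num.truncn kappa').+1.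
have kappa2 : 2 <= kappa' by rewrite le_max lexx orbT.
have kappa_k : kappa' <= k%:R.
  have k0 : 0 <= kappa' := le_trans (ler0n R 2) kappa2.
  by have /andP[_ /ltW] := truncn_itv k0.
have eta_kappa' : 1 - 2 / (9 * kappa') < eta.
  rewrite /kappa' maxEle; case: ifP => // _; lra.
pose D := ((100 * k.+1) ^ 2)%N; pose s : R := D%:R^-1.
have D0 : 0 < D%:R :> R by rewrite ltr0n.
have s0 : 0 < s by rewrite invr_gt0.
have s100 : s * 100 <= 1.
  rewrite /s ler_pdivrMl // mulr1 ler_nat /D; clear; nia.
exists s => // alpha [_ kappa0 [C C0 hC]] A iA bA.
have [a [b [ab A_le A_ge ->]]] := bounded_interval_ends iA bA.
(* The summand 1 leaves room for end points moved by [eps <= 1]. *)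
pose a0 := (Num.truncn (`|alpha| + `|a| + `|b| + 1)).+1.
have a0_ge : `|alpha| + `|a| + `|b| + 1 <= a0%:R.
  have h : 0 <= `|alpha| + `|a| + `|b| + 1 by rewrite !addr_ge0.
  by have /andP[_ /ltW] := truncn_itv h.
have al0 := normr_ge0 alpha; have al := normr_ge0 a; have bl := normr_ge0 b.
have a_b : - `|a| <= a /\ a <= `|a| by rewrite lerNnormlW // ler_norm.
have b_b : - `|b| <= b /\ b <= `|b| by rewrite lerNnormlW // ler_norm.
case: a_b b_b => aN aP [bN bP].
have hC' (p : int) (q : nat) : (0 < q)%N -> C / q%:R `^ kappa' < `|alpha - p%:~R / q%:R|.
  move=> q0; apply: le_lt_trans (hC p q q0); rewrite ler_pM2l //.
  have q0' : 0 < q%:R :> R by rewrite ltr0n.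
  by rewrite lef_pV2 ?posrE ?powR_gt0 // ler_powR ?ler1n // le_max lexx.
have alpha_le : `|alpha| <= a0%:R by lra.
have a_ge : - a0%:R + 1 <= a by lra.
have b_le : b <= a0%:R - 1 by lra.
have hblk := block_average_eventually kappa2 kappa_k eta17 eta_kappa' eta1 C0 hC' alpha_le.
have T1 : 0 <= 2 * 3000 * (a0%:R + 1) ^+ 2 :> R.
  by apply: mulr_ge0; [rewrite -natrM ler0n|exact: sqr_ge0].
move: (2 * 3000 * (a0%:R + 1) ^+ 2) T1 hblk => T1 T10 hblk.
pose T : R := 3 * T1 + a0%:R.
have T0 : 0 <= T by rewrite addr_ge0 ?ler0n // mulr_ge0 ?ler0n.
have ba0 : 0 <= b - a by rewrite subr_ge0.
apply/eqO_exP; exists (b - a + 2 + 2 * T); first by rewrite ltr_pwDl // ?mulr_ge0 // ltr_wpDl.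
pose theta := eta - 4 / D%:R.
have th0 : 0 < theta by rewrite /theta -/s; lra.
near=> M.
rewrite (ger0_norm (powR_ge0 _ _)).
have M1 : 1 <= M by near: M; exact: nbhs_pinfty_ge.
have M0 : 0 < M by exact: lt_le_trans M1.
set W := M `^ eta; set eps := M `^ (- s).
have W0 : 0 < W by exact: powR_gt0.
have eps0 : 0 < eps by exact: powR_gt0.
have Weps : W * eps = M `^ (eta - s) by rewrite powRD // (gt_eqF M0) implybT.
have Weps1 : 1 <= W * eps by rewrite Weps; near: M; apply: powR_eventually_ge; lra.
have eps1 : eps <= 1 by rewrite -(powRr0 M) ler_powR // oppr_le0 ltW.
have W1 : 1 <= W by apply: le_trans Weps1 _; rewrite ger_pMr.
have WM : W <= M by exact: ler1_powR.
set H := Num.truncn (M `^ theta).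
(* As [eta - 4 * s <= eta - s], one incomplete block is within the admissible error. *)
have Hth : M `^ theta <= W * eps by rewrite Weps ler_powR // lerD2l lerN2 ler_peMl ?ler1n // ltW.
have HW : H%:R <= W * eps.
  by apply: le_trans Hth; rewrite truncn_le powR_ge0.
have H0 : (0 < H)%N.
  rewrite truncn_gt0; near: M; exact: powR_eventually_ge.
have MW : M <= M + W by rewrite lerDl ltW.
have [N1 [L [N1_ge N1L /andP[L1 L2] ->]]] :=
  fsbig_nat_range (fun N => pair_correlation N A (boxed_phase alpha N)) (ltW M0) MW.
have hblkM : forall a b : R, a <= b -> - a0%:R <= a -> b <= a0%:R ->
    forall N0 : nat, M <= N0%:R <= 3 * M ->
    `|\sum_(i < H) (cplus a b alpha (N0 + i))%:R / (N0 + i)%:R - H%:R * (b - a) / 2|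
    <= T1 * (H%:R * eps).
  by rewrite /H /eps; near: M; exact: hblk.
have avg (c d : R) : c <= d -> - a0%:R <= c -> d <= a0%:R ->
    `|\sum_(i < L) (cplus c d alpha (N1 + i))%:R / (N1 + i)%:R - L%:R * ((d - c) / 2)|
    <= W * eps * T.
  move=> cd hc hd; apply: (@cplus_long_average R alpha c d W eps T1 a0%:R M N1 L H) => //.
  - by move: L2; rewrite [M + W]addrC addrK.
  - exact: hblkM.
have N10 : (0 < N1)%N by rewrite -(ltr0n R) (lt_le_trans M0 N1_ge).
have [S1 S2] := pair_correlation_sum_bounds N10 ab A_le A_ge eps0 eps1 a_ge b_le avg.
apply: (@sandwich_average R W eps _ L%:R T a b) => //; first exact: ltW.
by move: L1 L2; rewrite [M + W]addrC addrK => -> ->.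
Unshelve. all: by end_near.
Qed.
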